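(* Assuming the Strong Exponential Time Hypothesis (SETH), for every $\varepsilon>0$ there is no algorithm that solves \textsc{Upper Dominating Set} in time $O^*((6-\varepsilon)^{pw})$, where $pw$ is the pathwidth of the input graph.
   Context: Let $G=(V,E)$ be a graph. A set $D\subseteq V$ is dominating if every vertex of $V$ is in $D$ or adjacent to a vertex of $D$. An upper dominating set is an inclusion-minimal dominating set. \textsc{Upper Dominating Set}: given a graph $G$ (and an integer $k$), find a maximum-size upper dominating set (decide whether one of size at least $k$ exists). $O^*$ suppresses factors polynomial in the input size. SETH: for every $\delta<1$ there is $q$ such that $q$-SAT on $n$ variables cannot be solved in time $O(2^{\delta n})$. *)

(* Defs.v *)
From HB Require Import structures.
From mathcomp Require Import all_boot all_order all_algebra.
From mathcomp Require Import boolp reals exp.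

Set Implicit Arguments.
Unset Strict Implicit.
Unset Printing Implicit Defensive.

Import Order.TTheory GRing.Theory Num.Theory.

(** * Algorithms and running time

    Algorithms are programs of N. D. Jones's WHILE language over binary trees
    (pure LISP without recursion), with one time unit per elementary operation.
    Exponential lower bounds with a precise base are sensitive to the machine
    model, but only beyond factors polynomial in the input size.  With shared
    subtrees every operation below takes constant time on a RAM with
    logarithmic word size; conversely such a RAM running for t steps is
    simulated with overhead polynomial in log t, its memory being kept in a
    balanced tree.  For t at most exponential in the input size this is a
    polynomial factor, so "in time 2^(d n) for some d < 1" and
    "in time O*(c^pw)" mean the same as on a word RAM. *)

Inductive tree := Leaf | Node of tree & tree.

Fixpoint tree_size (u : tree) : nat :=
  if u is Node l r then (tree_size l + tree_size r).+1 else 1.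

Definition lsub (u : tree) : tree := if u is Node l _ then l else Leaf.
Definition rsub (u : tree) : tree := if u is Node _ r then r else Leaf.

Inductive expr :=
  | EVar of nat
  | ENil
  | ECons of expr & expr
  | EHd of expr
  | ETl of expr.

Inductive program :=
  | Assign of nat & expr
  | Seq of program & program
  | If of expr & program & program
  | While of expr & program.

Definition store := nat -> tree.

Definition update (s : store) (x : nat) (u : tree) : store :=
  fun y => if y == x then u else s y.

Fixpoint eval (s : store) (a : expr) : tree :=
  match a with
  | EVar x => s x
  | ENil => Leaf
  | ECons a1 a2 => Node (eval s a1) (eval s a2)
  | EHd a1 => lsub (eval s a1)
  | ETl a1 => rsub (eval s a1)
  end.

Fixpoint eval_time (a : expr) : nat :=
  match a with
  | EVar _ | ENil => 1
  | ECons a1 a2 => (eval_time a1 + eval_time a2).+1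
  | EHd a1 | ETl a1 => (eval_time a1).+1
  end.

Definition truth (u : tree) : bool := if u is Node _ _ then true else false.

(** [exec p s t s']: started in [s], [p] halts in [s'] after [t] time units. *)
Inductive exec : program -> store -> nat -> store -> Prop :=
  | ExecAssign s x a :
      exec (Assign x a) s (eval_time a).+1 (update s x (eval s a))
  | ExecSeq p1 p2 s1 s2 s3 t1 t2 :
      exec p1 s1 t1 s2 -> exec p2 s2 t2 s3 -> exec (Seq p1 p2) s1 (t1 + t2) s3
  | ExecIfTrue a p1 p2 s s' t :
      truth (eval s a) -> exec p1 s t s' ->
      exec (If a p1 p2) s (eval_time a + t).+1 s'
  | ExecIfFalse a p1 p2 s s' t :
      ~~ truth (eval s a) -> exec p2 s t s' ->
      exec (If a p1 p2) s (eval_time a + t).+1 s'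
  | ExecWhileTrue a p s1 s2 s3 t1 t2 :
      truth (eval s1 a) -> exec p s1 t1 s2 -> exec (While a p) s2 t2 s3 ->
      exec (While a p) s1 (eval_time a + t1 + t2).+1 s3
  | ExecWhileFalse a p s :
      ~~ truth (eval s a) -> exec (While a p) s (eval_time a).+1 s.

Definition computes (p : program) (input : tree) (t : nat) (output : tree) :
    Prop :=
  exists2 s, exec p (update (fun=> Leaf) 0 input) t s & s 0 = output.

Record problem := Problem {
  instance : Type;
  encode : instance -> tree;
  solution : instance -> tree -> Prop }.

Definition solvable_in_time (R : realType) (P : problem)
    (f : instance P -> R) : Prop :=
  exists p : program, forall x : instance P, exists (t : nat) (out : tree),
    [/\ computes p (encode x) t out, solution x out & (t%:R <= f x)%R].

(** Polynomial factors are bounded by [C * size ^ d], as [tree_size] is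
    positive. *)
Definition solvable_in_time_star (R : realType) (P : problem)
    (f : instance P -> R) : Prop :=
  exists (C : R) (d : nat),
    solvable_in_time (fun x : instance P =>
      C * (tree_size (encode x))%:R ^+ d * f x)%R.

Definition tree_of_bool (b : bool) : tree := if b then Node Leaf Leaf else Leaf.

(** Unary; all the numbers encoded below are linear in the number of variables
    or vertices (a threshold exceeding the number of vertices is trivial). *)
Definition tree_of_nat (n : nat) : tree := iter n (Node Leaf) Leaf.

Definition tree_of_seq (A : Type) (f : A -> tree) (s : seq A) : tree :=
  foldr (fun x u => Node (f x) u) Leaf s.

(** * Satisfiability and SETH *)

(** The literal [(x, b)] holds under [a] when [a x = b].  A formula is a set of
    clauses: repetitions are excluded, so that a q-CNF on n variables has at
    most (2 n + 1)^q clauses and a running time depending on n alone is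
    meaningful. *)
Record qcnf (q : nat) := QCNF {
  nvars : nat;
  clauses : seq (seq ('I_nvars * bool));
  clauses_uniq : uniq clauses;
  clauses_width : all (fun c => size c <= q) clauses }.

Definition satisfiable (q : nat) (phi : qcnf q) : bool :=
  [exists a : {ffun 'I_(nvars phi) -> bool},
     all (has (fun l => a l.1 == l.2)) (clauses phi)].

Definition tree_of_qcnf (q : nat) (phi : qcnf q) : tree :=
  Node (tree_of_nat (nvars phi))
    (tree_of_seq
       (tree_of_seq (fun l : 'I_(nvars phi) * bool =>
          Node (tree_of_nat l.1) (tree_of_bool l.2)))
       (clauses phi)).

Definition SAT (q : nat) : problem :=
  @Problem (qcnf q) (@tree_of_qcnf q)
    (fun phi out => out = tree_of_bool (satisfiable phi)).

Definition SETH (R : realType) : Prop :=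
  forall delta : R, (delta < 1)%R ->
    exists q : nat, ~ exists C : R,
      solvable_in_time (fun phi : instance (SAT q) =>
        C * powR 2 (delta * (nvars phi)%:R))%R.

(** * Graphs *)

Record graph := Graph {
  nverts : nat;
  adj : rel 'I_nverts;
  adj_sym : symmetric adj;
  adj_irrefl : irreflexive adj }.
Arguments adj : clear implicits.

Definition path_decomposition (G : graph) (B : seq {set 'I_(nverts G)}) :
    Prop :=
  [/\ forall x, exists2 X, X \in B & x \in X,
      forall x y, adj G x y -> exists2 X, X \in B & (x \in X) && (y \in X)
    & forall i j k, i <= j -> j <= k -> k < size B ->
        nth set0 B i :&: nth set0 B k \subset nth set0 B j].

(** Predecessor is truncated: the graph without vertices gets pathwidth 0. *)
Definition width (G : graph) (B : seq {set 'I_(nverts G)}) : nat :=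
  (\max_(X <- B) #|X|).-1.

Lemma has_path_decomposition (G : graph) :
  exists w, `[< exists2 B, @path_decomposition G B & width B = w >].
Proof.
exists (width [:: [set: 'I_(nverts G)]]); apply/asboolP.
exists [:: [set: 'I_(nverts G)]] => //; split=> [x|x y _|i j k ij jk].
- by exists setT; rewrite ?inE.
- by exists setT; rewrite ?inE.
- rewrite ltnS leqn0 => /eqP k0; move: jk; rewrite k0 leqn0 => /eqP j0.
  by move: ij; rewrite j0 leqn0 => /eqP ->; rewrite setIid.
Qed.

Definition pathwidth (G : graph) : nat := ex_minn (has_path_decomposition G).

Definition dominating (G : graph) (D : {set 'I_(nverts G)}) : bool :=
  [forall x, (x \in D) || [exists y in D, adj G y x]].
Arguments dominating : clear implicits.

Definition upper_dominating (G : graph) (D : {set 'I_(nverts G)}) : bool :=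
  minset (dominating G) D.
Arguments upper_dominating : clear implicits.

Definition tree_of_graph (G : graph) : tree :=
  tree_of_seq (tree_of_seq tree_of_bool)
    [seq [seq adj G x y | y <- enum 'I_(nverts G)] | x <- enum 'I_(nverts G)].

Definition tree_of_set (n : nat) (D : {set 'I_n}) : tree :=
  tree_of_seq tree_of_bool [seq x \in D | x <- enum 'I_n].

Definition UpperDominatingSet_decision : problem :=
  @Problem (graph * nat)
    (fun x => Node (tree_of_graph x.1) (tree_of_nat x.2))
    (fun x out => out = tree_of_bool
       [exists D, upper_dominating x.1 D && (x.2 <= #|D|)]).

Definition UpperDominatingSet_search : problem :=
  @Problem graph tree_of_graph
    (fun G out => exists D : {set 'I_(nverts G)},
       [/\ out = tree_of_set D, upper_dominating G D
         & forall D', upper_dominating G D' -> #|D'| <= #|D|]).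

(* Main.v *)
Require Import Defs.
From HB Require Import structures.
From mathcomp Require Import all_boot all_order all_algebra zify ring lra.
From mathcomp Require Import boolp reals sequences exp.

(** An algorithm running in time [O*(c ^ pw)] with [c < 6] is turned into one for
    q-SAT running in time [O(2 ^ (delta n))] with [delta < 1].

    A vertex [s] of a minimal dominating set [D], seen from one side of a cut
    through it, presents one of six behaviours.  If [s] is in [D]: it has a private
    neighbour on that side (A2), or neighbours in [D] only (A1), or neither (A0).
    If [s] is not in [D]: it is dominated from that side (B2), or is there the only
    private neighbour of a member of [D] (B1), or has no neighbour in [D] (B0).
    Pairing the behaviours of the two sides as in the table below gives six types
    per cut vertex, so that [p] cut vertices ("columns") carry [6 ^ p >= 2 ^ gamma]
    values, enough for a group of [gamma] variables.  The graph is a sequence of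
    blocks of bounded size; each block reads the columns of one group, together
    with a carry bit for the truth of the current clause, and hands them on to the
    next block of that group.  One vertex per column and one block fit in a bag,
    so the pathwidth is [n p / gamma + O(1)], which is close to [n / log2 6].

    A mismatch between two consecutive blocks either costs a vertex of the
    solution or moves the type of the column up in a linear order.  The clauses
    are therefore repeated often enough that some repetition sees constant types,
    and the assignment read off there is satisfying. *)

Set Implicit Arguments.
Unset Strict Implicit.
Unset Printing Implicit Defensive.

(** * Gadget blocks *)

(** Minimality amounts to the existence of private neighbours and is therefore local, but nothing
    local stops a block from misreading its wires. The size of the solution does: a wire is counted
    with the block it enters, a block contributes at most [weight] vertices, and the threshold is
    [T * weight], so a solution that reaches it is extremal in every block, which fixes what the
    block sees at each port. Agreement of the two ends of a wire still cannot be forced: a wire in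
    the solution may well have private neighbours on both sides. What is excluded is a mismatch in
    the other direction, which leaves a selected wire without a private neighbour or dominates a
    private neighbour twice; monotonicity along a column is all that remains. The reduction must
    also be an explicit program. This is feasible because the group size and [p] depend on the base
    only: the adjacency tables of a block are constants of the program, and only block kinds and
    unary block numbers are computed from the formula. *)

Section MinimalDomination.
Variables (V : finType) (e : rel V).

(** Adjacency is taken reflexively because a vertex of [D] may be its own private neighbour; wires
    of type 1 are. *)
Definition nbh (x y : V) := (x == y) || e x y.

Definition covered (D : {set V}) (x : V) := exists2 y, y \in D & nbh y x.

Definition private (D : {set V}) (x y : V) :=
  nbh x y /\ forall z, z \in D -> nbh z y -> z = x.

Definition mindom (D : {set V}) :=
  (forall x, covered D x) /\ (forall x, x \in D -> exists y, private D x y).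
End MinimalDomination.

(* The types [w] of a wire, as (behaviour towards the block it leaves, behaviour
   towards the block it enters):
     0 = (A2, A1)   1 = (A0, A0)   2 = (A1, A2)
     3 = (B0, B1)   4 = (B2, B2)   5 = (B1, B0)
   The numbering is the order along which mismatches are free of charge.  The
   boolean [side] is true at the block entered; [priv], [rely] and [dom] recognize
   A2, B1, and A1 or B2. *)
Definition isA (w : nat) := w < 3.
Definition priv (side : bool) (w : nat) := w == (if side then 2 else 0).
Definition rely (side : bool) (w : nat) := w == (if side then 3 else 5).
Definition dom (side : bool) (w : nat) := (w == 4) || (w == if side then 0 else 2).

(* Six gain vertices per port reward a block for agreeing with its wire: kinds 0
   and 1 are lost to a wire in the solution under a type B, kind 2 makes up for
   them under a type A, kinds 3 and 4 are lost to an unwanted [y], and kind 5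
   makes up for them under B1. *)
Definition blkz (k : nat) (side : bool) (w : nat) :=
  match k with
  | 0 => isA w
  | 1 => side && isA w
  | 2 => ~~ isA w
  | 3 | 4 => rely side w
  | _ => ~~ rely side w
  end.
Definition blks (k : nat) (side : bool) := (k == 0) || ((k == 1) && side).
Definition blky (k : nat) := (k == 3) || (k == 4).

Section Network.
Variables (M K : nat) (P S : finType).

Definition port : finType := (bool * P)%type.
Definition item : finType := ('I_M + port * 'I_6)%type.
Definition cq : finType := (unit + (item + port))%type.
(* The vertices of a block.  Two cliques [Q] and [C] are joined by a matching
   between their [core] and [gain] vertices; a solution of maximum size uses [Q],
   with private neighbours in [C], and no vertex of [C].  The [hub] of [Q] has no
   partner: something in [Q] must dominate it, which rules out the mirror
   solution using [C].  The [hub] of [C] forces some [Zn s] into the solution,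
   selecting the configuration [s]; each [Zn s] has [K] leaves, so that selecting
   two is too expensive.  At a port, [aux] is the vertex [y] of [Q] whose private
   neighbour can only be the wire, and in [C] the possible private neighbour of
   the wire.  [In j] is the wire entering the block at [j]. *)
Definition loc : finType := (((cq + cq) + (S + S * 'I_K)) + P)%type.

Notation Qn a := (inl (inl (inl a))).
Notation Cn a := (inl (inl (inr a))).
Notation Zn s := (inl (inr (inl s))).
Notation Ln s k := (inl (inr (inr (s, k)))).
Notation In j := (inr j).
Notation hub := (inl tt).
Notation core i := (inr (inl (inl i))).
Notation gain pt k := (inr (inl (inr (pt, k)))).
Notation aux pt := (inr (inr pt)).

Definition template := S -> port -> 'I_6.

(** A selected [aux] vertex dominates the partners of the gain vertices of kinds 3 and 4. It costs
    these two and yields one, unless the selected configuration has already dominated the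
    partners. *)
Definition qc (a b : cq) : bool :=
  match a, b with
  | inr (inl i), inr (inl j) => i == j
  | aux pt, gain pt' k => (pt == pt') && blky k
  | _, _ => false
  end.

(** Exactly under A2 the [aux] vertex of [C] is left alone by the configuration, so that it can be
    private to the wire. The core of [C] is left alone as well, which forces the core of [Q] into
    the solution. *)
Definition zc (f : port -> 'I_6) (b : cq) : bool :=
  match b with
  | hub => true
  | core _ => false
  | gain pt k => blkz k pt.1 (f pt)
  | aux pt => ~~ priv pt.1 (f pt)
  end.

Definition sadj (tau : template) (l : loc) (pt : port) : bool :=
  match l with
  | Qn (aux pt') => pt' == pt
  | Cn (aux pt') => pt' == pt
  | Cn (gain pt' k) => (pt' == pt) && blks k pt.1
  | Zn s => dom pt.1 (tau s pt)
  | _ => false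
  end.

Definition intra (tau : template) (l l' : loc) : bool :=
  match l, l' with
  | Qn a, Qn b => a != b
  | Cn a, Cn b => a != b
  | Qn a, Cn b => qc a b
  | Zn s, Cn b => zc (tau s) b
  | Zn s, Ln s' _ => s == s'
  | _, In j => sadj tau l (true, j)
  | _, _ => false
  end.

Definition inter (tau : template) (l l' : loc) (j : P) : bool :=
  if l' is In j' then (j == j') && sadj tau l (false, j) else false.

Variables (T : nat) (link : 'I_T -> 'I_T -> P -> bool) (tau : 'I_T -> template).

Definition vert : finType := ('I_T * loc)%type.

Definition garc (u v : vert) : bool :=
  ((u.1 == v.1) && intra (tau u.1) u.2 v.2)
  || [exists j, link u.1 v.1 j && inter (tau u.1) u.2 v.2 j].

Definition edge (u v : vert) := garc u v || garc v u.

Lemma edge_sym : symmetric edge.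
Proof. by move=> u v; rewrite /edge orbC. Qed.

Lemma edge_irrefl : irreflexive edge.
Proof.
case=> t l; rewrite /edge orbb /garc /= eqxx /=; apply/norP; split.
  by case: l => [[[a|a]|[s|[s k]]]|j] /=; rewrite ?eqxx.
apply/negP => /existsP[j]; rewrite /inter; case: l => [l|j'] /=; first by rewrite andbF.
by rewrite !andbF.
Qed.

Lemma arc_In t l t' j : garc (t, l) (t', In j) =
  ((t == t') && sadj (tau t) l (true, j)) || (link t t' j && sadj (tau t) l (false, j)).
Proof.
rewrite /garc /=; congr (_ || _).
  by congr (_ && _); case: l => [[[a|a]|[s|[s k]]]|j'].
apply/existsP/idP => [[i /andP[li]]|/andP[lk sa]]; last by exists j; rewrite lk /= eqxx.
by rewrite /inter /= => /andP[/eqP ij sa]; rewrite -ij li.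
Qed.

Lemma arc_loc t l t' l' : garc (t, l) (t', inl l') = (t == t') && intra (tau t) l (inl l').
Proof.
rewrite /garc /=; case: existsP => [[j]|_]; rewrite ?orbF // /inter /=.
by rewrite andbF.
Qed.

Lemma arc_from_In t j v : garc (t, In j) v = false.
Proof.
case: v => t' [l|j']; last by rewrite arc_In /= !andbF.
by rewrite arc_loc /=; case: l => [[a|a]|[s|[s k]]]; rewrite andbF.
Qed.

Lemma edge_In v t j : edge v (t, In j) = garc v (t, In j).
Proof. by rewrite /edge arc_from_In orbF. Qed.

Lemma nbh_sym u v : nbh edge u v = nbh edge v u.
Proof. by rewrite /nbh eq_sym edge_sym. Qed.

(** A wire vertex belongs to the block it enters, so the port of a leaving wire looks it up in the
    successor block. *)
Definition attached (t : 'I_T) (pt : port) (t' : 'I_T) :=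
  if pt.1 then t == t' else link t t' pt.2.

Lemma arc_InP t l t' j : reflect
  (exists side, attached t (side, j) t' /\ sadj (tau t) l (side, j))
  (garc (t, l) (t', In j)).
Proof.
rewrite arc_In; apply: (iffP orP) => [[]/andP[]|[[] /= []]].
- by move=> tt' sa; exists true.
- by move=> lk sa; exists false.
- by rewrite /attached /= => -> ->; left.
- by rewrite /attached /= => -> ->; right.
Qed.

Lemma nbhQ t a v : nbh edge v (t, Qn a) ->
  [\/ exists b, v = (t, Qn b), exists2 b, v = (t, Cn b) & qc a b
    | exists pt t', [/\ v = (t', In pt.2), a = aux pt & attached t pt t']].
Proof.
rewrite /nbh => /orP[/eqP->|]; first by constructor 1; exists a.
case: v => t' [[[b|b]|[s|[s k]]]|j]; rewrite /edge.
- by rewrite !arc_loc /= => /orP[]/andP[/eqP-> _]; constructor 1; exists b.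
- by rewrite !arc_loc /= andbF => /andP[/eqP<- qab]; constructor 2; exists b.
- by rewrite !arc_loc /= !andbF.
- by rewrite !arc_loc /= !andbF.
rewrite arc_from_In /= => /arc_InP[side [att]] /=.
case: a => [//|[//|pt /eqP ptE]]; constructor 3; exists pt, t'.
by rewrite ptE.
Qed.

Lemma nbhC t a v : nbh edge v (t, Cn a) ->
  [\/ exists b, v = (t, Cn b), exists2 b, v = (t, Qn b) & qc b a,
      exists2 s, v = (t, Zn s) & zc (tau t s) a
    | exists pt t', [/\ v = (t', In pt.2), attached t pt t'
         & a = aux pt \/ exists2 k, a = gain pt k & blks k pt.1]].
Proof.
rewrite /nbh => /orP[/eqP->|]; first by constructor 1; exists a.
case: v => t' [[[b|b]|[s|[s k]]]|j]; rewrite /edge.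
- by rewrite !arc_loc /= andbF orbF => /andP[/eqP-> qab]; constructor 2; exists b.
- by rewrite !arc_loc /= => /orP[]/andP[/eqP-> _]; constructor 1; exists b.
- by rewrite !arc_loc /= andbF orbF => /andP[/eqP-> qab]; constructor 3; exists s.
- by rewrite !arc_loc /= !andbF.
rewrite arc_from_In /= => /arc_InP[side [att]] /=.
case: a => [//|[[//|[pt k]]|pt]].
  case/andP => /eqP ptE bs; constructor 4; exists pt, t'; rewrite ptE; split=> //.
  by right; exists k.
by move/eqP => ptE; constructor 4; exists pt, t'; rewrite ptE; split=> //; left.
Qed.

Lemma nbhL t s k v : nbh edge v (t, Ln s k) -> v = (t, Ln s k) \/ v = (t, Zn s).
Proof.
rewrite /nbh => /orP[/eqP->|]; first by left.
case: v => t' [[[b|b]|[s'|[s' k']]]|j]; rewrite /edge ?arc_from_In ?arc_loc /= ?andbF //=.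
  by rewrite orbF => /andP[/eqP-> /eqP->]; right.
by case/arc_InP=> side [].
Qed.

Lemma nbhI t j v : nbh edge v (t, In j) -> v = (t, In j) \/ garc v (t, In j).
Proof. by rewrite /nbh => /orP[/eqP->|]; [left | rewrite edge_In; right]. Qed.

Lemma nbh_refl v : nbh edge v v. Proof. by rewrite /nbh eqxx. Qed.

Lemma nbhQQ t a b : nbh edge (t, Qn a) (t, Qn b).
Proof.
rewrite /nbh /edge !arc_loc /= eqxx /=.
by case: (eqVneq a b) => [->|ab]; rewrite ?eqxx // orbT.
Qed.

Lemma nbhCC t a b : nbh edge (t, Cn a) (t, Cn b).
Proof.
rewrite /nbh /edge !arc_loc /= eqxx /=.
by case: (eqVneq a b) => [->|ab]; rewrite ?eqxx // orbT.
Qed.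

Lemma nbhQC t a b : qc a b -> nbh edge (t, Qn a) (t, Cn b).
Proof. by rewrite /nbh /edge !arc_loc /= eqxx => ->; rewrite orbT. Qed.

Lemma nbhZC t s b : zc (tau t s) b -> nbh edge (t, Zn s) (t, Cn b).
Proof. by rewrite /nbh /edge !arc_loc /= eqxx => ->; rewrite orbT. Qed.

Lemma nbhZL t s k : nbh edge (t, Zn s) (t, Ln s k).
Proof. by rewrite /nbh /edge !arc_loc /= !eqxx orbT. Qed.

Lemma nbh_In t pt t' l : attached t pt t' -> sadj (tau t) l pt ->
  nbh edge (t, l) (t', In pt.2).
Proof.
move=> att sa; rewrite /nbh edge_In; apply/orP; right; apply/arc_InP.
by exists pt.1; rewrite -surjective_pairing.
Qed.

Hypothesis link_fun : forall t t' t'' j, link t t' j -> link t t'' j -> t' = t''.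
Hypothesis link_inj : forall t t' u j, link t t' j -> link u t' j -> t = u.

Lemma attached_fun t pt t' t'' : attached t pt t' -> attached t pt t'' -> t' = t''.
Proof.
rewrite /attached; case: ifP => _; last exact: link_fun.
by move/eqP<- => /eqP<-.
Qed.

Lemma attached_inj t pt t' u : attached t pt t' -> attached u pt t' -> t = u.
Proof.
rewrite /attached; case: ifP => _; last exact: link_inj.
by move/eqP-> => /eqP->.
Qed.

(** * A minimal dominating set inside one block *)

Section Block.
Variables (D : {set vert}) (t : 'I_T).
Hypothesis mdD : mindom edge D.
Hypothesis K_gt0 : 0 < K.
Hypothesis M_gt1 : 1 < M.

Definition wireD (pt : port) := [exists t', attached t pt t' && ((t', In pt.2) \in D)].

Lemma leafE s k : ((t, Ln s k) \in D) = ((t, Zn s) \notin D).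
Proof.
case: mdD => cov prv; apply/idP/idP => [lD|zD].
  apply/negP => zD; have [y [ny py]] := prv _ lD.
  have nzy : nbh edge (t, Zn s) y.
    by move: ny; rewrite nbh_sym => /nbhL[]->; [apply: nbhZL | apply: nbh_refl].
  by have := py _ zD nzy.
have [y yD] := cov (t, Ln s k); move/nbhL => [yE|yE]; rewrite -?yE //.
by rewrite -yE yD in zD.
Qed.

(** [Zn s] is dominated within its own star, by itself or by a leaf, hence is private to nothing
    outside the stars. *)
Lemma not_private_Z v s : (forall s', v <> (t, Zn s')) -> (forall s' k, v <> (t, Ln s' k)) ->
  v \in D -> ~ private edge D v (t, Zn s).
Proof.
move=> nz nl vD [nvz pv]; case: (boolP ((t, Zn s) \in D)) => zD.
  by apply: (nz s); rewrite (pv _ zD (nbh_refl _)).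
pose k0 := Ordinal K_gt0; have lD : (t, Ln s k0) \in D by rewrite leafE.
by apply: (nl s k0); rewrite (pv _ lD _) // nbh_sym nbhZL.
Qed.

Lemma Q_ex : exists a, (t, Qn a) \in D.
Proof.
have [y yD] := mdD.1 (t, Qn hub); move/nbhQ => [[b yE]|[b _]//|[pt [t' []]]//].
by exists b; rewrite -yE.
Qed.

Lemma Q_private a a' : (t, Qn a) \in D -> (t, Qn a') \in D -> a != a' ->
  (exists b, qc a b /\ private edge D (t, Qn a) (t, Cn b)) \/
  (exists pt t', [/\ a = aux pt, attached t pt t' & private edge D (t, Qn a) (t', In pt.2)]).
Proof.
move=> aD a'D aa'; have [y [ny py]] := mdD.2 _ aD.
move: (ny); rewrite nbh_sym => /nbhQ [[b yE]|[b yE qab]|[pt [t' [yE aE att]]]].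
- by have := py _ a'D; rewrite yE nbhQQ => /(_ isT) [] /esym/eqP; rewrite (negPf aa').
- by left; exists b; split=> //; rewrite -yE.
- by right; exists pt, t'; split=> //; rewrite -yE.
Qed.

(** Some vertex of [Q] and a second one of [C] are selected, so neither clique contains a private
    neighbour of [c], and configuration vertices never serve as one. Only a wire is left. *)
Lemma C_private c c' : (t, Cn c) \in D -> (t, Cn c') \in D -> c != c' ->
  (exists pt, c = aux pt) \/ (exists pt k, c = gain pt k).
Proof.
move=> cD c'D cc'; have [y [ny py]] := mdD.2 _ cD.
move: (ny); rewrite nbh_sym => /nbhC [[b yE]|[b yE _]|[s yE _]|[pt [t' [yE att]]]].
- by have := py _ c'D; rewrite yE nbhCC => /(_ isT) [] /esym/eqP; rewrite (negPf cc').
- by have [a aD] := Q_ex; have := py _ aD; rewrite yE nbhQQ => /(_ isT).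
- by case: (@not_private_Z (t, Cn c) s) => //; split=> //; rewrite -yE.
- by case=> [->|[k -> _]]; [left; exists pt | right; exists pt, k].
Qed.

(** [c] dominates all of [C] and [a'] all of [Q], so the private neighbour of [a] is a wire. *)
Lemma C_kills_Q c a a' : (t, Cn c) \in D -> (t, Qn a) \in D -> (t, Qn a') \in D ->
  a != a' -> exists pt, a = aux pt.
Proof.
move=> cD aD a'D aa'; case: (Q_private aD a'D aa') => [[b [_ [_ py]]]|[pt [t' [aE _ _]]]].
  by have := py _ cD (nbhCC _ _ _).
by exists pt.
Qed.

Section NoC.
Hypothesis noC : forall c, (t, Cn c) \notin D.

Lemma Z_ex : exists s, (t, Zn s) \in D.
Proof.
have [y yD] := mdD.1 (t, Cn hub).
move/nbhC => [[b yE]|[b _]|[s yE _]|[pt [t' [_ _]]]].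
- by rewrite yE (negPf (noC _)) in yD.
- by case: b => [[]|[i|pt]].
- by exists s; rewrite -yE.
- by case=> [|[k]].
Qed.

Lemma core_in i : (t, Qn (core i)) \in D.
Proof.
have [y yD] := mdD.1 (t, Cn (core i)).
move/nbhC => [[b yE]|[b yE q]|[s]//|[pt [t' [_ _]]]].
- by rewrite yE (negPf (noC _)) in yD.
- by case: b yE q => [//|[j|pt]] yE // /eqP jE; rewrite -jE -yE.
- by case=> [|[k]].
Qed.

Lemma Q_other a : exists2 a', (t, Qn a') \in D & a != a'.
Proof.
pose i0 : 'I_M := Ordinal (ltnW M_gt1); pose i1 : 'I_M := Ordinal M_gt1.
case: (eqVneq a (core i0)) => [->|ne]; last by exists (core i0); rewrite ?core_in.
by exists (core i1); rewrite ?core_in.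
Qed.

Lemma hub_out : (t, Qn hub) \notin D.
Proof.
apply/negP => hD; have [a aD ha] := Q_other hub.
by case: (Q_private hD aD ha) => [[b []]//|[pt [t' []]]].
Qed.

Lemma gain_private pt k : (t, Qn (gain pt k)) \in D ->
  private edge D (t, Qn (gain pt k)) (t, Cn (gain pt k)).
Proof.
move=> gD; have [a aD ga] := Q_other (gain pt k).
case: (Q_private gD aD ga) => [[b [q p]]|[pt' [t' []]]//].
by case: b q p => [//|[j|//]] /eqP<-.
Qed.

(** With other vertices of [Q] selected, the only possible private neighbour of a gain vertex is its
    partner in [C]. Conversely, if nothing else dominates the partner, the gain vertex has to. The
    three disjuncts are the other dominators: [aux], a configuration, the wire. *)
Lemma gainE pt k : ((t, Qn (gain pt k)) \in D) =
  ~~ [|| blky k && ((t, Qn (aux pt)) \in D),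
        [exists s, ((t, Zn s) \in D) && blkz k pt.1 (tau t s pt)]
      | blks k pt.1 && wireD pt].
Proof.
apply/idP/idP => [gD|].
  have [_ py] := gain_private gD; apply/negP => /or3P[].
  - case/andP=> bk yD; have := py _ yD; rewrite nbhQC; first by move=> /(_ isT).
    by rewrite /= eqxx.
  - case/existsP => s /andP[sD bz]; have := py _ sD; rewrite nbhZC //.
    by move=> /(_ isT).
  - case/andP => bs /existsP[t' /andP[att wD]]; have := py _ wD.
    rewrite nbh_sym (@nbh_In t pt t') //; first by move=> /(_ isT).
    by rewrite /= eqxx.
move=> nb; have [y yD] := mdD.1 (t, Cn (gain pt k)).
move/nbhC => [[b yE]|[b yE q]|[s yE z]|[pt' [t' [yE att]]]].
- by rewrite yE (negPf (noC _)) in yD.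
- case: b yE q => [//|[j|pt']] yE; first by move=> /eqP jE; rewrite -jE -yE.
  case/andP=> /eqP ptE bk; case/norP: nb; rewrite bk /= -ptE -yE yD.
  by [].
- case/norP: nb => _ /norP[/negP[]]; apply/existsP; exists s.
  by rewrite -yE yD.
- case=> [//|[k' [ptE kE] bs]]; case/norP: nb => _ /norP[_ /negP[]].
  rewrite ptE kE bs /=; apply/existsP; exists t'.
  by rewrite att -yE.
Qed.

(** Under [rely] the configuration [s] already dominates the gain vertices of kinds 3 and 4, which
    are all the neighbours of [aux] in [C]. *)
Lemma aux_private pt s : (t, Zn s) \in D -> rely pt.1 (tau t s pt) ->
  (t, Qn (aux pt)) \in D ->
  exists2 t', attached t pt t' & private edge D (t, Qn (aux pt)) (t', In pt.2).
Proof.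
move=> sD rl yD; have [a aD ya] := Q_other (aux pt).
case: (Q_private yD aD ya) => [[b [q [_ p]]]|[pt' [t' [[ptE] att pr]]]]; last first.
  by move: att pr; rewrite -ptE => att pr; exists t'.
case: b q p => [//|[[//|[pt' k]]|//]] /andP[/eqP<- bk] p.
have := p _ sD; rewrite nbhZC; first by move=> /(_ isT).
by move: bk; rewrite /= /blky => /orP[]/eqP->.
Qed.
End NoC.
End Block.

(** * Counting the solution in a block *)

Lemma sum_sumType (I J : finType) (F : I + J -> nat) :
  \sum_x F x = \sum_i F (inl i) + \sum_j F (inr j).
Proof. exact: big_sumType. Qed.

Lemma sum_unit (F : unit -> nat) : \sum_x F x = F tt.
Proof. by rewrite (big_pred1 tt) // => -[]. Qed.

Lemma sum_prod (I J : finType) (F : I * J -> nat) :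
  \sum_x F x = \sum_i \sum_j F (i, j).
Proof. by rewrite (pair_bigA _ (fun i j => F (i, j))); apply: eq_bigr => -[]. Qed.

Lemma sum_side (F : port -> nat) :
  \sum_x F x = \sum_j F (true, j) + \sum_j F (false, j).
Proof. by rewrite sum_prod big_bool. Qed.

(** The core, four vertices at each of the [2 * #|P|] ports (an entering wire included), the leaves
    of the configurations not selected, and the one selected. *)
Definition weight := M + 8 * #|P| + (#|S|.-1) * K + 1.

Section Count.
Variables (D : {set vert}).
Hypothesis mdD : mindom edge D.
(** The two bounds are just what the strict inequalities of [bcount_two] and [bcount_C] require. *)
Hypothesis K_large : 7 * #|P| + 3 <= K.
Hypothesis M_large : K + 9 * #|P| + 2 <= M.

Definition bcount (t : 'I_T) := \sum_(l : loc) ((t, l) \in D).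

Lemma cardE_bcount : #|D| = \sum_t bcount t.
Proof.
rewrite -sum1_card big_mkcond /= /bcount pair_bigA /=.
by apply: eq_bigr => -[t l] _ /=; case: ifP.
Qed.

Let K_gt0 : 0 < K. Proof. lia. Qed.
Let M_gt1 : 1 < M. Proof. lia. Qed.

Variable t : 'I_T.

Let qD a := (t, Qn a) \in D.
Let cD a := (t, Cn a) \in D.
Let zD s := (t, Zn s) \in D.
Let iD j := (t, In j) \in D.

Lemma bcount_split : bcount t =
  \sum_a qD a + \sum_a cD a + \sum_s (if zD s then 1 else K) + \sum_j iD j.
Proof.
rewrite /bcount sum_sumType; congr (_ + _).
rewrite sum_sumType; congr (_ + _); first by rewrite sum_sumType.
rewrite sum_sumType sum_prod -big_split /=.
apply: eq_bigr => s _; rewrite (eq_bigr (fun=> (~~ zD s : nat))); last first.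
  by move=> k _; rewrite leafE.
by rewrite sum_nat_const card_ord -/(zD s); case: (zD s); rewrite /= ?muln0 ?muln1 ?addn0.
Qed.

Lemma sum_bool_le (I : finType) (b : I -> bool) : \sum_i b i <= #|I|.
Proof. by rewrite -sum1_card; apply: leq_sum => i _; case: (b i). Qed.

Lemma sum_bool_le1 (I : finType) (b : pred I) :
  (forall i j, b i -> b j -> i = j) -> \sum_i b i <= 1.
Proof.
move=> bU; case: (pickP b) => [i bi|b0]; last by rewrite big1 // => i _; rewrite b0.
rewrite (bigD1 i) //= bi big1 // => j ji; case: (boolP (b j)) => // bj.
by rewrite (bU _ _ bj bi) eqxx in ji.
Qed.

(** Private-neighbour arguments in a clique need a second selected vertex; the case of a single one
    is paid for by the successor. *)
Lemma sum_bool_two (I : finType) (b : pred I) B :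
  (forall i j, b i -> b j -> i != j -> \sum_i b i <= B) -> \sum_i b i <= B.+1.
Proof.
move=> h; case: (pickP [pred ij : I * I | [&& b ij.1, b ij.2 & ij.1 != ij.2]]) => [[i j]|no].
  by case/and3P => bi bj ij; apply: leqW; apply: h ij.
apply: leq_trans (sum_bool_le1 _) _ => // i j bi bj; apply/eqP.
by have := no (i, j); rewrite /= bi bj /= => /negbFE.
Qed.

Lemma card_port : #|{: port}| = 2 * #|P|.
Proof. by rewrite card_prod card_bool. Qed.

Lemma sum_aux_le (b : pred cq) : (forall x, b x -> exists pt, x = aux pt) ->
  \sum_x b x <= 2 * #|P|.
Proof.
move=> h; rewrite sum_sumType big1 => [|x _]; last first.
  by case: (boolP (b (inl x))) => // /h[].
rewrite sum_sumType big1 => [|x _]; last first.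
  by case: (boolP (b (inr (inl x)))) => // /h[].
by rewrite -card_port; apply: (@sum_bool_le _ (fun j => b (aux j))).
Qed.

Lemma sum_aux_gain_le (b : pred cq) :
  (forall x, b x -> (exists pt, x = aux pt) \/ (exists pt k, x = gain pt k)) ->
  \sum_x b x <= 14 * #|P|.
Proof.
move=> h; rewrite sum_sumType big1 => [|x _]; last first.
  by case: (boolP (b (inl x))) => // /h[[]//|[? []]].
rewrite sum_sumType sum_sumType big1 => [|x _]; last first.
  by case: (boolP (b (core x))) => // /h[[]//|[? []]].
have h1 := @sum_bool_le _ (fun j => b (inr (inl (inr j)))).
have h2 := @sum_bool_le _ (fun j => b (aux j)).
move: h1 h2; rewrite card_prod card_port card_ord => h1 h2.
by apply: leq_trans (leq_add (leq_add (leqnn 0) h1) h2) _; lia.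
Qed.

Lemma sumZ_le : \sum_s (if zD s then 1 else K) <= #|S| * K.
Proof. by rewrite -sum_nat_const; apply: leq_sum => s _; case: ifP. Qed.

Lemma sumZ_le1 s : zD s -> \sum_s (if zD s then 1 else K) <= (#|S|.-1) * K + 1.
Proof.
move=> sD; rewrite (bigD1 s) //= sD addnC leq_add2r.
rewrite -(cardC1 s) -sum_nat_const; apply: leq_sum => s' _; by case: ifP.
Qed.

Lemma sumZ_le2 s s' : zD s -> zD s' -> s != s' ->
  \sum_s (if zD s then 1 else K) + K <= (#|S|.-1) * K + 2.
Proof.
move=> sD s'D ss'; rewrite (bigD1 s) //= sD (bigD1 s') 1?eq_sym //= s'D.
have -> : #|S|.-1 = #|[pred i | (i != s) && (i != s')]|.+1.
  have := cardC1 s; rewrite (cardD1 s') !inE eq_sym ss' => <-; congr _.+1.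
  by apply: eq_card => i; rewrite !inE andbC.
rewrite mulSn -sum_nat_const.
have -> : forall x, 1 + (1 + x) + K = K + x + 2 by move=> x; lia.
by rewrite leq_add2r leq_add2l; apply: leq_sum => i _; case: ifP.
Qed.

(** Using [C] forfeits the core of [Q]: in each clique all selected vertices are tied to ports,
    unless there is only one. The [M] lost core vertices outweigh everything else. *)
Lemma bcount_C c : cD c -> bcount t < weight.
Proof.
move=> cc; rewrite bcount_split.
have hQ : \sum_a qD a <= (2 * #|P|).+1.
  apply: sum_bool_two => a a' aD a'D aa'; apply: sum_aux_le => x xD.
  case: (eqVneq x a) => [->|xa]; first exact: (C_kills_Q mdD cc aD a'D).
  exact: (C_kills_Q mdD cc xD aD).
have hC : \sum_a cD a <= (14 * #|P|).+1.
  apply: sum_bool_two => a a' aD a'D aa'; apply: sum_aux_gain_le => x xD.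
  case: (eqVneq x a) => [->|xa]; first exact: (C_private mdD K_gt0 aD a'D).
  exact: (C_private mdD K_gt0 xD aD).
have hZ := sumZ_le; have hI : \sum_j iD j <= #|P| by apply: sum_bool_le.
rewrite /weight; case: (posnP #|S|) => S0; first by rewrite S0 in hZ *; lia.
have : #|S| * K = #|S|.-1 * K + K by rewrite -{1}(prednK S0) mulSn addnC.
lia.
Qed.

Lemma sum_Q_le : \sum_a qD a <= M + 14 * #|P| + 1.
Proof.
apply: leq_trans (sum_bool_le _) _.
by rewrite !card_sum card_unit card_prod card_port !card_ord; lia.
Qed.

(** The second selected configuration loses its [K] leaves, more than all the ports could make up
    for. *)
Lemma bcount_two s s' : (forall c, ~~ cD c) -> zD s -> zD s' -> s != s' -> bcount t < weight.
Proof.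
move=> noC sD s'D ss'; rewrite bcount_split [\sum_a cD a]big1 => [|c _]; last by rewrite (negPf (noC c)).
have := sumZ_le2 sD s'D ss'; have := sum_Q_le.
have : \sum_j iD j <= #|P| by apply: sum_bool_le.
rewrite /weight; lia.
Qed.

(** Under a type A nothing is asked of a leaving wire: kind 0 is lost anyway, and the wire is
    counted elsewhere. *)
Definition good_port (s : S) (pt : port) :=
  let w := tau t s pt in
  [/\ qD (aux pt) = rely pt.1 w, ~~ isA w -> ~~ wireD D t pt
    & pt.1 -> iD pt.2 = isA w].

Lemma wireD_in j : wireD D t (true, j) = iD j.
Proof.
apply/existsP/idP => [[t' /andP[]]|h]; first by rewrite /attached /= => /eqP<-.
by exists t; rewrite /attached /= eqxx.
Qed.

Definition port_count (pt : port) :=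
  \sum_(k < 6) qD (gain pt k) + qD (aux pt) + (pt.1 && iD pt.2).

Section One.
Variable s : S.
Hypotheses (noC : forall c, ~~ cD c) (sD : zD s) (sU : forall s', zD s' -> s' = s).

Lemma port_countE pt : let w := tau t s pt in
  port_count pt = \sum_(k < 6) ~~ [|| blky k && qD (aux pt), blkz k pt.1 w | blks k pt.1 && wireD D t pt]
   + qD (aux pt) + (pt.1 && iD pt.2).
Proof.
move=> w; rewrite /port_count; congr (_ + _ + _); apply: eq_bigr => k _.
rewrite /qD gainE //; congr (nat_of_bool (~~ [|| _, _ | _])).
apply/existsP/idP => [[s' /andP[/sU->]]//|h]; by exists s; apply/andP.
Qed.

(** Kinds 0 to 2 with the entering wire contribute at most two, and so do kinds 3 to 5 with [aux]. A
    wire selected against its type, a missing entering wire under A, or a wrong choice of [aux]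
    drops the respective part to one. *)
Lemma port_count_le pt : port_count pt <= 4 /\ (port_count pt = 4 -> good_port s pt).
Proof.
case: pt => side j; rewrite /good_port port_countE /=.
rewrite !big_ord_recl big_ord0 /= /blkz /blky /blks /=.
case: side; rewrite ?wireD_in /=.
  by case: (isA _); case: (rely _ _); case: (iD j); case: (qD _).
by case: (isA _); case: (rely _ _); case: (wireD _ _ _); case: (qD _).
Qed.

Lemma bcount_one : bcount t <= M + \sum_pt port_count pt + #|S|.-1 * K + 1.
Proof.
rewrite bcount_split [\sum_a cD a]big1 => [|c _]; last by rewrite (negPf (noC c)).
rewrite addn0 sum_sumType sum_unit sum_sumType sum_sumType.
rewrite {1}/qD (negPf (hub_out mdD M_gt1 noC)) add0n sum_prod.
have hM : \sum_i qD (core i) <= M by have := sum_bool_le (fun i => qD (core i)); rewrite card_ord.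
have hZ := sumZ_le1 sD.
have -> : \sum_pt port_count pt = \sum_pt \sum_k qD (gain pt k) + \sum_pt qD (aux pt) + \sum_j iD j.
  by rewrite /port_count !big_split /= (sum_side (fun pt => pt.1 && iD pt.2)) /= [X in _ + (_ + X)]big1 ?addn0.
rewrite -[X in _ <= X]addnA.
have arith a b c d e m z : a <= m -> d <= z -> a + b + c + d + e <= m + (b + c + e) + z by lia.
exact: arith.
Qed.
End One.

Lemma block_bound : bcount t <= weight /\ (bcount t = weight ->
  exists s, [/\ forall c, ~~ cD c, zD s, forall s', zD s' -> s' = s & forall pt, good_port s pt]).
Proof.
case: (pickP cD) => [c /bcount_C h|noC']; first by split; [exact: ltnW | move=> e; rewrite e ltnn in h].
have noC c : ~~ cD c by rewrite noC'.
have [s sD] := Z_ex mdD noC.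
case: (pickP [pred s' | zD s' && (s' != s)]) => [s' /andP[s'D s's]|sU'].
  have h := bcount_two noC s'D sD s's.
  by split; [exact: ltnW | move=> e; rewrite e ltnn in h].
have sU s' : zD s' -> s' = s.
  by move=> s'D; apply/eqP; have := sU' s'; rewrite /= s'D => /negbFE.
have h1 := bcount_one noC sD.
have hle pt : port_count pt <= 4 by case: (port_count_le noC sD sU pt).
have sum4 : \sum_(pt : port) 4 = 8 * #|P| by rewrite sum_nat_const card_port; lia.
have h2 : \sum_pt port_count pt <= 8 * #|P| by rewrite -sum4; apply: leq_sum.
split; first by rewrite /weight; lia.
rewrite /weight => eqw; exists s; split=> // pt.
apply: (port_count_le noC sD sU pt).2; apply/eqP; rewrite eqn_leq hle leqNgt.
apply/negP => lt4; suff : \sum_pt port_count pt < 8 * #|P| by lia.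
rewrite -sum4 (bigD1 pt) //= [X in _ < X](bigD1 pt) //=.
by rewrite -addSn leq_add // leq_sum.
Qed.
End Count.

Hypothesis K_large : 7 * #|P| + 3 <= K.
Hypothesis M_large : K + 9 * #|P| + 2 <= M.

Let K_gt0 : 0 < K. Proof. lia. Qed.
Let M_gt1 : 1 < M. Proof. lia. Qed.

(** * Types at the two ends of a wire *)

Section Sound.
Variable D : {set vert}.
Hypothesis mdD : mindom edge D.

Definition tight (t : 'I_T) (s : S) :=
  [/\ forall c, (t, Cn c) \notin D, (t, Zn s) \in D,
      forall s', (t, Zn s') \in D -> s' = s & forall pt, good_port D t s pt].

Section Wire.
Variables (t t' : 'I_T) (j : P) (s s' : S).
Hypotheses (lk : link t t' j) (tg : tight t s) (tg' : tight t' s').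
Let v : vert := (t', In j).

Let src side := if side then t' else t.
Let cfg side := if side then s' else s.
Let typ side := tau (src side) (cfg side) (side, j).

Lemma src_tight side : tight (src side) (cfg side).
Proof. by case: side. Qed.

Lemma src_attached side : attached (src side) (side, j) t'.
Proof. by case: side; rewrite /attached /= ?eqxx. Qed.

Lemma arc_wireP u l : garc (u, l) v ->
  exists side, u = src side /\ sadj (tau u) l (side, j).
Proof.
case/arc_InP => side [att sa]; exists side; split=> //.
exact: attached_inj att (src_attached _).
Qed.

Lemma wire_in : (v \in D) = isA (typ true).
Proof. by case: tg' => _ _ _ /(_ (true, j)) [_ _ ->]. Qed.

Lemma wire_out : ~~ isA (typ false) -> v \notin D.
Proof.
case: tg => _ _ _ /(_ (false, j)) [_ h _] /h; apply: contra => vD.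
by apply/existsP; exists t'; rewrite /attached /= lk.
Qed.

Lemma aux_rely side : ((src side, Qn (aux (side, j))) \in D) = rely side (typ side).
Proof. by case: (src_tight side) => _ _ _ /(_ (side, j)) []. Qed.

Lemma wire_nbr x : x \in D -> garc x v -> exists side,
  (x = (src side, Qn (aux (side, j))) /\ rely side (typ side)) \/
  (x = (src side, Zn (cfg side)) /\ dom side (typ side)).
Proof.
case: x => u l xD /arc_wireP[side [uE sa]]; exists side.
case: (src_tight side) => noC _ sU _; move: xD sa; rewrite uE => {u uE}.
case: l => [[[[[]|[i|pt]]|[[]|[[i|[pt k]]|pt]]]|[s0|[s0 k]]]|j0] //=.
- by move=> yD /eqP ptE; left; rewrite -aux_rely -ptE.
- by rewrite (negPf (noC _)).
- by rewrite (negPf (noC _)).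
- by move=> /sU-> dm; right.
Qed.

Lemma dom_in_D side : dom side (typ side) ->
  (src side, Zn (cfg side)) \in D /\ nbh edge (src side, Zn (cfg side)) v.
Proof.
move=> dm; case: (src_tight side) => _ zD _ _; split=> //.
exact: (@nbh_In _ (side, j) t' (Zn (cfg side)) (src_attached side)).
Qed.

Lemma rely_private side : rely side (typ side) ->
  private edge D (src side, Qn (aux (side, j))) v.
Proof.
move=> rl; case: (src_tight side) => noC zD _ _.
have yD : (src side, Qn (aux (side, j))) \in D by rewrite aux_rely.
have [u att] := aux_private mdD M_gt1 noC zD rl yD.
by rewrite -(attached_fun (src_attached side) att).
Qed.

(** Without A2 on either side, each neighbour of the wire has another dominator in its own block: a
    core vertex for those in [Q], the selected configuration for those in [C], the star for a
    configuration vertex. *)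
Lemma wire_private_A y : v \in D -> (forall side, isA (typ side)) ->
  (forall side, ~~ priv side (typ side)) -> private edge D v y -> y = v.
Proof.
move=> vD iA nP [nvy py]; have := nvy; rewrite nbh_sym => /nbhI[//|].
case: y nvy py => u l nvy py /arc_wireP[side [uE sa]]; exfalso.
case: (src_tight side) => noC zD _ _; move: nvy py sa; rewrite uE => {u uE}.
case: l => [[[[[]|[i|pt]]|[[]|[[i|[pt k]]|pt]]]|[s0|[s0 k]]]|j0] //= nvy py.
- move=> _; have := py _ (core_in mdD noC (Ordinal (ltnW M_gt1))).
  by rewrite nbhQQ => /(_ isT).
- case/andP => /eqP ptE bk; have := py _ zD; rewrite nbhZC => [/(_ isT)//|].
  rewrite /= ptE /=; move: bk (iA side); rewrite /blks /= => /orP[/eqP->//|].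
  by case/andP => /eqP-> /= sd; rewrite /typ sd.
- move=> /eqP ptE; have := py _ zD; rewrite nbhZC => [/(_ isT)//|].
  by rewrite /= ptE nP.
- by move=> _; apply: (@not_private_Z D (src side) mdD K_gt0 v s0).
Qed.

(** A decrease within the types A leaves a selected wire dominated and without private neighbour; a
    decrease within the types B has a wire that should be private to one [aux] dominated from the
    other side too. From B down to A, the leaving block forbids the wire that the entering one
    selects. For the pair (3, 5) both sides show B0 and nothing dominates the wire. *)
Lemma wire_compat :
  tau t s (false, j) <= tau t' s' (true, j) /\
  ~ (tau t s (false, j) = 3 :> nat /\ tau t' s' (true, j) = 5 :> nat).
Proof.
rewrite -/(typ false) -/(typ true).
have rp := rely_private; have dm := dom_in_D.
have lt6 side : typ side < 6 by apply: ltn_ord.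
case: (boolP (isA (typ true))) => [tA|tB].
  have vD : v \in D by rewrite wire_in.
  have fA : isA (typ false) by apply: contraTT vD => /wire_out.
  split; last by move=> [_ t5]; rewrite /isA t5 in tA.
  rewrite leqNgt; apply/negP => lt; have [y pv] := mdD.2 _ vD.
  have yE : y = v.
    apply: wire_private_A pv => // side; first by case: side.
    by move: tA fA lt; rewrite /isA /priv; case: side; lia.
  have : exists side, dom side (typ side).
    rewrite /isA in tA fA; have [t0|t1] : typ true = 0 :> nat \/ typ true = 1 :> nat by lia.
      by exists true; rewrite /dom t0.
    by exists false; rewrite /dom; apply/orP; right; apply/eqP; lia.
  case=> side /dm[zD nz]; case: pv => _ pv; rewrite yE in pv.
  by have := pv _ zD nz.
have vND : v \notin D by rewrite wire_in.
case: (boolP (isA (typ false))) => [fA|fB].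
  by move: fA tB; rewrite /isA; split; lia.
rewrite /isA in tB fB.
have n35 : ~ (typ false = 3 :> nat /\ typ true = 5 :> nat).
  move=> [f3 t5]; have [y yD] := mdD.1 v; case/nbhI => [yE|].
    by move: vND; rewrite /v -yE yD.
  by move/(wire_nbr yD) => [[] []] [] _; rewrite /rely /dom ?f3 ?t5.
split=> //; rewrite leqNgt; apply/negP => lt.
have [t3|t4] : typ true = 3 :> nat \/ (typ true = 4 :> nat /\ typ false = 5 :> nat).
- by have := lt6 false; lia.
- have [_ py] : private edge D (src true, Qn (aux (true, j))) v by apply: rp; rewrite /rely t3.
  have [f4|f5] : typ false = 4 :> nat \/ typ false = 5 :> nat by have := lt6 false; lia.
    have [zD nz] : (src false, Zn (cfg false)) \in D /\ nbh edge (src false, Zn (cfg false)) v.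
      by apply: dm; rewrite /dom f4.
    by have := py _ zD nz.
  have f5' : rely false (typ false) by rewrite /rely f5.
  have [ny _] := rp false f5'.
  by have := py _ _ ny; rewrite aux_rely f5' => /(_ isT).
- have [_ py] : private edge D (src false, Qn (aux (false, j))) v by apply: rp; rewrite /rely t4.2.
  have [zD nz] : (src true, Zn (cfg true)) \in D /\ nbh edge (src true, Zn (cfg true)) v.
    by apply: dm; rewrite /dom t4.1.
  by have := py _ zD nz.
Qed.
End Wire.

Lemma network_sound : T * weight <= #|D| ->
  exists sg : 'I_T -> S, forall t t' j, link t t' j ->
    tau t (sg t) (false, j) <= tau t' (sg t') (true, j) /\
    ~ (tau t (sg t) (false, j) = 3 :> nat /\ tau t' (sg t') (true, j) = 5 :> nat).
Proof.
rewrite cardE_bcount => le.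
have bb t := block_bound mdD K_large M_large t.
have eqw t : bcount D t = weight.
  apply/eqP; rewrite eqn_leq (bb t).1 leqNgt; apply/negP => lt.
  move: le; rewrite leqNgt => /negP[].
  have <- : \sum_(t < T) weight = T * weight by rewrite sum_nat_const card_ord.
  rewrite (bigD1 t) //= [X in _ < X](bigD1 t) //= -addSn leq_add //.
  by apply: leq_sum => u _; case: (bb u).
have /fin_all_exists [sg sgP] : forall t, exists s, tight t s.
  by move=> t; have [s [h1 h2 h3 h4]] := (bb t).2 (eqw t); exists s.
by exists sg => t t' j lk; apply: wire_compat.
Qed.
End Sound.

(** * The solution belonging to matching configurations *)

Section Complete.
Variable sg : 'I_T -> S.
Let ty t pt := tau t (sg t) pt.
Hypothesis ty_link : forall t t' j, link t t' j -> ty t (false, j) = ty t' (true, j).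
(** Type 3 = (B0, B1) suits open ends: the block entered dominates the wire alone, and the block
    left owes it nothing. *)
Hypothesis ty_in : forall t' j, (forall t, ~~ link t t' j) -> ty t' (true, j) = 3 :> nat.
Hypothesis ty_out : forall t j, (forall t', ~~ link t t' j) -> ty t (false, j) = 3 :> nat.

Definition sol : {set vert} := [set v : vert | match v.2 with
  | Qn hub => false
  | Qn (core _) => true
  | Qn (gain pt k) => ~~ blkz k pt.1 (ty v.1 pt)
  | Qn (aux pt) => rely pt.1 (ty v.1 pt)
  | Cn _ => false
  | Zn s => s == sg v.1
  | Ln s _ => s != sg v.1
  | In j => isA (ty v.1 (true, j))
  end].

Lemma attached_ty t pt t' : attached t pt t' -> ty t' (true, pt.2) = ty t pt.
Proof.
case: pt => -[] j; rewrite /attached /=; first by move/eqP->.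
by move/ty_link->.
Qed.

Lemma attached_ex t pt : pt.1 || (ty t pt != 3 :> nat) -> exists t', attached t pt t'.
Proof.
case: pt => -[] j /=; first by exists t; rewrite /attached /=.
move=> ne; case: (pickP (fun t' => link t t' j)) => [t' lk|no]; first by exists t'.
by rewrite ty_out ?eqxx // in ne => t'; rewrite no.
Qed.

Lemma sol_C t c : (t, Cn c) \in sol = false. Proof. by rewrite inE. Qed.
Lemma sol_Z t s : ((t, Zn s) \in sol) = (s == sg t). Proof. by rewrite inE. Qed.
Lemma sol_aux t pt : ((t, Qn (aux pt)) \in sol) = rely pt.1 (ty t pt).
Proof. by rewrite inE. Qed.
Lemma sol_In t j : ((t, In j) \in sol) = isA (ty t (true, j)). Proof. by rewrite inE. Qed.
Lemma sol_core t i : (t, Qn (core i)) \in sol. Proof. by rewrite inE. Qed.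

Lemma sol_wire_nbr t pt t' x : attached t pt t' -> x \in sol -> nbh edge x (t', In pt.2) ->
  [\/ x = (t', In pt.2),
      exists u side, [/\ x = (u, Qn (aux (side, pt.2))), attached u (side, pt.2) t'
          & rely side (ty t pt)]
    | exists u side, x = (u, Zn (sg u)) /\ dom side (ty t pt)].
Proof.
move=> att xD /nbhI[->|]; first by constructor 1.
case: x xD => u l xD /arc_InP[side [att' sa]].
rewrite -(attached_ty att) -[pt.2]/((side, pt.2).2) (attached_ty att').
case: l xD sa => [[[[[]|[i|pt']]|[[]|[[i|[pt' k]]|pt']]]|[s0|[s0 k]]]|j0] //=.
- move=> yD /eqP ptE; constructor 2; exists u, side; split=> //; first by rewrite ptE.
  by move: yD; rewrite sol_aux ptE.
- by rewrite sol_C.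
- by rewrite sol_C.
- by rewrite sol_Z => /eqP-> dm; constructor 3; exists u, side.
Qed.

Lemma sol_C_nbr t c x : x \in sol -> nbh edge x (t, Cn c) ->
  [\/ exists2 b, x = (t, Qn b) & qc b c,
      x = (t, Zn (sg t)) /\ zc (ty t) c
    | exists pt t', [/\ x = (t', In pt.2), attached t pt t', isA (ty t pt)
        & c = aux pt \/ exists2 k, c = gain pt k & blks k pt.1]].
Proof.
move=> xD /nbhC[[b xE]|[b xE q]|[s xE z]|[pt [t' [xE att cE]]]].
- by rewrite xE sol_C in xD.
- by constructor 1; exists b.
- by constructor 2; move: xD z; rewrite xE sol_Z => /eqP->.
- constructor 3; exists pt, t'; split=> //.
  by rewrite -(attached_ty att) -sol_In -xE.
Qed.

Lemma sol_covered x : covered edge sol x.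
Proof.
case: x => t l; have i0 : 'I_M := Ordinal (ltnW M_gt1).
case: l => [[[a|[[]|[[i|[pt k]]|pt]]]|[s|[s k]]]|j].
- by exists (t, Qn (core i0)); rewrite ?sol_core ?nbhQQ.
- by exists (t, Zn (sg t)); [rewrite sol_Z | apply: nbhZC].
- by exists (t, Qn (core i)); rewrite ?sol_core ?nbhQC //= eqxx.
- case: (boolP (blkz k pt.1 (ty t pt))) => bz.
    by exists (t, Zn (sg t)); [rewrite sol_Z | apply: nbhZC].
  by exists (t, Qn (gain pt k)); [rewrite inE | rewrite nbhQC //= eqxx].
- case: (boolP (priv pt.1 (ty t pt))) => pr; last first.
    by exists (t, Zn (sg t)); [rewrite sol_Z | apply: nbhZC].
  have [|t' att] := @attached_ex t pt.
    by move: pr; rewrite /priv => /eqP->; case: pt.1.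
  exists (t', In pt.2); first rewrite sol_In (attached_ty att).
    by move: pr; rewrite /priv => /eqP->; case: pt.1.
  by rewrite nbh_sym; apply: nbh_In att _; rewrite /= eqxx.
- case: (eqVneq s (sg t)) => [->|ne].
    by exists (t, Zn (sg t)); rewrite ?sol_Z ?nbh_refl.
  exists (t, Ln s (Ordinal K_gt0)); first by rewrite inE.
  by rewrite nbh_sym nbhZL.
- case: (eqVneq s (sg t)) => [->|ne].
    by exists (t, Zn (sg t)); rewrite ?sol_Z ?nbhZL.
  by exists (t, Ln s k); [rewrite inE | rewrite nbh_refl].
have att : attached t (true, j) t by rewrite /attached /=.
case: (boolP (isA (ty t (true, j)))) => iA.
  by exists (t, In j); rewrite ?sol_In ?nbh_refl.
have lt6 := ltn_ord (ty t (true, j)); rewrite /isA in iA.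
have [e3|[e4|e5]] : ty t (true, j) = 3 :> nat \/ ty t (true, j) = 4 :> nat
    \/ ty t (true, j) = 5 :> nat by lia.
- exists (t, Qn (aux (true, j))); first by rewrite sol_aux /rely e3.
  by apply: (nbh_In att); rewrite /= eqxx.
- exists (t, Zn (sg t)); first by rewrite sol_Z.
  by apply: (nbh_In att); rewrite /= /dom -/(ty t _) e4.
(* Type 5 is dominated by the [aux] of the block left, which exists because an unlinked wire has
   type 3. *)
case: (pickP (fun u => link u t j)) => [u lk|no]; last first.
  by rewrite ty_in in e5 => // u; rewrite no.
exists (u, Qn (aux (false, j))); first by rewrite sol_aux (ty_link lk) /rely e5.
by apply: (@nbh_In u (false, j) t); rewrite // /= eqxx.
Qed.

Lemma sol_private x : x \in sol -> exists y, private edge sol x y.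
Proof.
case: x => t l; case: l => [[[[[]|[[i|[pt k]]|pt]]|c]|[s|[s k]]]|j].
- by rewrite inE.
- move=> _; exists (t, Cn (core i)); split; first by rewrite nbhQC //= eqxx.
  move=> z zD /(sol_C_nbr zD)[[b -> q]|[]//|[pt [t' [_ _ _]]]]; last by case=> [|[]].
  by case: b q => [//|[i'|//]] /eqP->.
- rewrite inE /= => nbz; exists (t, Cn (gain pt k)); split; first by rewrite nbhQC //= eqxx.
  move=> z zD /(sol_C_nbr zD)[[b zE q]|[_ /=]|[pt' [t' [_ _ iA]]]].
  + case: b zE q => [//|[i' zE|pt' zE]] /=; first by move=> /eqP i'E; rewrite zE i'E.
    case/andP => /eqP ptE bk; case/negP: nbz; move: zD; rewrite zE sol_aux ptE.
    by move: bk; rewrite /blky => /orP[]/eqP->.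
  + by rewrite (negPf nbz).
  + case=> [//|[k' [ptE kE] bs]]; case/negP: nbz; rewrite ptE kE; move: bs iA.
    rewrite /blks; by move=> /orP[/eqP->//|/andP[/eqP-> /= ->]].
- rewrite sol_aux => rl; have [|t' att] := @attached_ex t pt.
    by move: rl; rewrite /rely => /eqP->; case: pt.1.
  exists (t', In pt.2); split; first by apply: nbh_In att _; rewrite /= eqxx.
  have nA : ~~ isA (ty t pt) by move: rl; rewrite /rely => /eqP->; case: pt.1.
  move=> z zD /(sol_wire_nbr att zD)[zE|[u [side [zE att' rl']]]|[u [side [zE dm]]]].
  + by move: zD; rewrite zE sol_In (attached_ty att) (negPf nA).
  + have sE : side = pt.1.
      by move: rl rl' => {zE att'}; rewrite /rely => /eqP->; case: side; case: pt.1.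
    rewrite sE -surjective_pairing in zE att'.
    by rewrite zE (attached_inj att att').
  + by move: rl dm; rewrite /rely /dom => /eqP->; case: side; case: pt.1.
- by rewrite sol_C.
- rewrite sol_Z => /eqP->; exists (t, Ln (sg t) (Ordinal K_gt0)); split; first exact: nbhZL.
  by move=> z zD /nbhL[]// zE; move: zD; rewrite zE inE /= eqxx.
- rewrite inE /= => ne; exists (t, Ln s k); split; first exact: nbh_refl.
  by move=> z zD /nbhL[]// zE; move: zD ne; rewrite zE sol_Z => ->.
rewrite sol_In => iA; have lt6 := ltn_ord (ty t (true, j)).
(* The private neighbour lies on the side showing A2, as the [aux] vertex of [C] there; under type 1
   it is the wire itself. *)
have [u [pt [att jE tyE]]] : exists u pt, [/\ attached u pt t, pt.2 = j &
    (priv pt.1 (ty u pt)) || (ty u pt == 1 :> nat)].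
  rewrite /isA in iA.
  have [e0|e12] : ty t (true, j) = 0 :> nat \/
     (ty t (true, j) = 2 :> nat) \/ (ty t (true, j) = 1 :> nat) by lia.
    case: (pickP (fun u => link u t j)) => [u lk|no]; last first.
      by rewrite ty_in in e0 => // u; rewrite no.
    by exists u, (false, j); split=> //; rewrite (ty_link lk) /priv e0.
  exists t, (true, j); split=> //; first by rewrite /attached /=.
  by rewrite /priv; case: e12 => ->.
move: iA; rewrite -jE (attached_ty att) => iA; case/orP: tyE => [pr|/eqP e1]; last first.
  exists (t, In pt.2); split; first exact: nbh_refl.
  move=> z zD /(sol_wire_nbr att zD)[//|[u' [side [_ _]]]|[u' [side [_]]]].
    by rewrite /rely e1; case: side.
  by rewrite /dom e1; case: side.
exists (u, Cn (aux pt)); split.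
  by rewrite nbh_sym; apply: nbh_In att _; rewrite /= eqxx.
move=> z zD /(sol_C_nbr zD)[[b _]|[_ /=]|[pt' [t' [zE att' _]]]].
- by case: b => [|[]].
- by rewrite pr.
case=> [[ptE]|[]//]; rewrite -ptE in zE att'.
by rewrite zE (attached_fun att att').
Qed.

Lemma sol_mindom : mindom edge sol.
Proof. by split; [exact: sol_covered | exact: sol_private]. Qed.

Lemma card_sol : #|sol| = T * weight.
Proof.
rewrite cardE_bcount -[T in RHS]card_ord -sum_nat_const; apply: eq_bigr => t _.
rewrite (bcount_split sol_mindom) [X in _ + X + _ + _]big1 => [|c _]; last by rewrite sol_C.
rewrite addn0 sum_sumType sum_unit sum_sumType sum_sumType inE add0n sum_prod.
rewrite (eq_bigr (fun=> 1)) => [|i _]; last by rewrite sol_core.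
rewrite sum_nat_const card_ord muln1.
have -> : \sum_s (if (t, Zn s) \in sol then 1 else K) = #|S|.-1 * K + 1.
  rewrite (bigD1 (sg t)) //= sol_Z eqxx addnC; congr (_ + 1).
  rewrite -(cardC1 (sg t)) -sum_nat_const; apply: eq_bigr => s ne.
  by rewrite sol_Z (negPf ne).
rewrite /weight; have <- : \sum_(pt : port) 4 = 8 * #|P| by rewrite sum_nat_const card_port; lia.
have -> : \sum_(pt : port) 4 = \sum_(pt : port) (\sum_(k < 6) ((t, Qn (gain pt k)) \in sol)
    + ((t, Qn (aux pt)) \in sol) + (pt.1 && ((t, In pt.2) \in sol))).
  apply: eq_bigr => -[side j] _; rewrite /= sol_aux sol_In !big_ord_recl big_ord0 !inE /= /blkz /=.
  have := ltn_ord (ty t (side, j)).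
  by case: side => /=; rewrite /isA /rely;
    case: (nat_of_ord (ty t _)) => [|[|[|[|[|[|]]]]]].
rewrite !big_split /= (sum_side (fun pt => pt.1 && ((t, In pt.2) \in sol))) /=.
rewrite [X in _ = _ + (_ + (_ + X)) + _ + _]big1 ?addn0 //.
have arith m a b c z : m + a + b + (z + 1) + c = m + (a + b + c) + z + 1 by lia.
exact: arith.
Qed.
End Complete.
End Network.

(** * Reduction from satisfiability *)

(** A vertex that becomes uncovered when [x] is removed from [D] is a private neighbour of [x]. *)
Lemma upper_dominatingP (G : graph) (D : {set 'I_(nverts G)}) :
  upper_dominating G D <-> mindom (adj G) D.
Proof.
have domP D' : dominating G D' <-> forall x, covered (adj G) D' x.
  split=> [/forallP h x|h]; last first.
    apply/forallP => x; have [y yD /orP[/eqP<-|yx]] := h x; first by rewrite yD.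
    by apply/orP; right; apply/existsP; exists y; rewrite yD.
  case/orP: (h x) => [xD|/existsP[y /andP[yD yx]]].
    by exists x => //; rewrite /nbh eqxx.
  by exists y => //; rewrite /nbh yx orbT.
split=> [/minsetP[/domP cov min]|[cov prv]].
  split=> // x xD; have : ~~ dominating G (D :\ x).
    apply/negP => /min /(_ (subsetDl _ _)) E.
    by move: xD; rewrite -E !inE eqxx.
  case/forallPn => y; rewrite negb_or => /andP[yND yno]; exists y.
  have uniq z : z \in D -> nbh (adj G) z y -> z = x.
    move=> zD zy; apply/eqP; apply/negPn/negP => zx; case/orP: zy => [/eqP zy|zy].
      by rewrite -zy !inE zx zD in yND.
    by case/negP: yno; apply/existsP; exists z; rewrite !inE zx zD.
  by split=> //; have [z zD zy] := cov y; rewrite -(uniq z).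
apply/minsetP; split=> [|B /domP covB BD]; first exact/domP.
apply/eqP; rewrite eqEsubset BD; apply/subsetP => x xD.
have [y [_ py]] := prv x xD; have [z zB zy] := covB y.
by rewrite -(py z) // (subsetP BD).
Qed.

Section GraphOf.
Variables (V : finType) (e : rel V) (sym_e : symmetric e) (irr_e : irreflexive e).

Definition graph_of : graph :=
  @Graph #|V| (fun i j => e (enum_val i) (enum_val j))
    (fun i j => sym_e _ _) (fun i => irr_e _).

Lemma nbh_graph_of i j : nbh (adj graph_of) i j = nbh e (enum_val i) (enum_val j).
Proof. by rewrite /nbh /= (inj_eq enum_val_inj). Qed.

Lemma graph_of_upper_dominating k :
  (exists2 D : {set V}, mindom e D & k <= #|D|) <->
  [exists D, upper_dominating graph_of D && (k <= #|D|)].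
Proof.
split=> [[D [cov prv] kD]|/existsP[D /andP[/upper_dominatingP[cov prv] kD]]].
  apply/existsP; exists [set enum_rank x | x in D].
  rewrite card_imset ?kD ?andbT; last exact: enum_rank_inj.
  apply/upper_dominatingP; split.
    move=> i; have [y yD yi] := cov (enum_val i).
    by exists (enum_rank y); [apply: imset_f | rewrite nbh_graph_of enum_rankK].
  move=> i /imsetP[x xD ->]; have [y [nxy py]] := prv x xD.
  exists (enum_rank y); split; first by rewrite nbh_graph_of !enum_rankK.
  move=> j /imsetP[z zD ->]; rewrite nbh_graph_of !enum_rankK => nzy.
  by rewrite (py z).
exists [set enum_val x | x in D]; last by rewrite card_imset //; apply: enum_val_inj.
split=> [x|x /imsetP[i iD ->]].
  have [j jD ji] := cov (enum_rank x); exists (enum_val j); first exact: imset_f.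
  by rewrite nbh_graph_of enum_rankK in ji.
have [j [nij pj]] := prv i iD; exists (enum_val j); split; first by rewrite -nbh_graph_of.
by move=> z /imsetP[k' kD' ->]; rewrite -nbh_graph_of => /(pj _ kD')->.
Qed.
End GraphOf.

Lemma sum_eq_leq (I : finType) (F H : I -> nat) :
  (forall i, F i <= H i) -> \sum_i H i <= \sum_i F i -> forall i, F i = H i.
Proof.
move=> le; rewrite leqNgt => /negP nlt i; apply/eqP; rewrite eqn_leq le leqNgt.
apply/negP => lt; apply: nlt; rewrite (bigD1 i) //= [X in _ < X](bigD1 i) //=.
by rewrite -addSn leq_add // leq_sum.
Qed.

Lemma stationary_step (h : nat -> nat) n :
  h n < h 0 + n -> exists2 r, r < n & h r.+1 <= h r.
Proof.
elim: n => [|n IH]; first by rewrite addn0 ltnn.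
move=> lt; case: (leqP (h n.+1) (h n)) => [le|lt']; first by exists n.
by have [|r rn hr] := IH; [lia | exists r => //; apply: leqW].
Qed.

Lemma monotone_between (f : nat -> nat) a b : (forall i, a <= i < b -> f i <= f i.+1) ->
  forall i j, a <= i <= j -> j <= b -> f i <= f j.
Proof.
move=> mono i j; elim: j => [|j IH]; first by case: i => // ? /andP[].
case: (eqVneq i j.+1) => [->//|ne] /andP[ai ij] jb.
by apply: leq_trans (mono j _); [apply: IH|]; lia.
Qed.

(** * Clauses as sequences of instructions *)

Definition clause := seq (nat * bool).

Definition sat_by (x : nat -> bool) (c : clause) := has (fun l => x l.1 == l.2) c.

Inductive instr := ILit of nat & bool | ICheck | IInit | IFin.

(** The closing check demands a true carry and resets it, so the next clause again starts from
    false. *)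
Definition clause_code (c : clause) : seq instr := rcons [seq ILit l.1 l.2 | l <- c] ICheck.

Definition middle (R : nat) (cls : seq clause) : seq instr :=
  flatten (nseq R (flatten [seq clause_code c | c <- cls])).

Definition instrs_of (R : nat) (cls : seq clause) : seq instr :=
  IInit :: rcons (middle R cls) IFin.

Section Reduction.
Variables (g0 p : nat).
Let gam := g0.+1.
Definition bits : finType := {ffun 'I_gam -> bool}.
Variable enc : bits -> 'I_p -> 'I_6.
Hypothesis enc_inj : forall a a', enc a =1 enc a' -> a = a'.

Definition wires : finType := option 'I_p.
(** A block guesses the bits of its group and the carry it receives; the links make the guesses
    consistent. *)
Definition config : finType := (bits * bool)%type.

(* A wire [None] carries the truth of the clause read so far, with types 3 (false)
   and 5 (true), between which no mismatch is free of charge. *)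
Inductive tmpl := TPass | TLit of 'I_gam & bool | TCheck | TInit | TFin.

Definition ord3 : 'I_6 := @Ordinal 6 3 isT.
Definition ord5 : 'I_6 := @Ordinal 6 5 isT.
Definition carry (b : bool) : 'I_6 := if b then ord5 else ord3.

(** [TInit] receives and [TFin] emits the carry false because open ends must have type 3, which is
    [carry false]. *)
Definition cin (x : tmpl) (s : config) : bool :=
  match x with TPass | TLit _ _ | TFin => s.2 | TCheck => true | TInit => false end.
Definition cout (x : tmpl) (s : config) : bool :=
  match x with TPass => s.2 | TLit j b => s.2 || (s.1 j == b) | _ => false end.

Definition isInit x := if x is TInit then true else false.
Definition isFin x := if x is TFin then true else false.

Definition tau_of (x : tmpl) : template wires config := fun s pt =>
  match pt.2 with
  | Some j => if (if pt.1 then isInit x else isFin x) then ord3 else enc s.1 j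
  | None => carry (if pt.1 then cin x s else cout x s)
  end.

(** The check sits in group 0, the first block of its sweep, where the carry of the previous sweep
    arrives; a literal is read by the group owning its variable. *)
Definition tmpl_of (i : instr) (g : nat) : tmpl :=
  match i with
  | ILit v b => if v %/ gam == g then TLit (inord (v %% gam)) b else TPass
  | ICheck => if g == 0 then TCheck else TPass
  | IInit => TInit
  | IFin => TFin
  end.

Variable G : nat.
Hypothesis G_gt0 : 0 < G.

Definition sweep (i : instr) : seq tmpl := [seq tmpl_of i g | g <- iota 0 G].
Definition blocks (ins : seq instr) : seq tmpl := flatten [seq sweep i | i <- ins].

Lemma size_blocks ins : size (blocks ins) = size ins * G.
Proof. by elim: ins => //= i ins IH; rewrite size_cat IH size_map size_iota mulSn. Qed.

Lemma nth_blocks ins i g : i < size ins -> g < G ->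
  nth TPass (blocks ins) (i * G + g) = tmpl_of (nth IFin ins i) g.
Proof.
move=> + gG; elim: ins i => // x ins IH [|i] /= hi; rewrite nth_cat size_map size_iota.
  by rewrite mul0n add0n gG (nth_map 0) ?size_iota // nth_iota.
by rewrite ifF; [rewrite -IH //; congr nth; lia | lia].
Qed.

Definition hgt := 7 * p.+1 + 3.
Definition cor := hgt + 9 * p.+1 + 2.

Section Net.
Variable bs : seq tmpl.
Let T := size bs.

(** The carry runs through all groups of a sweep and on into the next sweep; the columns skip [G]
    blocks, to the same group one sweep later. *)
Definition blink (t t' : 'I_T) (j : wires) : bool :=
  t' == t + (if j is Some _ then G else 1) :> nat.
Definition btau (t : 'I_T) := tau_of (nth TPass bs t).
Definition bvert := vert cor hgt wires config T.
Definition bedge : rel bvert := @edge cor hgt wires config T blink btau.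
Definition bgraph : graph :=
  graph_of (@edge_sym cor hgt wires config T blink btau)
    (@edge_irrefl cor hgt wires config T blink btau).
Definition bweight := weight cor hgt wires config.

Lemma blink_fun t t' t'' j : blink t t' j -> blink t t'' j -> t' = t''.
Proof. by rewrite /blink => /eqP h /eqP h'; apply: val_inj; rewrite /= h h'. Qed.

Lemma blink_inj t t' u j : blink t t' j -> blink u t' j -> t = u.
Proof. by rewrite /blink => /eqP h /eqP h'; apply: val_inj; rewrite /=; lia. Qed.

Lemma card_wires : #|wires| = p.+1.
Proof. by rewrite card_option card_ord. Qed.

Lemma hgt_large : 7 * #|wires| + 3 <= hgt. Proof. by rewrite card_wires. Qed.
Lemma cor_large : hgt + 9 * #|wires| + 2 <= cor. Proof. by rewrite card_wires. Qed.

Lemma carry_compat b b' : carry b <= carry b' -> ~ (carry b = 3 :> nat /\ carry b' = 5 :> nat) -> b = b'.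
Proof. by case: b; case: b' => //= _ []. Qed.

Lemma bgraph_sound :
  [exists D, upper_dominating bgraph D && (T * bweight <= #|D|)] ->
  exists sg : nat -> config,
    (forall t, t.+1 < T -> cout (nth TPass bs t) (sg t) = cin (nth TPass bs t.+1) (sg t.+1)) /\
    (forall t j, t + G < T -> ~~ isFin (nth TPass bs t) -> ~~ isInit (nth TPass bs (t + G)) ->
       enc (sg t).1 j <= enc (sg (t + G)).1 j).
Proof.
move/graph_of_upper_dominating => [D mdD leD].
have [sg sgP] := network_sound blink_fun blink_inj hgt_large cor_large mdD leD.
pose s0 : config := ([ffun=> true], true).
pose f t := if insub t is Some u then sg u else s0.
have fE t (tT : t < T) : f t = sg (Ordinal tT) by rewrite /f insubT.
exists f; split=> [t tT|t j tT nF nI].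
  rewrite (fE _ tT) (fE _ (ltnW tT)).
  have [|h1 h2] := sgP (Ordinal (ltnW tT)) (Ordinal tT) None; first by rewrite /blink /= addn1.
  by apply: carry_compat h1 h2.
have tT' : t < T by lia.
rewrite (fE _ tT) (fE _ tT').
have [|+ _] := sgP (Ordinal tT') (Ordinal tT) (Some j); first by rewrite /blink /=.
by rewrite /btau /tau_of /= (negPf nF) (negPf nI).
Qed.

Lemma bgraph_complete (sg : nat -> config) :
  (forall t, t.+1 < T -> cout (nth TPass bs t) (sg t) = cin (nth TPass bs t.+1) (sg t.+1)) ->
  (forall t, t + G < T -> [/\ ~~ isFin (nth TPass bs t), ~~ isInit (nth TPass bs (t + G))
                            & (sg t).1 = (sg (t + G)).1]) ->
  (forall t, t < G -> t < T -> isInit (nth TPass bs t)) ->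
  (forall t, t < T -> T <= t + G -> isFin (nth TPass bs t)) ->
  [exists D, upper_dominating bgraph D && (T * bweight <= #|D|)].
Proof.
move=> hc hcol hin hout; apply/graph_of_upper_dominating.
have h1 t t' j : blink t t' j ->
    btau t (sg t) (false, j) = btau t' (sg t') (true, j).
  case: j => [j|] /eqP tt'; rewrite /btau /tau_of /= tt'.
    by have := hcol t; rewrite -tt' => /(_ (ltn_ord _)) [/negPf-> /negPf-> ->].
  by have := ltn_ord t'; rewrite tt' addn1 => lt; rewrite hc.
have h2 t' j : (forall t, ~~ blink t t' j) -> btau t' (sg t') (true, j) = 3 :> nat.
  move=> no; have tG : t' < (if j is Some _ then G else 1).
    rewrite ltnNge; apply/negP => le.
    have lt : t' - (if j is Some _ then G else 1) < T by have := ltn_ord t'; lia.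
    by have := no (Ordinal lt); rewrite /blink /= subnK // eqxx.
  have iI : isInit (nth TPass bs t').
    by apply: hin => //; apply: leq_trans tG _; case: (j).
  case: j tG no => [j|] _ _; rewrite /btau /tau_of /= ?iI //.
  by move: iI; case: (nth _ _ _).
have h3 t j : (forall t', ~~ blink t t' j) -> btau t (sg t) (false, j) = 3 :> nat.
  move=> no; have tG : T <= t + (if j is Some _ then G else 1).
    rewrite leqNgt; apply/negP => lt.
    by have := no (Ordinal lt); rewrite /blink /= eqxx.
  have iF : isFin (nth TPass bs t).
    by apply: hout => //; apply: leq_trans tG _; rewrite leq_add2l; case: (j).
  case: j tG no => [j|] _ _; rewrite /btau /tau_of /= ?iF //.
  by move: iF; case: (nth _ _ _).
pose sg' (t : 'I_T) := sg t.
exists (sol cor hgt btau sg').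
  by apply: (@sol_mindom cor hgt wires config T blink btau blink_fun blink_inj hgt_large cor_large sg').
by rewrite (@card_sol cor hgt wires config T blink btau blink_fun blink_inj hgt_large cor_large sg').
Qed.
End Net.

Section Correct.
Variables (cls : seq clause) (R : nat).
Hypothesis R_large : 5 * (G * p) + 2 <= R.
Hypothesis vars_ok : forall c l, c \in cls -> l \in c -> l.1 < G * gam.

Let body := flatten [seq clause_code c | c <- cls].
Let L := size body.
Let ins := instrs_of R cls.
Let bs := blocks ins.
Let T := size bs.

Definition is_mid (i : instr) := match i with ILit _ _ | ICheck => true | _ => false end.

Lemma body_mid : all is_mid body.
Proof.
rewrite /body; elim: cls => //= c cs IH; rewrite all_cat IH andbT all_rcons /=.
by elim: c.
Qed.

Lemma middle_mid : all is_mid (middle R cls).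
Proof. by rewrite /middle; elim: R => //= r IH; rewrite all_cat IH body_mid. Qed.

Lemma size_middle : size (middle R cls) = R * L.
Proof. by rewrite /middle; elim: R => //= r IH; rewrite size_cat IH mulSn. Qed.

Lemma size_ins : size ins = (R * L).+2.
Proof. by rewrite /ins /= size_rcons size_middle. Qed.

Lemma T_ins : T = size ins * G. Proof. exact: size_blocks. Qed.

Lemma nth_middle r k : r < R -> k < L -> nth IFin (middle R cls) (r * L + k) = nth IFin body k.
Proof.
rewrite /middle => rR kL; elim: R r rR => // R' IH [|r] rR /=; rewrite nth_cat -/L.
  by rewrite mul0n add0n kL.
by rewrite ifF; [rewrite -(IH r) //; congr nth; lia | lia].
Qed.

Lemma nth_ins_mid i : 0 < i <= R * L -> is_mid (nth IFin ins i).
Proof.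
case: i => // i /= iL; rewrite nth_rcons size_middle iL.
by apply: (all_nthP _ middle_mid); rewrite size_middle.
Qed.

Lemma nth_ins_body r k : r < R -> k < L -> nth IFin ins (r * L + k).+1 = nth IFin body k.
Proof.
move=> rR kL /=; rewrite nth_rcons size_middle ifT ?nth_middle //.
by apply: leq_trans (_ : r.+1 * L <= _); [rewrite mulSn; lia | rewrite leq_mul2r rR orbT].
Qed.

(** * From configurations to a satisfying assignment *)

Section Soundness.
Variable sg : nat -> config.
Hypothesis sg_carry : forall t, t.+1 < T ->
  cout (nth TPass bs t) (sg t) = cin (nth TPass bs t.+1) (sg t.+1).
Hypothesis sg_col : forall t j, t + G < T ->
  ~~ isFin (nth TPass bs t) -> ~~ isInit (nth TPass bs (t + G)) ->
  enc (sg t).1 j <= enc (sg (t + G)).1 j.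

Let a i g := (sg (i * G + g)).1.
Let c t := cin (nth TPass bs t) (sg t).

Lemma enc_mono i g j : 0 < i < R * L -> g < G -> enc (a i g) j <= enc (a i.+1 g) j.
Proof.
move=> iL gG; have -> : a i.+1 g = (sg (i * G + g + G)).1 by rewrite /a mulSn; congr (sg _).1; lia.
have e : i * G + g + G = i.+1 * G + g by rewrite mulSn; lia.
have iT : i.+1 * G + g < T.
  rewrite T_ins size_ins; apply: (@leq_trans (i.+2 * G)); first by rewrite [i.+2 * _]mulSn; lia.
  by rewrite leq_mul2r; lia.
apply: sg_col; rewrite ?e //.
  rewrite nth_blocks ?size_ins //; last by lia.
  by have := @nth_ins_mid i; case: (nth _ _ _) => [v b|||] //=; try case: ifP; try lia.
rewrite nth_blocks ?size_ins //; last by lia.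
by have := @nth_ins_mid i.+1; case: (nth _ _ _) => [v b|||] //=; try case: ifP; try lia.
Qed.

Let rk i := \sum_(x : 'I_G * 'I_p) enc (a i x.1) x.2.

Lemma rk_mono i : 0 < i < R * L -> rk i <= rk i.+1.
Proof. by move=> iL; apply: leq_sum => -[g j] _; apply: enc_mono. Qed.

Lemma rk_bound i : rk i <= 5 * (G * p).
Proof.
apply: (@leq_trans (\sum_(x : 'I_G * 'I_p) 5)).
  by apply: leq_sum => x _; rewrite -ltnS; apply: ltn_ord.
by rewrite sum_nat_const card_prod !card_ord mulnC.
Qed.

(* The sum of the types of all columns never decreases and is at most [5 G p], so
   it stays constant during one of the [5 G p + 2] repetitions of the clauses. *)
Lemma constant_round : exists2 r, r < R & forall k g, k < L -> g < G -> a (r * L + k).+1 g = a (r * L).+1 g.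
Proof.
case: (posnP L) => [L0|L_gt0]; first by exists 0; [lia | move=> k g; rewrite L0].
(* Row 0 is the initial sweep, whence the successor. Only [R.-1] steps are compared since [rk_mono]
   stops before the closing sweep; with the bound [5 * (G * p)] this gives the 2 in [R_large]. *)
have [|r rR hr] := @stationary_step (fun r => rk (r * L).+1) R.-1.
  by have := rk_bound (R.-1 * L).+1; lia.
have rL : r.+1 * L <= R.-1 * L by rewrite leq_mul2r rR orbT.
have RL : R * L = L + R.-1 * L by rewrite -mulSn prednK //; lia.
rewrite mulSn in hr rL.
exists r; first by lia.
have mono := @monotone_between rk 1 (R * L) rk_mono.
move=> k g kL gG; apply: enc_inj => j.
have le i : i <= L -> rk (r * L + i).+1 = rk (r * L).+1.
  move=> iL; apply/eqP; rewrite eqn_leq; apply/andP; split; last by apply: mono; lia.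
  by apply: leq_trans hr; apply: mono; lia.
elim: k kL => [|k IH] kL; first by rewrite addn0.
rewrite -IH; last by lia.
have := @sum_eq_leq _ (fun x : 'I_G * 'I_p => enc (a (r * L + k).+1 x.1) x.2)
  (fun x : 'I_G * 'I_p => enc (a (r * L + k.+1).+1 x.1) x.2) _ _ (Ordinal gG, j).
move=> h; apply/esym/val_inj/h => [x|] /=.
  by rewrite addnS; apply: enc_mono => //; lia.
by rewrite -/(rk _) -/(rk _) !le //; lia.
Qed.

Lemma carry_block i g : i.+1 < size ins -> g < G ->
  cout (tmpl_of (nth IFin ins i) g) (sg (i * G + g)) = c (i * G + g).+1.
Proof.
move=> iS gG; rewrite /c -sg_carry ?nth_blocks //; first by lia.
rewrite T_ins; apply: (@leq_trans (i.+2 * G)); first by rewrite !mulSn; lia.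
by rewrite leq_mul2r iS orbT.
Qed.

Lemma cE i g : i < size ins -> g < G ->
  c (i * G + g) = cin (tmpl_of (nth IFin ins i) g) (sg (i * G + g)).
Proof. by move=> iS gG; rewrite /c nth_blocks. Qed.

(** Within the sweep of a literal only the block of the group [v %/ gam] can turn the carry on. *)
Lemma carry_lit i v b : i.+1 < size ins -> nth IFin ins i = ILit v b ->
  c (i.+1 * G) -> c (i * G) || (a i (v %/ gam) (inord (v %% gam)) == b).
Proof.
move=> iS iE; rewrite mulSn addnC.
suff h g : g <= G -> c (i * G + g) -> c (i * G) || (a i (v %/ gam) (inord (v %% gam)) == b) by apply: h.
elim: g => [|g IH] gG; first by rewrite addn0 => ->.
rewrite addnS -carry_block // iE /=; have := IH (ltnW gG).
rewrite cE ?iE //=; last exact: ltnW.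
case: eqP => [vE|_] //= IH' /orP[|/eqP <-]; first exact: IH'.
by rewrite /a vE eqxx orbT.
Qed.

Lemma carry_check i : i.+1 < size ins -> nth IFin ins i = ICheck ->
  c (i * G) /\ ~~ c (i.+1 * G).
Proof.
move=> iS iE; split; first by rewrite -[i * G]addn0 cE ?iE //; lia.
rewrite mulSn addnC -{2}(prednK G_gt0) addnS; have : G.-1 < G by lia.
elim: G.-1 => [|g IH] gG; rewrite -carry_block // iE //=.
by have := IH (ltnW gG); rewrite -addnS cE ?iE //; lia.
Qed.

(** The inequality is strict so that an instruction follows and receives the carry. *)
Definition at_ i0 (code : seq instr) :=
  i0 + size code < size ins /\
  forall k, k < size code -> nth IFin ins (i0 + k) = nth IFin code k.

Lemma at_cat i0 s1 s2 : at_ i0 (s1 ++ s2) -> at_ i0 s1 /\ at_ (i0 + size s1) s2.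
Proof.
rewrite /at_ size_cat => -[le h]; split; split; try by lia.
  by move=> k ks; rewrite h ?nth_cat ?ks //; lia.
move=> k ks; rewrite -addnA h ?nth_cat; last by lia.
by rewrite ifF ?addKn //; lia.
Qed.

Lemma carry_code i0 cl : at_ i0 (clause_code cl) -> ~~ c ((i0 + size (clause_code cl)) * G).
Proof.
rewrite /at_ size_rcons size_map addnS => -[le h].
have [|//|_ //] := @carry_check (i0 + size cl); first exact: le.
by rewrite h // nth_rcons size_map ltnn eqxx.
Qed.

Lemma carry_codes i0 cs : at_ i0 (flatten [seq clause_code cl | cl <- cs]) -> ~~ c (i0 * G) ->
  ~~ c ((i0 + size (flatten [seq clause_code cl | cl <- cs])) * G).
Proof.
elim: cs i0 => [|cl cs IH] i0 /=; first by rewrite addn0.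
case/at_cat => h1 h2 _; rewrite size_cat addnA; apply: IH => //.
exact: carry_code.
Qed.

Section Round.
Variables (r : nat) (rR : r < R).
Hypothesis const : forall k g, k < L -> g < G -> a (r * L + k).+1 g = a (r * L).+1 g.

Definition assignment v := a (r * L).+1 (v %/ gam) (inord (v %% gam)).

Lemma at_round r' : r' < R -> at_ (r' * L).+1 body.
Proof.
move=> r'R; split; last by move=> k kL; rewrite addSn nth_ins_body.
rewrite size_ins -/L; have : r'.+1 * L <= R * L by rewrite leq_mul2r r'R orbT.
by rewrite mulSn; lia.
Qed.

Lemma round_start r' : r' < R -> ~~ c ((r' * L).+1 * G).
Proof.
elim: r' => [|r' IH] r'R.
  rewrite mul0n mul1n -(prednK G_gt0) -[in X in c X](add0n G.-1) -[X in c (X + _).+1](mul0n G).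
  rewrite -carry_block //; first by rewrite size_ins.
  by lia.
have -> : (r'.+1 * L).+1 = (r' * L).+1 + size body by rewrite mulSn -/L; lia.
by apply: carry_codes; [apply: at_round; lia | apply: IH; lia].
Qed.

(** The carry is false on entry and true at the check, so some literal turned it on; since the bits
    do not change during the round, this literal holds under [assignment]. *)
Lemma code_sat i0 cl : cl \in cls -> at_ i0 (clause_code cl) -> ~~ c (i0 * G) ->
  (forall k g, k < size (clause_code cl) -> g < G -> a (i0 + k) g = a (r * L).+1 g) ->
  sat_by assignment cl.
Proof.
move=> clin [+ at0] c0 cst; rewrite size_rcons size_map in at0 cst *; rewrite addnS => le.
have [||cT _] := @carry_check (i0 + size cl); first exact: le.
  by rewrite at0 // nth_rcons size_map ltnn eqxx.
suff h k : k <= size cl -> c ((i0 + k) * G) -> sat_by assignment (take k cl).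
  by have := h _ (leqnn _) cT; rewrite take_size.
elim: k => [|k IH] kS; first by rewrite addn0 (negPf c0).
pose lit := nth (0, true) cl k; rewrite addnS => cS.
have h1 : (i0 + k).+1 < size ins by apply: leq_trans le; rewrite !ltnS leq_add2l ltnW.
have h2 : nth IFin ins (i0 + k) = ILit lit.1 lit.2.
  by rewrite at0 ?nth_rcons ?size_map ?kS ?(nth_map (0, true)) // ltnW.
rewrite (take_nth (0, true)) // /sat_by has_rcons.
case/orP: (carry_lit h1 h2 cS) => [/(IH (ltnW kS))|].
  by rewrite /sat_by => ->; rewrite orbT.
rewrite cst /assignment => [->//||]; first by rewrite ltnW.
by rewrite ltn_divLR //; apply: vars_ok clin _; apply: mem_nth.
Qed.

Lemma round_sat : all (sat_by assignment) cls.
Proof.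
suff h k cs : at_ ((r * L).+1 + k) (flatten [seq clause_code cl | cl <- cs]) ->
    ~~ c (((r * L).+1 + k) * G) -> {subset cs <= cls} ->
    k + size (flatten [seq clause_code cl | cl <- cs]) <= L -> all (sat_by assignment) cs.
  by apply: (h 0); rewrite ?addn0 ?add0n //; [apply: at_round | apply: round_start].
elim: cs k => //= cl cs IH k /at_cat[h1 h2] ck sub; rewrite size_cat => le; apply/andP; split.
  apply: (code_sat _ h1 ck); first by apply: sub; rewrite mem_head.
  by move=> k' g k'S gG; rewrite -addnA addSn const //; lia.
apply: (IH (k + size (clause_code cl))); rewrite ?addnA //; last by lia.
  exact: carry_code.
by move=> x xc; apply: sub; rewrite inE xc orbT.
Qed.
End Round.
End Soundness.

(** * From a satisfying assignment to configurations *)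

Section Completeness.
Variable x : nat -> bool.
Hypothesis sat_x : all (sat_by x) cls.

Definition step (cy : bool) (i : instr) : bool :=
  if i is ILit v b then cy || (x v == b) else false.

Fixpoint okrun (cy : bool) (code : seq instr) : bool :=
  if code is i :: code' then (if i is ICheck then cy else true) && okrun (step cy i) code'
  else true.

Lemma okrun_cat cy s1 s2 :
  okrun cy (s1 ++ s2) = okrun cy s1 && okrun (foldl step cy s1) s2.
Proof. by elim: s1 cy => //= i s1 IH cy; rewrite IH andbA. Qed.

Lemma okrun_nth cy code i : okrun cy code -> i < size code -> nth IFin code i = ICheck ->
  foldl step cy (take i code).
Proof.
elim: code cy i => // i0 code IH cy [|i] /= /andP[h1 h2].
  by move=> _ iE; rewrite iE in h1.
exact: IH.
Qed.

(** Such codes start and end with a false carry, so they can be concatenated and repeated. *)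
Definition closed_code code := okrun false code /\ foldl step false code = false.

Lemma closed_cat s1 s2 : closed_code s1 -> closed_code s2 -> closed_code (s1 ++ s2).
Proof.
by move=> [h1 h2] [h3 h4]; split; rewrite ?okrun_cat ?foldl_cat h2 ?h1 ?h3 ?h4.
Qed.

Lemma closed_clause cl : sat_by x cl -> closed_code (clause_code cl).
Proof.
move=> h; split; last by rewrite /clause_code -cats1 foldl_cat.
have runE cy : okrun cy [seq ILit l.1 l.2 | l <- cl] /\
    foldl step cy [seq ILit l.1 l.2 | l <- cl] = cy || sat_by x cl.
  by elim: cl cy {h} => [|l cl IH] cy /=; rewrite ?orbF // (IH _).1 (IH _).2 orbA.
by rewrite /clause_code -cats1 okrun_cat (runE _).1 (runE _).2 h.
Qed.

Lemma closed_middle : closed_code (middle R cls).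
Proof.
rewrite /middle; elim: R => //= r IH; apply: closed_cat IH.
elim: cls sat_x => //= cl cs IH' /andP[/closed_clause h1 h2].
by apply: closed_cat h1 (IH' h2).
Qed.

Let base i := foldl step false (take i ins).

Lemma baseS i : i < size ins -> base i.+1 = step (base i) (nth IFin ins i).
Proof. by move=> iS; rewrite /base (take_nth IFin) // foldl_rcons. Qed.

Lemma base_check i : i < size ins -> nth IFin ins i = ICheck -> base i.
Proof.
apply: okrun_nth; rewrite /ins /instrs_of /= -cats1 okrun_cat.
by have [-> _] := closed_middle.
Qed.

(** The carry on arrival at group [g] of row [i]; the inequality is strict because the literal's own
    block acts after receiving it. In the row of a check the value is false: group 0 ignores it and
    the others pass on the reset carry. *)
Let bit i g := match nth IFin ins i with
  | ILit v b => base i || ((v %/ gam < g) && (x v == b))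
  | IFin => (g == 0) && base i
  | _ => false end.

Let vals g : bits := [ffun j : 'I_gam => x (g * gam + j)].

Let sg t : config := (vals (t %% G), bit (t %/ G) (t %% G)).

Lemma sgE i g : g < G -> sg (i * G + g) = (vals g, bit i g).
Proof. by move=> gG; rewrite /sg divnMDl // modnMDl divn_small // modn_small // addn0. Qed.

Lemma val_lit v : vals (v %/ gam) (inord (v %% gam)) = x v.
Proof. by rewrite ffunE inordK ?ltn_mod // -divn_eq. Qed.

Lemma lit_small i v b : nth IFin ins i = ILit v b -> v %/ gam < G.
Proof.
pose ok ii := if ii is ILit v _ then v < G * gam else true.
have okc cl : cl \in cls -> all ok (clause_code cl).
  move=> clin; rewrite all_rcons /= all_map; apply/allP => l lin.
  exact: vars_ok clin lin.
have okb : all ok body.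
  rewrite /body; elim: cls okc => //= cl cs IH h; rewrite all_cat h ?mem_head //=.
  by apply: IH => y yc; apply: h; rewrite inE yc orbT.
have okm : all ok ins.
  rewrite /ins /= all_rcons /= /middle; elim: R => //= r IH.
  by rewrite all_cat -/body okb.
move=> iE; rewrite ltn_divLR //.
case: (ltnP i (size ins)) => iS; last by rewrite nth_default in iE.
by have := all_nthP IFin okm i iS; rewrite iE.
Qed.

Lemma nth_ins_init i : 0 < i -> isInit (tmpl_of (nth IFin ins i) 0) = false.
Proof.
case: i => // i _ /=; rewrite nth_rcons size_middle.
case: ltngtP => [iL||] //; have := @nth_ins_mid i.+1 iL.
by rewrite /= nth_rcons size_middle iL; case: (nth _ _ _) => // v b _; rewrite /=; case: ifP.
Qed.

Lemma reduction_complete :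
  [exists D, upper_dominating (bgraph bs) D && (T * bweight <= #|D|)].
Proof.
have decomp t : exists i g, t = i * G + g /\ g < G.
  by exists (t %/ G), (t %% G); rewrite -divn_eq ltn_mod.
have rowlt i g : g < G -> (i * G + g < T) = (i < size ins).
  by move=> gG; rewrite T_ins -ltn_divLR // divnMDl // divn_small ?addn0.
have tmplI ii g : isInit (tmpl_of ii g) = if ii is IInit then true else false.
  by case: ii => //= *; case: ifP.
have tmplF ii g : isFin (tmpl_of ii g) = if ii is IFin then true else false.
  by case: ii => //= *; case: ifP.
apply: (@bgraph_complete bs sg).
- move=> t; have [i [g [-> gG]]] := decomp t; rewrite sgE //.
  case: (ltngtP g.+1 G) => [gG'|gG'|gG'].
  + rewrite -addnS rowlt // => iS; rewrite sgE // !nth_blocks //.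
    rewrite /bit; case: (nth IFin ins i) => [v b||//|//] /=.
      case: (ltngtP (v %/ gam) g) => h1; case: (ltngtP (v %/ gam) g.+1) => h2; rewrite /= ?orbF ?orbT //; try lia.
      by rewrite -h1 val_lit.
    by case: g gG gG'.
  + by rewrite ltnNge gG in gG'.
  + have -> : (i * G + g).+1 = i.+1 * G + 0 by rewrite mulSn; lia.
    rewrite rowlt // => iS; rewrite sgE // !nth_blocks //; last by exact: ltnW.
    have iS' : i < size ins by apply: ltnW.
    have -> : cout (tmpl_of (nth IFin ins i) g) (vals g, bit i g) = base i.+1.
      rewrite baseS // /bit; case: (nth IFin ins i) (@lit_small i) => [v b h||//|//] /=; last first.
        by move=> _; case: ifP.
      have {h} := h v b erefl; rewrite -gG' ltnS => vg; case: eqP => [vE|ne] /=.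
        by rewrite -vE val_lit ltnn /= orbF.
      by rewrite ltn_neqAle vg andbT; move/eqP: ne => ->.
    have := @nth_ins_init i.+1 isT; have := @base_check i.+1 iS; rewrite /bit.
    case: (nth IFin ins i.+1) => [v b|h|//|] /=; first by case: ifP; rewrite /= ?orbF.
      by rewrite h.
    by [].
- move=> t; have [i [g [-> gG]]] := decomp t.
  have -> : i * G + g + G = i.+1 * G + g by rewrite mulSn; lia.
  rewrite rowlt // => iS; rewrite !sgE // !nth_blocks //; last exact: ltnW.
  rewrite tmplI tmplF; split=> //.
    case: i iS => [//|i] iS; have := @nth_ins_mid i.+1.
    by rewrite size_ins in iS; case: (nth _ _ _) => //= /(_ _); apply; lia.
  by have := @nth_ins_init i.+1 isT; rewrite tmplI => ->.
- move=> t tG _; rewrite -[t]add0n -(mul0n G) nth_blocks //.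
- move=> t tT; have [i [g [tE gG]]] := decomp t; move: tT; rewrite tE rowlt // => iS.
  rewrite nth_blocks // tmplF -/T T_ins => le.
  have iE : i = (R * L).+1.
    apply/eqP; rewrite eqn_leq -ltnS -size_ins iS -ltnS -size_ins.
    rewrite leqNgt; apply/negP => lt; move: le; rewrite leqNgt => /negP[].
    apply: (@leq_trans (i.+2 * G)); first by rewrite !mulSn; lia.
    by rewrite leq_mul2r lt orbT.
  by rewrite iE /= nth_rcons size_middle ltnn eqxx.
Qed.
End Completeness.

Theorem reduction_correct :
  [exists D, upper_dominating (bgraph bs) D && (T * bweight <= #|D|)] <->
  exists x, all (sat_by x) cls.
Proof.
split=> [|[x]]; last exact: reduction_complete.
case/bgraph_sound => sg [sgc sgcol].
have [r rR const] := constant_round sgcol.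
by exists (assignment sg r); apply: round_sat.
Qed.
End Correct.
End Reduction.

(** * Pathwidth of the reduction *)

Lemma pathwidth_le (G : graph) (B : seq {set 'I_(nverts G)}) w :
  path_decomposition B -> (forall X, X \in B -> #|X| <= w) -> pathwidth G <= w.
Proof.
move=> pd le; rewrite /pathwidth; case: ex_minnP => m _ min.
apply: (@leq_trans (width B)); first by apply: min; apply/asboolP; exists B.
apply: leq_trans (leq_pred _) _; apply/bigmax_leqP_seq => X XB _; exact: le.
Qed.

Section BlockPathwidth.
Variables (g0 p : nat) (enc : bits g0 -> 'I_p -> 'I_6) (G : nat) (G_gt0 : 0 < G).
Variable bs : seq (tmpl g0).
Let T := size bs.
Let V := bvert p bs.
Let blk : finType := loc (cor p) (hgt p) (wires p) (config g0).

(** Besides block [t], the wires crossing it: a wire stays in the bags from the block it leaves to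
    the block it enters. A column has one wire among the [G] blocks after [t]. *)
Definition in_bag (t : nat) (u : V) : bool :=
  (u.1 == t :> nat) ||
  (if u.2 is inr j then t < u.1 <= t + (if j is Some _ then G else 1) else false).

Definition bag (t : nat) : {set 'I_#|V|} := [set i | in_bag t (enum_val i)].

Lemma bag_convex t t' t'' u : t <= t' <= t'' -> in_bag t u -> in_bag t'' u -> in_bag t' u.
Proof.
rewrite /in_bag; case: u => u [l|j] /=; first by rewrite !orbF => *; apply/eqP; lia.
by case: j => [j|]; lia.
Qed.

(** For a wire in the bag the offset is already below [G]; the remainder only serves to form an
    ordinal. *)
Definition bag_code (t : nat) (u : V) : blk + ('I_G * 'I_p) + unit :=
  if u.1 == t :> nat then inl (inl u.2) else
  match u.2 with
  | inr (Some j) => inl (inr (Ordinal (ltn_pmod (u.1 - t.+1) G_gt0), j))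
  | _ => inr tt
  end.

Lemma bag_code_inj t u v :
  in_bag t u -> in_bag t v -> bag_code t u = bag_code t v -> u = v.
Proof.
case: u v => [u l] [v m]; rewrite /in_bag /bag_code /=.
case: (eqVneq (u : nat) t) => ut; case: (eqVneq (v : nat) t) => vt //=.
- by move=> _ _ [->]; congr (_, _); apply: val_inj; rewrite /= ut vt.
- by case: m => [//|[j|]].
- by case: l => [//|[j|]].
case: l => // -[j|] hu; case: m => // -[j'|] hv //; last first.
  by move=> _; congr (_, _); apply: val_inj => /=; lia.
case=> + ->; rewrite !modn_small; try lia.
by move=> e; congr (_, _); apply: val_inj => /=; lia.
Qed.

Lemma card_bag t : #|bag t| <= #|blk| + G * p + 1.
Proof.
have <- : #|{: blk + ('I_G * 'I_p) + unit}| = #|blk| + G * p + 1.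
  by rewrite card_sum card_sum card_prod card_ord card_ord card_unit.
rewrite -(card_in_imset (f := fun i => bag_code t (enum_val i))); first exact: max_card.
move=> i j; rewrite !inE => hi hj e; apply: enum_val_inj.
exact: (bag_code_inj hi hj e).
Qed.

Lemma bgraph_pathwidth : pathwidth (bgraph enc G bs) <= #|blk| + G * p + 1.
Proof.
apply: (@pathwidth_le (bgraph enc G bs) [seq bag t | t <- iota 0 T]); last first.
  by move=> X /mapP[t _ ->]; apply: card_bag.
have bagP (u : V) : bag u.1 \in [seq bag t | t <- iota 0 T].
  by apply: map_f; rewrite mem_iota /=.
have arcP (u v : V) : @garc (cor p) (hgt p) (wires p) (config g0) T (@blink g0 p G bs) (@btau g0 p enc bs) u v ->
    in_bag u.1 u && in_bag u.1 v.
  rewrite {1}/in_bag eqxx /= => /orP[/andP[/eqP e _]|].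
    by rewrite /in_bag e eqxx.
  case/existsP => j /andP[]; rewrite /blink /inter /in_bag => /eqP e.
  by case: (v.2) => // j' /andP[/eqP<- _]; rewrite e; rewrite leqnn -[X in X < _]addn0 ltn_add2l;
    case: (j) => [j0|]; rewrite ?G_gt0 orbT.
split.
- move=> i; exists (bag (enum_val i).1); first exact: bagP.
  by rewrite inE /in_bag eqxx.
- move=> i j /orP[] /arcP h.
    by exists (bag (enum_val i).1); rewrite ?bagP // !inE.
  by exists (bag (enum_val j).1); rewrite ?bagP // !inE andbC.
- move=> i j k ij jk; rewrite size_map size_iota => kT.
  rewrite !(nth_map 0) ?size_iota ?nth_iota; try lia.
  apply/subsetP => x; rewrite !inE => /andP[h1 h2].
  by apply: bag_convex h1 h2; rewrite ij.
Qed.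
End BlockPathwidth.

(** * Polynomial-time WHILE programs *)

(** One parameter plays constant and degree at once: every polynomial lies below some [pb c], and
    the family is monotone in both arguments. *)
Definition pb (c n : nat) := (n + c) ^ c.
Definition polyb (f : nat -> nat) := exists c, forall n, f n <= pb c n.

Lemma leq_expl m n e : m <= n -> m ^ e <= n ^ e.
Proof. by case: e => // e mn; rewrite leq_exp2r. Qed.

Lemma pb_mono c c' n n' : c <= c' -> n <= n' -> pb c n <= pb c' n'.
Proof.
move=> cc nn; rewrite /pb; case: (posnP c') => [c0|c0].
  by move: cc; rewrite c0 leqn0 => /eqP->.
by apply: (@leq_trans ((n' + c') ^ c)); [apply: leq_expl | apply: leq_pexp2l]; lia.
Qed.

Lemma polyb_pb c : polyb (pb c). Proof. by exists c. Qed.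

Lemma polyb_le f g : polyb g -> (forall n, f n <= g n) -> polyb f.
Proof. by move=> [c gc] fg; exists c => n; apply: leq_trans (fg n) (gc n). Qed.

Lemma polyb_id : polyb id.
Proof. by exists 1 => n; rewrite /pb expn1 leq_addr. Qed.

Lemma polyb_const k : polyb (fun=> k).
Proof.
exists k.+1 => n; rewrite /pb expnS; apply: leq_trans (leq_pmulr _ _); first by lia.
by rewrite expn_gt0; apply/orP; left; lia.
Qed.

Lemma polyb_add f g : polyb f -> polyb g -> polyb (fun n => f n + g n).
Proof.
move=> [a fa] [b gb]; exists (a + b).+2 => n; apply: leq_trans (leq_add (fa n) (gb n)) _.
have ha : pb a n <= (n + (a + b).+2) ^ (a + b).
  by apply: leq_trans (leq_expl a _) (leq_pexp2l _ _); lia.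
have hb : pb b n <= (n + (a + b).+2) ^ (a + b).
  by apply: leq_trans (leq_expl b _) (leq_pexp2l _ _); lia.
apply: leq_trans (leq_add ha hb) _; rewrite /pb [X in _ <= _ ^ X]/= expnS addnn -mul2n.
apply: leq_mul; first by lia.
by apply: leq_pexp2l; lia.
Qed.

Lemma polyb_mul f g : polyb f -> polyb g -> polyb (fun n => f n * g n).
Proof.
move=> [a fa] [b gb]; exists (a + b) => n; apply: leq_trans (leq_mul (fa n) (gb n)) _.
by rewrite /pb expnD; apply: leq_mul; apply: leq_expl; lia.
Qed.

Lemma polyb_comp c f : polyb f -> polyb (fun n => pb c (f n)).
Proof.
move=> [b fb]; exists (c + b + 2 + b.+1 * c) => n.
apply: leq_trans (pb_mono (leqnn c) (fb n)) _; rewrite {1}/pb.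
pose x := n + (c + b + 2).
have h : pb b n + c <= x ^ b.+1.
  apply: (@leq_trans (x ^ b + c)).
    by rewrite leq_add2r /pb; apply: leq_expl; rewrite /x; lia.
  have cx : c < x by rewrite /x; lia.
  case: (b) => [|b']; first by rewrite expn0 expn1.
  rewrite expnS [X in _ <= X]expnS; have : 0 < x ^ b' by rewrite expn_gt0 /x; lia.
  have : 1 < x by rewrite /x; lia.
  move=> x1 z0; apply: leq_trans (leq_mul x1 (leqnn _)); rewrite [x ^ _.+1]expnS mul2n -addnn leq_add2l.
  by apply: leq_trans (ltnW cx) _; apply: leq_pmulr.
apply: leq_trans (leq_expl c h) _; rewrite -expnM /pb.
apply: leq_trans (leq_expl _ (_ : x <= n + (c + b + 2 + b.+1 * c))) _; first by rewrite /x; lia.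
by apply: leq_pexp2l; lia.
Qed.

Ltac polyb_tac :=
  repeat first [ apply: polyb_add | apply: polyb_mul | apply: polyb_comp
               | apply: polyb_const | apply: polyb_id | apply: polyb_pb | done ].

(** * Variables of programs and the frame property *)

Fixpoint evars_lt (k : nat) (a : expr) : bool :=
  match a with
  | EVar x => x < k
  | ENil => true
  | ECons a1 a2 => evars_lt k a1 && evars_lt k a2
  | EHd a1 | ETl a1 => evars_lt k a1
  end.

Fixpoint pvars_lt (k : nat) (p : program) : bool :=
  match p with
  | Assign x a => (x < k) && evars_lt k a
  | Seq p1 p2 => pvars_lt k p1 && pvars_lt k p2
  | If a p1 p2 => [&& evars_lt k a, pvars_lt k p1 & pvars_lt k p2]
  | While a p1 => evars_lt k a && pvars_lt k p1
  end.

Lemma evars_lt_leq k k' a : k <= k' -> evars_lt k a -> evars_lt k' a.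
Proof. by move=> kk; elim: a => //= [x|a1 IH1 a2 IH2 /andP[/IH1-> /IH2->]] //; lia. Qed.

Lemma pvars_lt_leq k k' p : k <= k' -> pvars_lt k p -> pvars_lt k' p.
Proof.
move=> kk; have ev a := @evars_lt_leq _ _ a kk.
elim: p => [x a|p1 IH1 p2 IH2|a p1 IH1 p2 IH2|a p1 IH1] /=.
- by case/andP => xk /ev->; rewrite andbT; lia.
- by case/andP => /IH1-> /IH2->.
- by case/and3P => /ev-> /IH1-> /IH2->.
- by case/andP => /ev-> /IH1->.
Qed.

Lemma evars_bound a : exists k, evars_lt k a.
Proof.
elim: a => [x||a1 [k1 h1] a2 [k2 h2]|a [k h]|a [k h]] /=; try by exists k.
- by exists x.+1.
- by exists 0.
- by exists (k1 + k2); rewrite (evars_lt_leq _ h1) ?(evars_lt_leq _ h2); lia.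
Qed.

Lemma pvars_bound p : exists k, pvars_lt k p.
Proof.
elim: p => [x a|p1 [k1 h1] p2 [k2 h2]|a p1 [k1 h1] p2 [k2 h2]|a p1 [k1 h1]] /=.
- have [k h] := evars_bound a; exists (x.+1 + k); rewrite (evars_lt_leq _ h); lia.
- by exists (k1 + k2); rewrite (pvars_lt_leq _ h1) ?(pvars_lt_leq _ h2); lia.
- have [k h] := evars_bound a; exists (k + (k1 + k2)).
  by rewrite (evars_lt_leq _ h) ?(pvars_lt_leq _ h1) ?(pvars_lt_leq _ h2); lia.
- have [k h] := evars_bound a; exists (k + k1).
  by rewrite (evars_lt_leq _ h) ?(pvars_lt_leq _ h1); lia.
Qed.

Lemma eval_agree k a s s1 : evars_lt k a -> (forall j, j < k -> s1 j = s j) ->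
  eval s1 a = eval s a.
Proof.
move=> + ag; elim: a => [x|//|a1 IH1 a2 IH2|a1 IH|a1 IH] /=; first exact: ag.
- by case/andP => /IH1-> /IH2->.
- by move/IH->.
- by move/IH->.
Qed.

(** A program neither reads nor writes variables from [k] on, so they can hold saved values while it
    runs as a subprogram, at the same cost. *)
Lemma exec_frame k p s t s' : exec p s t s' -> pvars_lt k p ->
  forall s1 : store, (forall j, j < k -> s1 j = s j) ->
  exists s1', [/\ exec p s1 t s1', forall j, j < k -> s1' j = s' j
                & forall j, k <= j -> s1' j = s1 j].
Proof.
elim=> {p s t s'}.
- move=> s x a /= /andP[xk ak] s1 ag; exists (update s1 x (eval s1 a)); split.
  + exact: ExecAssign.
  + by move=> j jk; rewrite /update; case: eqP => _; [apply: eval_agree ak _ | apply: ag].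
  + by move=> j kj; rewrite /update ifF //; lia.
- move=> p1 p2 s1 s2 s3 t1 t2 _ IH1 _ IH2 /= /andP[h1 h2] r1 ag.
  have [r2 [e1 ag2 o2]] := IH1 h1 r1 ag; have [r3 [e2 ag3 o3]] := IH2 h2 r2 ag2.
  by exists r3; split=> //; [apply: ExecSeq e1 e2 | move=> j kj; rewrite o3 ?o2].
- move=> a p1 p2 s s' t tr _ IH /= /and3P[ha h1 h2] r ag.
  have [r' [e1 ag2 o2]] := IH h1 r ag; exists r'; split=> //.
  by apply: ExecIfTrue e1; rewrite (eval_agree ha ag).
- move=> a p1 p2 s s' t tr _ IH /= /and3P[ha h1 h2] r ag.
  have [r' [e1 ag2 o2]] := IH h2 r ag; exists r'; split=> //.
  by apply: ExecIfFalse e1; rewrite (eval_agree ha ag).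
- move=> a p s1 s2 s3 t1 t2 tr _ IH1 _ IH2 /= /andP[ha h1] r ag.
  have [r2 [e1 ag2 o2]] := IH1 h1 r ag.
  have [|r3 [e2 ag3 o3]] := IH2 _ r2 ag2; first by rewrite /= ha.
  exists r3; split=> //; last by move=> j kj; rewrite o3 ?o2.
  by apply: ExecWhileTrue e1 e2; rewrite (eval_agree ha ag).
- move=> a p s tr /= /andP[ha h1] r ag; exists r; split=> //.
  by apply: ExecWhileFalse; rewrite (eval_agree ha ag).
Qed.

Definition single (x : tree) : store := update (fun=> Leaf) 0 x.

Definition st (k : nat) (x : tree) (r : seq tree) : store :=
  fun j => if j == 0 then x else if j < k then Leaf else nth Leaf r (j - k).

Lemma st_clean k x r : all (fun u => ~~ truth u) r -> st k x r = single x.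
Proof.
move=> h; apply/funext => j; rewrite /st /single /update; case: eqP => // _.
case: ltnP => // kj; case: (ltnP (j - k) (size r)) => jr; last by rewrite nth_default.
by have := all_nthP Leaf h _ jr; case: (nth _ _ _).
Qed.

Lemma st0 k x r : st k x r 0 = x. Proof. by []. Qed.

Lemma stk k x r i : 0 < k -> st k x r (k + i) = nth Leaf r i.
Proof.
move=> k0; rewrite /st ifF; last by lia.
by rewrite ifF ?addKn //; lia.
Qed.

Lemma update_st0 k x r y : update (st k x r) 0 y = st k y r.
Proof. by apply/funext => j; rewrite /update /st; case: eqP. Qed.

Lemma update_stk k x r i y : 0 < k ->
  update (st k x r) (k + i) y = st k x (set_nth Leaf r i y).
Proof.
move=> k0; apply/funext => j; rewrite /update /st nth_set_nth /=.
case: eqP => [->|ne]; last by case: eqP => // j0; case: ltnP => // kj; rewrite ifF //; lia.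
by case: eqP => [|_]; [lia | rewrite ltnNge leq_addr /= addKn eqxx].
Qed.

Definition exec_le p s b s' := exists2 t, exec p s t s' & t <= b.

Lemma exec_le_seq p1 p2 s1 s2 s3 b1 b2 :
  exec_le p1 s1 b1 s2 -> exec_le p2 s2 b2 s3 -> exec_le (Seq p1 p2) s1 (b1 + b2) s3.
Proof.
by move=> [t1 e1 h1] [t2 e2 h2]; exists (t1 + t2); [apply: ExecSeq e1 e2 | apply: leq_add].
Qed.

Lemma exec_le_assign0 k x r a : exec_le (Assign 0 a) (st k x r) (eval_time a).+1
  (st k (eval (st k x r) a) r).
Proof. by exists (eval_time a).+1; rewrite // -[st k (eval _ _) r](update_st0 k x); apply: ExecAssign. Qed.

Lemma exec_le_assignk k x r i a : 0 < k ->
  exec_le (Assign (k + i) a) (st k x r) (eval_time a).+1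
  (st k x (set_nth Leaf r i (eval (st k x r) a))).
Proof. by move=> k0; exists (eval_time a).+1; rewrite // -update_stk //; apply: ExecAssign. Qed.

Lemma exec_le_leq p s b b' s' : exec_le p s b s' -> b <= b' -> exec_le p s b' s'.
Proof. by move=> [t e h] bb; exists t => //; apply: leq_trans h bb. Qed.

Lemma exec_le_frame k p x y b r : 0 < k -> pvars_lt k p ->
  exec_le p (single x) b (single y) -> exec_le p (st k x r) b (st k y r).
Proof.
move=> k0 pk [t e tb]; have [|s1 [e1 h1 h2]] := exec_frame e pk (s1 := st k x r).
  by move=> j jk; rewrite /st /single /update jk; case: eqP.
exists t => //; suff -> : st k y r = s1 by [].
apply/funext => j; case: (ltnP j k) => jk.
  by rewrite h1 // /st /single /update jk; case: eqP.
by rewrite h2 // /st; case: eqP => // j0; lia.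
Qed.

Lemma tree_size_gt0 u : 0 < tree_size u. Proof. by case: u. Qed.

(* The size of the result is bounded separately: sharing lets a program build a
   tree exponentially larger than its running time. *)
Definition ptime (f : tree -> tree) :=
  exists (p : program) (c : nat), forall x,
    exec_le p (single x) (pb c (tree_size x)) (single (f x)) /\
    tree_size (f x) <= pb c (tree_size x).

Lemma ptimeI f p b : polyb b ->
  (forall x, exec_le p (single x) (b (tree_size x)) (single (f x)) /\
             tree_size (f x) <= b (tree_size x)) -> ptime f.
Proof.
move=> [c bc] h; exists p, c => x; have [h1 h2] := h x.
by split; [apply: exec_le_leq h1 (bc _) | apply: leq_trans h2 (bc _)].
Qed.

Lemma ptime_ext f g : ptime f -> f =1 g -> ptime g.
Proof. by move=> h /funext <-. Qed.

Lemma ptime_size f : ptime f -> exists c, forall x, tree_size (f x) <= pb c (tree_size x).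
Proof. by move=> [p [c h]]; exists c => x; case: (h x). Qed.

Lemma ptime_comp f g : ptime f -> ptime g -> ptime (fun x => f (g x)).
Proof.
move=> [pf [cf hf]] [pg [cg hg]].
apply: (@ptimeI _ (Seq pg pf) (fun n => pb cg n + pb cf (pb cg n))); first by polyb_tac.
move=> x; have [eg sg] := hg x; have [ef sf] := hf (g x).
have le := pb_mono (leqnn cf) sg; split.
  by apply: exec_le_seq eg _; apply: exec_le_leq ef le.
by apply: leq_trans sf _; apply: leq_trans le (leq_addl _ _).
Qed.

Lemma ptime_expr a f : evars_lt 1 a -> (forall x, eval (single x) a = f x) ->
  (exists2 b, polyb b & forall x, tree_size (f x) <= b (tree_size x)) -> ptime f.
Proof.
move=> ha fE [b pbb hb].
apply: (@ptimeI _ (Assign 0 a) (fun n => (eval_time a).+1 + b n)); first by polyb_tac.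
move=> x; split; last by apply: leq_trans (hb x) (leq_addl _ _).
exists (eval_time a).+1; last exact: leq_addr.
have -> : single (f x) = update (single x) 0 (f x).
  by apply/funext => j; rewrite /single /update; case: eqP.
by rewrite -fE; apply: ExecAssign.
Qed.

Lemma ptime_id : ptime id.
Proof. by apply: (@ptime_expr (EVar 0)) => //; exists id => //; exact: polyb_id. Qed.

Fixpoint quote (u : tree) : expr := if u is Node l r then ECons (quote l) (quote r) else ENil.

Lemma quote_eval u s : eval s (quote u) = u.
Proof. by elim: u => //= l -> r ->. Qed.

Lemma ptime_const u : ptime (fun=> u).
Proof.
apply: (@ptime_expr (quote u)); first by elim: u => //= l -> r ->.
  by move=> x; rewrite quote_eval.
by exists (fun=> tree_size u) => //; exact: polyb_const.
Qed.

Lemma size_lsub u : tree_size (lsub u) <= tree_size u. Proof. by case: u => //= l r; lia. Qed.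
Lemma size_rsub u : tree_size (rsub u) <= tree_size u. Proof. by case: u => //= l r; lia. Qed.

Lemma ptime_lsub f : ptime f -> ptime (fun x => lsub (f x)).
Proof.
apply: (@ptime_comp lsub); apply: (@ptime_expr (EHd (EVar 0))) => //.
by exists id; [exact: polyb_id | exact: size_lsub].
Qed.

Lemma ptime_rsub f : ptime f -> ptime (fun x => rsub (f x)).
Proof.
apply: (@ptime_comp rsub); apply: (@ptime_expr (ETl (EVar 0))) => //.
by exists id; [exact: polyb_id | exact: size_rsub].
Qed.

Lemma pvars_bound3 p1 p2 p3 : exists k, [/\ 0 < k, pvars_lt k p1, pvars_lt k p2 & pvars_lt k p3].
Proof.
have [k1 h1] := pvars_bound p1; have [k2 h2] := pvars_bound p2; have [k3 h3] := pvars_bound p3.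
exists (k1 + k2 + k3).+1; split=> //.
- by apply: pvars_lt_leq h1; lia.
- by apply: pvars_lt_leq h2; lia.
- by apply: pvars_lt_leq h3; lia.
Qed.

Lemma ptime_node f g : ptime f -> ptime g -> ptime (fun x => Node (f x) (g x)).
Proof.
move=> [pf [cf hf]] [pg [cg hg]].
have [k [k0 kf kg _]] := pvars_bound3 pf pg pg.
pose prog := Seq (Assign (k + 0) (EVar 0)) (Seq pf (Seq (Assign (k + 1) (EVar 0))
  (Seq (Assign 0 (EVar (k + 0))) (Seq pg (Seq (Assign 0 (ECons (EVar (k + 1)) (EVar 0)))
  (Seq (Assign (k + 0) ENil) (Assign (k + 1) ENil))))))).
apply: (@ptimeI _ prog (fun n => pb cf n + pb cg n + 20)); first by polyb_tac.
move=> x; have [ef sf] := hf x; have [eg sg] := hg x; split; last by rewrite /=; lia.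
rewrite -(@st_clean k x [::]) // -(@st_clean k (Node (f x) (g x)) [:: Leaf; Leaf]) //.
apply: (@exec_le_leq _ _ (2 + (pb cf (tree_size x) + (2 + (2 + (pb cg (tree_size x) + (4 + (2 + 2)))))))); last by lia.
apply: exec_le_seq; first exact: exec_le_assignk.
apply: exec_le_seq; first exact: exec_le_frame ef.
apply: exec_le_seq; first exact: exec_le_assignk.
apply: exec_le_seq; first exact: exec_le_assign0.
rewrite /= !stk //=.
apply: exec_le_seq; first exact: exec_le_frame eg.
apply: exec_le_seq; first exact: exec_le_assign0.
rewrite /= !stk //= st0.
apply: exec_le_seq; first exact: exec_le_assignk.
exact: exec_le_assignk.
Qed.

Lemma ptime_if c f g : ptime c -> ptime f -> ptime g ->
  ptime (fun x => if truth (c x) then f x else g x).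
Proof.
move=> [pc [cc hc]] [pf [cf hf]] [pg [cg hg]].
have [k [k0 kc kf kg]] := pvars_bound3 pc pf pg.
pose prog := Seq (Assign (k + 0) (EVar 0)) (Seq pc (Seq (Assign (k + 1) (EVar 0))
  (Seq (Assign 0 (EVar (k + 0))) (Seq (Assign (k + 0) ENil)
  (Seq (If (EVar (k + 1)) pf pg) (Assign (k + 1) ENil)))))).
apply: (@ptimeI _ prog (fun n => pb cc n + pb cf n + pb cg n + 20)); first by polyb_tac.
move=> x; have [ec sc] := hc x; have [ef sf] := hf x; have [eg sg] := hg x.
split; last by case: ifP => _; lia.
set y := if _ then _ else _.
rewrite -(@st_clean k x [::]) // -(@st_clean k y [:: Leaf; Leaf]) //.
set n := tree_size x.
apply: (@exec_le_leq _ _ (2 + (pb cc n + (2 + (2 + (2 + ((1 + (pb cf n + pb cg n)).+1 + 2))))))); last by lia.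
apply: exec_le_seq; first exact: exec_le_assignk.
apply: exec_le_seq; first exact: exec_le_frame ec.
apply: exec_le_seq; first exact: exec_le_assignk.
apply: exec_le_seq; first exact: exec_le_assign0.
apply: exec_le_seq; first exact: exec_le_assignk.
rewrite /= !stk //= st0.
apply: (@exec_le_seq _ _ _ (st k y [:: Leaf; c x])); last exact: exec_le_assignk.
rewrite /y; case: ifP => ct.
  have [t e tb] := exec_le_frame [:: Leaf; c x] k0 kf ef.
  exists (eval_time (EVar (k + 1)) + t).+1; last by rewrite -/n in tb; rewrite /=; lia.
  by apply: ExecIfTrue e; rewrite /= stk.
have [t e tb] := exec_le_frame [:: Leaf; c x] k0 kg eg.
exists (eval_time (EVar (k + 1)) + t).+1; last by rewrite -/n in tb; rewrite /=; lia.
by apply: ExecIfFalse e; rewrite /= stk //= ct.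
Qed.

(** * Lists as trees, and loops over them *)

Fixpoint spine (u : tree) : seq tree := if u is Node a v then a :: spine v else [::].
Definition ltree (s : seq tree) : tree := foldr Node Leaf s.

Lemma spineK u : ltree (spine u) = u. Proof. by elim: u => //= a _ v ->. Qed.
Lemma ltreeK s : spine (ltree s) = s. Proof. by elim: s => //= a s ->. Qed.

Lemma size_spine_elem u e : e \in map tree_size (spine u) -> e < tree_size u.
Proof.
elim: u => //= a _ v IH; rewrite inE => /orP[/eqP->|/IH]; lia.
Qed.

Lemma size_spine u : size (spine u) < tree_size u.
Proof. by elim: u => //= a _ v IH; lia. Qed.

(* Loop variables: [k] the environment, [k + 1] the rest of the list,
   [k + 2] the current value. *)
Lemma exec_le_loop k ph (h : tree -> tree) x B :
  0 < k -> pvars_lt k ph -> forall l acc y,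
  (forall l1 e l2, spine l = l1 ++ e :: l2 ->
     let z := Node (foldl (fun acc e => h (Node acc (Node e x))) acc l1) (Node e x) in
     exec_le ph (single z) B (single (h z))) ->
  exists y', exec_le (While (EVar (k + 1))
    (Seq (Assign 0 (ECons (EVar (k + 2)) (ECons (EHd (EVar (k + 1))) (EVar (k + 0)))))
    (Seq ph (Seq (Assign (k + 2) (EVar 0)) (Assign (k + 1) (ETl (EVar (k + 1))))))))
   (st k y [:: x; l; acc]) (2 + (size (spine l)) * (B + 20))
   (st k y' [:: x; Leaf; foldl (fun acc e => h (Node acc (Node e x))) acc (spine l)]).
Proof.
move=> k0 kh; elim=> [|e _ l IH] acc y hB.
  exists y; exists 2 => //; apply: (@ExecWhileFalse (EVar (k + 1))).
  by rewrite /= stk.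
have [|y' [t2 e2 h2]] := IH (h (Node acc (Node e x))) (h (Node acc (Node e x))).
  by move=> l1 e1 l2 lE; have := hB (e :: l1) e1 l2; rewrite /= lE => /(_ erefl).
have [t1 e1 h1] : exec_le (Seq (Assign 0 (ECons (EVar (k + 2)) (ECons (EHd (EVar (k + 1))) (EVar (k + 0)))))
    (Seq ph (Seq (Assign (k + 2) (EVar 0)) (Assign (k + 1) (ETl (EVar (k + 1)))))))
    (st k y [:: x; Node e l; acc]) (7 + (B + (2 + 3)))
    (st k (h (Node acc (Node e x))) [:: x; l; h (Node acc (Node e x))]).
  apply: exec_le_seq; first exact: exec_le_assign0.
  rewrite /= !stk //=.
  apply: exec_le_seq.
    by apply: exec_le_frame; rewrite ?k0 //; apply: (hB [::] e (spine l)).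
  apply: exec_le_seq; first exact: exec_le_assignk.
  rewrite /=.
  have -> : [:: x; l; h (Node acc (Node e x))] = set_nth Leaf [:: x; Node e l; h (Node acc (Node e x))] 1
     (eval (st k (h (Node acc (Node e x))) [:: x; Node e l; h (Node acc (Node e x))]) (ETl (EVar (k + 1)))).
    by rewrite /= stk.
  exact: exec_le_assignk.
exists y'; exists (eval_time (EVar (k + 1)) + t1 + t2).+1.
  by apply: ExecWhileTrue e1 e2; rewrite /= stk.
by rewrite /= mulSn; lia.
Qed.

(** The bound on all intermediate accumulators has to be assumed: iterating a polynomially bounded
    function may produce exponential growth. *)
Lemma ptime_fold h a0 l c : ptime h -> ptime a0 -> ptime l ->
  (forall x l1 l2, spine (l x) = l1 ++ l2 ->
     tree_size (foldl (fun acc e => h (Node acc (Node e x))) (a0 x) l1) <= pb c (tree_size x)) ->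
  ptime (fun x => foldl (fun acc e => h (Node acc (Node e x))) (a0 x) (spine (l x))).
Proof.
move=> [ph [ch hh]] [pa [ca ha]] [pl [cl hl]] bnd.
have [k [k0 kh ka kl]] := pvars_bound3 ph pa pl.
pose loop := While (EVar (k + 1))
    (Seq (Assign 0 (ECons (EVar (k + 2)) (ECons (EHd (EVar (k + 1))) (EVar (k + 0)))))
    (Seq ph (Seq (Assign (k + 2) (EVar 0)) (Assign (k + 1) (ETl (EVar (k + 1))))))).
pose prog := Seq (Assign (k + 0) (EVar 0)) (Seq pl (Seq (Assign (k + 1) (EVar 0))
  (Seq (Assign 0 (EVar (k + 0))) (Seq pa (Seq (Assign (k + 2) (EVar 0))
  (Seq loop (Seq (Assign 0 (EVar (k + 2)))
  (Seq (Assign (k + 0) ENil) (Assign (k + 2) ENil))))))))).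
pose B n := pb ch (pb c n + (pb cl n + n) + 2).
apply: (@ptimeI _ prog (fun n => pb cl n + pb ca n + pb cl n * (B n + 20) + pb c n + 40)).
  by rewrite /B; polyb_tac.
move=> x; have [el sl] := hl x; have [ea sa] := ha x.
have := bnd x (spine (l x)) [::]; rewrite cats0 => /(_ erefl) sz; split; last by lia.
set res := foldl _ _ _ in sz *; set n := tree_size x in sl sa el ea sz *.
have [|y' loopE] := @exec_le_loop k ph h x (B n) k0 kh (l x) (a0 x) (a0 x).
  move=> l1 e l2 lE /=; set z := Node _ _; have [ez _] := hh z.
  apply: exec_le_leq ez _; apply: pb_mono => //; rewrite /z /=.
  have le1 := bnd x l1 (e :: l2) lE.
  have le2 : tree_size e < tree_size (l x).
    by apply: size_spine_elem; rewrite lE map_cat mem_cat inE eqxx orbT.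
  rewrite -/n in le1 *; lia.
rewrite -(@st_clean k x [::]) // -(@st_clean k res [:: Leaf; Leaf; Leaf]) //.
apply: (@exec_le_leq _ _ (2 + (pb cl n + (2 + (2 + (pb ca n + (2 +
  ((2 + (size (spine (l x))) * (B n + 20)) + (2 + (2 + 2)))))))))); last first.
  have : size (spine (l x)) * (B n + 20) <= pb cl n * (B n + 20).
    by rewrite leq_mul2r; have := size_spine (l x); lia.
  by move: (size _ * _) (pb cl n * _) => u v; lia.
apply: exec_le_seq; first exact: exec_le_assignk.
apply: exec_le_seq; first exact: exec_le_frame el.
apply: exec_le_seq; first exact: exec_le_assignk.
apply: exec_le_seq; first exact: exec_le_assign0.
rewrite /= !stk //=.
apply: exec_le_seq; first exact: exec_le_frame ea.
apply: exec_le_seq; first exact: exec_le_assignk.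
apply: exec_le_seq; first exact: loopE.
apply: exec_le_seq; first exact: exec_le_assign0.
rewrite /= !stk //= -/res.
apply: exec_le_seq; first exact: exec_le_assignk.
exact: exec_le_assignk.
Qed.

Lemma size_ltree_cat s1 s2 :
  tree_size (ltree (s1 ++ s2)) = (tree_size (ltree s1)).-1 + tree_size (ltree s2).
Proof.
elim: s1 => //= u s1 ->; have := tree_size_gt0 (ltree s1); lia.
Qed.

Lemma size_ltree_rev s : tree_size (ltree (rev s)) = tree_size (ltree s).
Proof.
elim: s => // u s IH; rewrite rev_cons -cats1 size_ltree_cat IH /=.
by have := tree_size_gt0 (ltree s); lia.
Qed.

Lemma size_ltree_prefix s1 s2 : tree_size (ltree s1) <= tree_size (ltree (s1 ++ s2)).
Proof. by rewrite size_ltree_cat; have := tree_size_gt0 (ltree s1); have := tree_size_gt0 (ltree s2); lia. Qed.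

Lemma ptime_catrev f g : ptime f -> ptime g ->
  ptime (fun x => ltree (catrev (spine (f x)) (spine (g x)))).
Proof.
move=> pf pg; have [cf sf] := ptime_size pf; have [cg sg] := ptime_size pg.
have [c hc] : polyb (fun n => pb cf n + pb cg n) by polyb_tac.
have ph : ptime (fun z => Node (lsub (rsub z)) (lsub z)).
  by apply: ptime_node; do ?[apply: ptime_lsub | apply: ptime_rsub]; apply: ptime_id.
have foldE l a : foldl (fun acc e => Node e acc) a l = ltree (catrev l (spine a)).
  by elim: l a => [|e l IH] a /=; rewrite ?spineK ?IH.
apply: ptime_ext (ptime_fold (c := c) ph pg pf _) _ => [x l1 l2 lE|x] /=; last exact: foldE.
rewrite foldE catrevE size_ltree_cat size_ltree_rev spineK.
apply: leq_trans (hc _); apply: leq_add (sg x).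
have := sf x; rewrite -{1}(spineK (f x)) lE; have := size_ltree_prefix l1 l2; lia.
Qed.

Lemma ptime_rev f : ptime f -> ptime (fun x => ltree (rev (spine (f x)))).
Proof. by move=> pf; apply: (ptime_catrev pf (ptime_const Leaf)). Qed.

Lemma ptime_cat f g : ptime f -> ptime g -> ptime (fun x => ltree (spine (f x) ++ spine (g x))).
Proof.
move=> pf pg; apply: ptime_ext (ptime_catrev (ptime_rev pf) pg) _ => x.
by rewrite ltreeK catrevE revK.
Qed.

Definition flatmap (h : tree -> tree) (l : tree) : tree :=
  ltree (flatten [seq spine (h e) | e <- spine l]).

Lemma ptime_flatmap h l : ptime h -> ptime l ->
  ptime (fun x => flatmap (fun e => h (Node e x)) (l x)).
Proof.
move=> ph pl; have [ch sh] := ptime_size ph; have [cl sl] := ptime_size pl.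
have [c hc] : polyb (fun n => pb cl n * pb ch (pb cl n + n + 1) + 1) by polyb_tac.
(* The pieces are accumulated in reverse by [catrev]; a single reversal at the end restores the
   order. *)
pose step z := ltree (catrev (spine (h (rsub z))) (spine (lsub z))).
have pstep : ptime step.
  by apply: ptime_catrev; [apply: (ptime_comp ph); apply: ptime_rsub | apply: ptime_lsub]; apply: ptime_id.
have foldE x s : foldl (fun acc e => step (Node acc (Node e x))) Leaf s =
    ltree (rev (flatten [seq spine (h (Node e x)) | e <- s])).
  elim/last_ind: s => // s e IH.
  by rewrite foldl_rcons IH /step /= ltreeK catrevE map_rcons flatten_rcons rev_cat.
have pfold : ptime (fun x => foldl (fun acc e => step (Node acc (Node e x))) Leaf (spine (l x))).
  apply: (ptime_fold (c := c) pstep (ptime_const Leaf) pl) => x l1 l2 lE.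
  rewrite foldE size_ltree_rev; apply: leq_trans (hc _); set n := tree_size x.
  have bnd : forall s, {subset map tree_size s <= map tree_size (spine (l x))} ->
      tree_size (ltree (flatten [seq spine (h (Node e x)) | e <- s])) <=
      size s * pb ch (pb cl n + n + 1) + 1.
    elim=> // e s IH sub; rewrite /= size_ltree_cat spineK mulSn.
    have /IH h1 : {subset map tree_size s <= map tree_size (spine (l x))}.
      by move=> y ys; apply: sub; rewrite inE ys orbT.
    have le : tree_size e < tree_size (l x) by apply: size_spine_elem; apply: sub; rewrite inE eqxx.
    have h2 := sh (Node e x); have h3 := sl x.
    have h4 : pb ch (tree_size (Node e x)) <= pb ch (pb cl n + n + 1).
      by apply: pb_mono => //=; rewrite -/n; rewrite -/n in h3; lia.
    have := tree_size_gt0 (h (Node e x)).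
    by have := leq_trans h2 h4; move: h1; lia.
  apply: leq_trans (bnd l1 _) _; first by move=> y; rewrite lE map_cat mem_cat => ->.
  rewrite leq_add2r leq_mul2r; apply/orP; right.
  by have := sl x; have := size_spine (l x); rewrite lE size_cat -/n; lia.
apply: ptime_ext (ptime_rev pfold) _ => x.
by rewrite foldE ltreeK revK.
Qed.

Definition tmap (h : tree -> tree) (l : tree) : tree := ltree [seq h e | e <- spine l].

Lemma ptime_map h l : ptime h -> ptime l -> ptime (fun x => tmap (fun e => h (Node e x)) (l x)).
Proof.
move=> ph pl; have ph' : ptime (fun z => Node (h z) Leaf) by apply: ptime_node => //; apply: ptime_const.
apply: ptime_ext (ptime_flatmap ph' pl) _ => x; rewrite /flatmap /tmap; congr ltree.
by elim: (spine (l x)) => //= e s ->.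
Qed.

(** * Unary arithmetic *)

Lemma tree_of_natE n : tree_of_nat n = ltree (nseq n Leaf).
Proof. by elim: n => //= n; rewrite /tree_of_nat /= => ->. Qed.

Lemma spine_nat n : size (spine (tree_of_nat n)) = n.
Proof. by rewrite tree_of_natE ltreeK size_nseq. Qed.

Lemma size_nat n : tree_size (tree_of_nat n) = n.*2.+1.
Proof. by elim: n => //= n IH; rewrite IH; lia. Qed.

Lemma truth_ltree s : truth (ltree s) = (0 < size s). Proof. by case: s. Qed.

Lemma ptime_drop f g : ptime f -> ptime g ->
  ptime (fun x => ltree (drop (size (spine (f x))) (spine (g x)))).
Proof.
move=> pf pg; have [cg sg] := ptime_size pg.
have ph : ptime (fun z => rsub (lsub z)) by apply: ptime_rsub; apply: ptime_lsub; apply: ptime_id.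
have foldE l a : foldl (fun acc (_ : tree) => rsub acc) a l = ltree (drop (size l) (spine a)).
  elim: l a => [|e l IH] a /=; first by rewrite drop0 spineK.
  by rewrite IH; case: a.
apply: ptime_ext (ptime_fold (c := cg) ph pg pf _) _ => [x l1 l2 lE|x] /=; last exact: foldE.
rewrite foldE; apply: leq_trans (sg x).
rewrite -{2}(spineK (g x)) -{2}(cat_take_drop (size l1) (spine (g x))) size_ltree_cat.
exact: leq_addl.
Qed.

Lemma ptime_ltn f g : ptime f -> ptime g ->
  ptime (fun x => tree_of_bool (size (spine (f x)) < size (spine (g x)))).
Proof.
move=> pf pg; apply: ptime_ext (ptime_if (ptime_drop pf pg) (ptime_const (Node Leaf Leaf)) (ptime_const Leaf)) _.
by move=> x; rewrite truth_ltree size_drop subn_gt0.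
Qed.

Definition eqlen (u v : tree) := size (spine u) == size (spine v).

Lemma ptime_eqlen_if f g a b : ptime f -> ptime g -> ptime a -> ptime b ->
  ptime (fun x => if eqlen (f x) (g x) then a x else b x).
Proof.
move=> pf pg pa pb.
apply: ptime_ext (ptime_if (ptime_ltn pf pg) pb (ptime_if (ptime_ltn pg pf) pb pa)) _ => x.
by rewrite /eqlen; case: ltngtP.
Qed.

(** With [s = 1] this numbers the blocks; with [s = gam] it gives the first variable of each
    group. *)
Definition numbered (s : nat) (l : seq tree) : seq tree :=
  [seq Node (tree_of_nat (i * s)) (nth Leaf l i) | i <- iota 0 (size l)].

Lemma numbered_rcons s l e :
  numbered s (rcons l e) = rcons (numbered s l) (Node (tree_of_nat (size l * s)) e).
Proof.
rewrite /numbered size_rcons -addn1 iotaD map_cat /= add0n nth_rcons ltnn eqxx cats1.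
congr rcons; apply/eq_in_map => i; rewrite mem_iota /= => il.
by rewrite nth_rcons il.
Qed.

Lemma size_ltree_numbered s l : tree_size (ltree (numbered s l)) <=
  tree_size (ltree l) + size l * (2 + (size l * s).*2).
Proof.
elim/last_ind: l => // l e IH; rewrite numbered_rcons -!cats1 !size_ltree_cat size_cat /= size_nat.
have := tree_size_gt0 (ltree (numbered s l)); have := tree_size_gt0 (ltree l).
rewrite (addn1 (size l)) mulSn; have : size l * (2 + (size l * s).*2) <= size l * (2 + ((size l).+1 * s).*2).
  by rewrite leq_mul2l mulSn; lia.
by move: IH; lia.
Qed.

Lemma nat_addn n u : iter n (Node Leaf) u = ltree (nseq n Leaf ++ spine u).
Proof. by elim: n => /= [|n ->]; rewrite ?spineK. Qed.

Lemma ptime_addn n f : ptime f -> ptime (fun x => iter n (Node Leaf) (f x)).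
Proof. by move=> pf; elim: n => //= n IH; apply: ptime_node => //; apply: ptime_const. Qed.

Lemma tree_of_nat_add m n : iter m (Node Leaf) (tree_of_nat n) = tree_of_nat (m + n).
Proof. by rewrite /tree_of_nat iterD. Qed.

Lemma ptime_numbered s f : ptime f -> ptime (fun x => ltree (numbered s (spine (f x)))).
Proof.
move=> pf; have [cf sf] := ptime_size pf.
have [c hc] : polyb (fun n => (pb cf n * s).*2 + (pb cf n + pb cf n * (2 + (pb cf n * s).*2)) + 2).
  apply: polyb_le (_ : polyb (fun n => 2 * (pb cf n * s) + (pb cf n + pb cf n * (2 + 2 * (pb cf n * s))) + 2)) _.
    by polyb_tac.
  by move=> n; rewrite !mul2n.
pose step z := let cnt := lsub (lsub z) in
  Node (iter s (Node Leaf) cnt) (Node (Node cnt (lsub (rsub z))) (rsub (lsub z))).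
have pz : ptime id := ptime_id.
have pstep : ptime step.
  apply: ptime_node; first by apply: ptime_addn; do 2![apply: ptime_lsub].
  apply: ptime_node; last by apply: ptime_rsub; apply: ptime_lsub.
  by apply: ptime_node; apply: ptime_lsub; [apply: ptime_lsub | apply: ptime_rsub].
have foldE x l : foldl (fun acc e => step (Node acc (Node e x))) (Node Leaf Leaf) l =
    Node (tree_of_nat (size l * s)) (ltree (rev (numbered s l))).
  elim/last_ind: l => // l e IH; rewrite foldl_rcons IH /step /= numbered_rcons rev_rcons.
  by rewrite size_rcons mulSn tree_of_nat_add.
have pfold : ptime (fun x => foldl (fun acc e => step (Node acc (Node e x))) (Node Leaf Leaf) (spine (f x))).
  apply: (ptime_fold (c := c) pstep (ptime_const _) pf) => x l1 l2 lE.
  rewrite foldE /= size_ltree_rev size_nat; apply: leq_trans (hc _).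
  have h1 : size l1 <= pb cf (tree_size x).
    by apply: leq_trans (sf x); have := size_spine (f x); rewrite lE size_cat; lia.
  have h2 : tree_size (ltree l1) <= pb cf (tree_size x).
    apply: leq_trans (sf x); rewrite -(spineK (f x)) lE; exact: size_ltree_prefix.
  have h3 := size_ltree_numbered s l1.
  have h4 : size l1 * s <= pb cf (tree_size x) * s by rewrite leq_mul2r h1 orbT.
  have h5 : size l1 * (2 + (size l1 * s).*2) <= pb cf (tree_size x) * (2 + (pb cf (tree_size x) * s).*2).
    by apply: leq_mul => //; lia.
  by lia.
apply: ptime_ext (ptime_rev (ptime_rsub pfold)) _ => x.
by rewrite foldE /= ltreeK revK.
Qed.

Lemma ptime_div g f : ptime f ->
  ptime (fun x => tree_of_nat (size (spine (f x)) %/ g.+1)).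
Proof.
move=> pf; have [cf sf] := ptime_size pf.
have [c hc] : polyb (fun n => 4 * pb cf n + 3) by polyb_tac.
(* The accumulator holds the remainder and the quotient of the number of elements read so far. *)
pose step z := let r := lsub (lsub z) in let q := rsub (lsub z) in
  if eqlen r (tree_of_nat g) then Node Leaf (Node Leaf q) else Node (Node Leaf r) q.
have pr : ptime (fun z => lsub (lsub z)) by do 2!apply: ptime_lsub; apply: ptime_id.
have pq : ptime (fun z => rsub (lsub z)) by apply: ptime_rsub; apply: ptime_lsub; apply: ptime_id.
have pstep : ptime step.
  apply: (ptime_eqlen_if pr (ptime_const _)).
    exact: (ptime_node (ptime_const _) (ptime_node (ptime_const _) pq)).
  exact: (ptime_node (ptime_node (ptime_const _) pr) pq).
have foldE x l : foldl (fun acc e => step (Node acc (Node e x))) (Node Leaf Leaf) l =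
    Node (tree_of_nat (size l %% g.+1)) (tree_of_nat (size l %/ g.+1)).
  elim/last_ind: l => [|l e IH]; first by rewrite [size _]/= mod0n div0n.
  rewrite foldl_rcons IH /step /= /eqlen !spine_nat size_rcons.
  have := divn_eq (size l) g.+1; have := ltn_pmod (size l) (ltn0Sn g).
  move: (size l) (size l %/ _) (size l %% _) => n q r rg ->.
  case: eqP => [->|ne].
    have -> : (q * g.+1 + g).+1 = q.+1 * g.+1 by rewrite mulSn; lia.
    by rewrite modnMl mulnK.
  have rg' : r.+1 < g.+1 by lia.
  by rewrite -addnS modnMDl divnMDl // modn_small // divn_small // addn0.
have pfold : ptime (fun x => foldl (fun acc e => step (Node acc (Node e x))) (Node Leaf Leaf) (spine (f x))).
  apply: (ptime_fold (c := c) pstep (ptime_const _) pf) => x l1 l2 lE.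
  rewrite foldE /= !size_nat; apply: leq_trans (hc _).
  have h1 : size l1 <= pb cf (tree_size x).
    by apply: leq_trans (sf x); have := size_spine (f x); rewrite lE size_cat; lia.
  by have := leq_div (size l1) g.+1; have := leq_mod (size l1) g.+1; lia.
by apply: ptime_ext (ptime_rsub pfold) _ => x; rewrite foldE.
Qed.

(** * Computing the reduction *)

Lemma lsub_iter i u : lsub (iter i rsub u) = nth Leaf (spine u) i.
Proof.
elim: i u => [|i IH] [|a v] //; rewrite iterSr IH //=.
by rewrite nth_nil.
Qed.

Ltac ptime_tac := repeat first
  [ exact: ptime_id | exact: ptime_const | assumption
  | apply: ptime_lsub | apply: ptime_rsub | apply: ptime_node ].

Lemma ptime_sel i f : ptime f -> ptime (fun x => lsub (iter i rsub (f x))).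
Proof.
move=> pf; apply: ptime_lsub; elim: i => //= i IH; exact: ptime_rsub.
Qed.

Lemma tree_of_seqE (A : Type) (f : A -> tree) s : tree_of_seq f s = ltree [seq f x | x <- s].
Proof. by elim: s => //= a s ->. Qed.

Section Program.
Variables (g0 p : nat) (enc : bits g0 -> 'I_p -> 'I_6).
Let gam := g0.+1.
Let blk : finType := loc (cor p) (hgt p) (wires p) (config g0).

(* The row of vertex [l] of a block of kind [x]: against the block itself, the
   block reached by its carry, by its columns, and the blocks of kind [x]
   reaching the block of [l] by the carry, by the columns. *)
Definition entry (x : tmpl g0) (k : nat) (l l' : blk) : bool :=
  match k with
  | 0 => intra (tau_of enc x) l l' || intra (tau_of enc x) l' l
  | 1 => inter (tau_of enc x) l l' None
  | 2 => [exists j, inter (tau_of enc x) l l' (Some j)]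
  | 3 => inter (tau_of enc x) l' l None
  | _ => [exists j, inter (tau_of enc x) l' l (Some j)]
  end.

Definition rowt x k l : tree := ltree [seq tree_of_bool (entry x k l l') | l' <- enum blk].
(** The table does not depend on the input formula, so it enters the program as a quoted
    constant. *)
Definition tab (x : tmpl g0) : tree :=
  ltree [seq ltree [seq rowt x k l | k <- iota 0 5] | l <- enum blk].
Definition sel i k (u : tree) : tree := lsub (iter k rsub (lsub (iter i rsub u))).
Definition zeros : tree := ltree [seq Leaf | _ <- enum blk].

(** The number [G] of groups. One extra group would cover all variables; the second gives [1 < G],
    so that carry and column links never join the same two blocks. *)
Definition grp x := iter 2 (Node Leaf) (tree_of_nat (size (spine (lsub x)) %/ gam)).
Definition bases x := ltree (numbered gam (spine (grp x))).

(** Comparing [v] with [base + j] for each of the constantly many [j] spares a division of the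
    variable index. *)
Definition pick (v b base : tree) : tree :=
  foldr (fun j r => if eqlen v (iter (nat_of_ord j) (Node Leaf) base)
                    then (if truth b then tab (TLit j true) else tab (TLit j false)) else r)
    (tab (TPass g0)) (enum 'I_gam).

(** Here and below environments are nested pairs, the element bound last coming first. *)
Definition pickz z := pick (lsub (lsub (rsub z))) (rsub (lsub (rsub z))) (lsub (lsub z)).
Definition litT z := tmap (fun e => pickz (Node e z)) (lsub (rsub (rsub z))).
Definition checkz z := if truth (lsub (lsub z)) then tab (TPass g0) else tab (TCheck g0).
Definition checkT z := tmap (fun e => checkz (Node e z)) (lsub (rsub z)).
Definition clauseT z :=
  ltree (spine (flatmap (fun e => litT (Node e z)) (lsub z)) ++ spine (checkT z)).
Definition bodyT y := flatmap (fun e => clauseT (Node e y)) (rsub y).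
Definition roundsT y := iter 2 (Node Leaf) (flatmap (fun=> tree_of_nat (5 * p)) (lsub y)).
Definition midT y := flatmap (fun=> bodyT y) (roundsT y).
Definition tabsT y := ltree (spine (tmap (fun=> tab (TInit g0)) (lsub y)) ++
  spine (ltree (spine (midT y) ++ spine (tmap (fun=> tab (TFin g0)) (lsub y))))).

(** The part of row [i] of one block facing another block depends on the difference of their
    numbers, which is 0, 1 or [G] up to sign wherever edges exist; for a backward link the table is
    that of the other block. *)
Definition segz i z :=
  let e := lsub (rsub z) in let e' := lsub z in let gr := rsub (rsub (rsub z)) in
  if eqlen (lsub e) (lsub e') then sel i 0 (rsub e)
  else if eqlen (lsub e') (Node Leaf (lsub e)) then sel i 1 (rsub e)
  else if eqlen (lsub e') (ltree (spine (lsub e) ++ spine gr)) then sel i 2 (rsub e)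
  else if eqlen (lsub e) (Node Leaf (lsub e')) then sel i 3 (rsub e')
  else if eqlen (lsub e) (ltree (spine (lsub e') ++ spine gr)) then sel i 4 (rsub e')
  else zeros.
Definition rowz i z := flatmap (fun e => segz i (Node e z)) (lsub (rsub z)).
Definition rowsz z := foldr (fun i r => Node (rowz i z) r) Leaf (iota 0 #|blk|).
Definition matT w := flatmap (fun e => rowsz (Node e w)) (lsub w).
Definition targetT w :=
  flatmap (fun=> tree_of_nat (bweight g0 p)) (lsub w).
Definition envT x :=
  Node (ltree (numbered 1 (spine (tabsT (Node (bases x) (rsub x)))))) (grp x).
Definition redT x := Node (matT (envT x)) (targetT (envT x)).

Lemma ptime_pick v b base : ptime v -> ptime b -> ptime base ->
  ptime (fun x => pick (v x) (b x) (base x)).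
Proof.
move=> pv pb pbase; rewrite /pick; elim: (enum _) => [|j s IH] /=; first exact: ptime_const.
apply: ptime_eqlen_if => //; first exact: ptime_addn.
by apply: ptime_if => //; exact: ptime_const.
Qed.

Lemma ptime_litT : ptime litT.
Proof.
apply: (@ptime_map pickz); last by ptime_tac.
by apply: ptime_pick; ptime_tac.
Qed.

Lemma ptime_checkT : ptime checkT.
Proof.
apply: (@ptime_map checkz); last by ptime_tac.
by apply: ptime_if; ptime_tac.
Qed.

Lemma ptime_bodyT : ptime bodyT.
Proof.
apply: (@ptime_flatmap clauseT); last by ptime_tac.
apply: ptime_cat; last exact: ptime_checkT.
by apply: (@ptime_flatmap litT); [exact: ptime_litT | ptime_tac].
Qed.

Lemma ptime_midT : ptime midT.
Proof.
apply: (@ptime_flatmap (fun z => bodyT (rsub z))).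
  by apply: (ptime_comp ptime_bodyT); ptime_tac.
apply: ptime_addn; apply: (@ptime_flatmap (fun=> tree_of_nat (5 * p))); ptime_tac.
Qed.

Lemma ptime_tabsT : ptime tabsT.
Proof.
apply: ptime_cat; first by apply: (@ptime_map (fun=> tab (TInit g0))); ptime_tac.
apply: ptime_cat; first exact: ptime_midT.
by apply: (@ptime_map (fun=> tab (TFin g0))); ptime_tac.
Qed.

Lemma ptime_segz i : ptime (segz i).
Proof.
have ps k f : ptime f -> ptime (fun x => sel i k (f x)).
  by move=> pf; apply: ptime_sel; apply: ptime_sel.
rewrite /segz; apply: ptime_eqlen_if; [ptime_tac | ptime_tac | apply: ps; ptime_tac | ].
apply: ptime_eqlen_if; [ptime_tac | ptime_tac | apply: ps; ptime_tac | ].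
apply: ptime_eqlen_if; [ptime_tac | apply: ptime_cat; ptime_tac | apply: ps; ptime_tac | ].
apply: ptime_eqlen_if; [ptime_tac | ptime_tac | apply: ps; ptime_tac | ].
by apply: ptime_eqlen_if; [ptime_tac | apply: ptime_cat; ptime_tac | apply: ps; ptime_tac | ptime_tac].
Qed.

Lemma ptime_matT : ptime matT.
Proof.
apply: (@ptime_flatmap rowsz); last by ptime_tac.
rewrite /rowsz; elim: (iota _ _) => [|i s IH] /=; first exact: ptime_const.
by apply: ptime_node => //; apply: (@ptime_flatmap (segz i)); [exact: ptime_segz | ptime_tac].
Qed.

Lemma ptime_grp : ptime grp.
Proof. by apply: ptime_addn; apply: ptime_div; ptime_tac. Qed.

Lemma ptime_redT : ptime redT.
Proof.
have penv : ptime envT.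
  apply: ptime_node ptime_grp; apply: ptime_numbered; apply: (ptime_comp ptime_tabsT).
  by apply: ptime_node; [apply: ptime_numbered ptime_grp | ptime_tac].
apply: ptime_node; first exact: (ptime_comp ptime_matT penv).
by apply: (@ptime_flatmap (fun=> tree_of_nat (bweight g0 p))); ptime_tac.
Qed.

Lemma foldr_if_none (A : eqType) (c : A -> bool) (F : A -> tree) d s :
  (forall j, j \in s -> c j = false) -> foldr (fun j r => if c j then F j else r) d s = d.
Proof.
elim: s => //= j s IH h; rewrite h ?mem_head //; apply: IH => i si.
by apply: h; rewrite inE si orbT.
Qed.

Lemma foldr_if_some (A : eqType) (c : A -> bool) (F : A -> tree) d s j0 :
  (forall j, c j = (j == j0)) -> j0 \in s ->
  foldr (fun j r => if c j then F j else r) d s = F j0.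
Proof.
move=> h; elim: s => //= j s IH; rewrite h inE eq_sym.
by case: eqP => [->|_] //= /IH.
Qed.

Lemma eqlen_nat m n : eqlen (tree_of_nat m) (tree_of_nat n) = (m == n).
Proof. by rewrite /eqlen !spine_nat. Qed.

Lemma pickE v b g :
  pick (tree_of_nat v) (tree_of_bool b) (tree_of_nat (g * gam)) = tab (tmpl_of g0 (ILit v b) g).
Proof.
rewrite /pick /=; case: eqP => [vg|vg].
  rewrite (@foldr_if_some _ _ _ _ _ (inord (v %% gam))) ?mem_enum //; first by case: b.
  move=> j; rewrite tree_of_nat_add eqlen_nat -val_eqE /= inordK ?ltn_mod //.
  by rewrite {1}(divn_eq v gam) vg addnC eqn_add2r eq_sym.
apply: foldr_if_none => j _; rewrite tree_of_nat_add eqlen_nat; apply/eqP => vE.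
by apply: vg; rewrite vE divnDMl // divn_small // add0n.
Qed.

(** * The output of the program on an encoded formula *)

Section Formula.
Variables (n : nat) (cls : seq clause).

Definition lit_tree (l : nat * bool) := Node (tree_of_nat l.1) (tree_of_bool l.2).
Definition clause_tree (c : clause) := ltree [seq lit_tree l | l <- c].
Definition formula_tree := Node (tree_of_nat n) (ltree [seq clause_tree c | c <- cls]).

Let G := n %/ gam + 2.
Let R := 5 * (G * p) + 2.
Let bs := blocks g0 G (instrs_of R cls) : seq (tmpl g0).
Let T := size bs.
Let bl := ltree [seq Node (tree_of_nat (g * gam)) Leaf | g <- iota 0 G].
Let y := Node bl (ltree [seq clause_tree c | c <- cls]).

Lemma grpE : grp formula_tree = tree_of_nat G.
Proof. by rewrite /grp [lsub _]/= spine_nat tree_of_nat_add addnC. Qed.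

Lemma basesE : bases formula_tree = bl.
Proof.
rewrite /bases grpE /bl /numbered spine_nat tree_of_natE ltreeK; congr ltree.
by apply/eq_in_map => i; rewrite mem_iota /= => iG; rewrite nth_nseq iG.
Qed.

Definition tabs (s : seq (tmpl g0)) := [seq tab x | x <- s].

Lemma sweep_map i (F : tree -> tree) :
  (forall g, F (Node (tree_of_nat (g * gam)) Leaf) = tab (tmpl_of g0 i g)) ->
  tmap F bl = ltree (tabs (sweep g0 G i)).
Proof.
by move=> h; rewrite /tmap /bl ltreeK -map_comp /tabs /sweep -map_comp; congr ltree; apply: eq_map.
Qed.

Lemma litTE l z : lsub (rsub z) = bl -> litT (Node (lit_tree l) z) = ltree (tabs (sweep g0 G (ILit l.1 l.2))).
Proof. by rewrite /litT /= => ->; apply: sweep_map => g; rewrite /pickz /= pickE. Qed.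

Lemma checkTE z : lsub (rsub z) = bl -> checkT z = ltree (tabs (sweep g0 G ICheck)).
Proof.
rewrite /checkT => ->; apply: sweep_map => g; rewrite /checkz /= tree_of_natE truth_ltree size_nseq.
by rewrite muln_gt0 andbT lt0n; case: eqP.
Qed.

Lemma blocks_cat s1 s2 : blocks g0 G (s1 ++ s2) = blocks g0 G s1 ++ blocks g0 G s2 :> seq (tmpl g0).
Proof. by rewrite /blocks map_cat flatten_cat. Qed.

Lemma tabs_cat s1 s2 : tabs (s1 ++ s2) = tabs s1 ++ tabs s2.
Proof. exact: map_cat. Qed.

Lemma clauseTE c : clauseT (Node (clause_tree c) y) = ltree (tabs (blocks g0 G (clause_code c))).
Proof.
rewrite /clauseT /= checkTE // ltreeK; congr ltree.
rewrite /clause_code -cats1 blocks_cat tabs_cat /flatmap ltreeK; congr (_ ++ _); last first.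
  by rewrite /blocks /= cats0.
rewrite /clause_tree ltreeK; elim: c => //= l c ->.
by rewrite litTE // ltreeK -tabs_cat.
Qed.

Lemma flatmap_blocks (A : Type) (s : seq A) (F : tree -> tree) (t : A -> tree) (code : A -> seq instr) :
  (forall a, F (t a) = ltree (tabs (blocks g0 G (code a)))) ->
  flatmap F (ltree [seq t a | a <- s]) = ltree (tabs (blocks g0 G (flatten [seq code a | a <- s]))).
Proof.
move=> h; rewrite /flatmap ltreeK; congr ltree; elim: s => //= a s ->.
by rewrite h ltreeK blocks_cat tabs_cat.
Qed.

Lemma bodyTE : bodyT y = ltree (tabs (blocks g0 G (flatten [seq clause_code c | c <- cls]))).
Proof. exact: (flatmap_blocks (F := fun e => clauseT (Node e y)) _ clauseTE). Qed.

Lemma roundsTE : roundsT y = tree_of_nat R.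
Proof.
rewrite /roundsT /flatmap [lsub y]/= /bl ltreeK nat_addn ltreeK [RHS]tree_of_natE; congr ltree.
rewrite /R addnC nseqD; congr (_ ++ _); rewrite mulnCA -{2}(size_iota 0 G) mulnC.
elim: (iota 0 G) => //= g s ->; rewrite mulSn nseqD; congr (_ ++ _).
by rewrite tree_of_natE ltreeK.
Qed.

Lemma midTE : midT y = ltree (tabs (blocks g0 G (middle R cls))).
Proof.
rewrite /midT roundsTE bodyTE tree_of_natE /flatmap ltreeK /middle; congr ltree.
by rewrite ltreeK; elim: R => //= r ->; rewrite -tabs_cat -blocks_cat.
Qed.

Lemma tabsTE : tabsT y = ltree (tabs bs).
Proof.
rewrite /tabsT /= midTE (sweep_map (i := IInit)) // (sweep_map (i := IFin)) //.
rewrite !ltreeK -!tabs_cat; congr (ltree (tabs _)).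
by rewrite /bs /instrs_of -cats1 -cat1s !blocks_cat /blocks /= !cats0.
Qed.

Let nb := [seq Node (tree_of_nat t) (nth Leaf (tabs bs) t) | t <- iota 0 T].

Lemma envTE : envT formula_tree = Node (ltree nb) (tree_of_nat G).
Proof.
rewrite /envT basesE grpE -/y tabsTE ltreeK /numbered size_map; congr (Node (ltree _) _).
by apply: eq_map => t; rewrite muln1.
Qed.

Lemma targetTE : targetT (envT formula_tree) = tree_of_nat (T * bweight g0 p).
Proof.
rewrite envTE /targetT /flatmap [lsub _]/= ltreeK [RHS]tree_of_natE; congr ltree.
rewrite /nb -{2}(size_iota 0 T); elim: (iota 0 T) => //= t s ->.
by rewrite mulSn nseqD tree_of_natE ltreeK.
Qed.

Lemma selE i k x (l0 : blk) : i < #|blk| -> k < 5 ->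
  sel i k (tab x) = rowt x k (nth l0 (enum blk) i).
Proof.
move=> il k5; rewrite /sel !lsub_iter /tab ltreeK (nth_map l0) -?cardE // ltreeK.
by rewrite (nth_map 0) ?size_iota // nth_iota.
Qed.

Let bedgeV : rel (bvert p bs) := bedge enc G (bs := bs).

Lemma segzE i (t t' : 'I_T) (l0 : blk) : i < #|blk| ->
  segz i (Node (Node (tree_of_nat t') (nth Leaf (tabs bs) t'))
    (Node (Node (tree_of_nat t) (nth Leaf (tabs bs) t)) (envT formula_tree)))
  = ltree [seq tree_of_bool (bedgeV (t, nth l0 (enum blk) i) (t', l')) | l' <- enum blk].
Proof.
move=> il; rewrite /segz envTE /= /tabs !(nth_map (TPass g0)) // -!/(tree_of_nat _.+1).
set l := nth l0 _ i; set x := nth _ bs t; set x' := nth _ bs t'.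
have addE a b : ltree (spine (tree_of_nat a) ++ spine (tree_of_nat b)) = tree_of_nat (a + b).
  by rewrite !tree_of_natE !ltreeK -nseqD.
have SE a : Node Leaf (tree_of_nat a) = tree_of_nat a.+1 by [].
rewrite !SE !addE !eqlen_nat !(selE _ l0) // -/l /rowt /zeros.
have G2 : 1 < G by rewrite /G addn2.
have edgeE l' : bedgeV (t, l) (t', l') =
  if t == t' :> nat then entry x 0 l l' else if t' == t.+1 :> nat then entry x 1 l l'
  else if t' == t + G :> nat then entry x 2 l l' else if t == t'.+1 :> nat then entry x' 3 l l'
  else if t == t' + G :> nat then entry x' 4 l l' else false.
  have garcE (u u' : 'I_T) m m' : garc (@blink g0 p G bs) (@btau g0 p enc bs) (u, m) (u', m') =
     [|| (u == u' :> nat) && intra (tau_of enc (nth (TPass g0) bs u)) m m',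
         (u' == u.+1 :> nat) && inter (tau_of enc (nth (TPass g0) bs u)) m m' None
       | (u' == u + G :> nat) && [exists j, inter (tau_of enc (nth (TPass g0) bs u)) m m' (Some j)]].
    rewrite /garc /=; congr (_ || _); apply/existsP/idP => [[[j|]]|/orP[]/andP[]].
    - rewrite /blink /btau => /andP[-> h]; apply/orP; right => /=.
      by apply/existsP; exists j.
    - by rewrite /blink /btau addn1 => /andP[-> h]; apply/orP; left.
    - by move=> uu h; exists None; rewrite /blink addn1 uu.
    - by move=> uu /existsP[j h]; exists (Some j); rewrite /blink uu.
  rewrite /bedgeV /bedge /edge !garcE -/x -/x' [t' == t :> nat]eq_sym.
  case: (eqVneq (t : nat) t') => [tt'|ne].
    have -> : x' = x by rewrite /x' -tt'.
    have -> : (t' == t.+1 :> nat) = false by lia.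
    have -> : (t' == t + G :> nat) = false by lia.
    have -> : (t == t'.+1 :> nat) = false by lia.
    have -> : (t == t' + G :> nat) = false by lia.
    by rewrite /= !orbF.
  case: (eqVneq (t' : nat) t.+1) => [e1|n1].
    have -> : (t' == t + G :> nat) = false by lia.
    have -> : (t == t'.+1 :> nat) = false by lia.
    have -> : (t == t' + G :> nat) = false by lia.
    by rewrite /= !orbF.
  case: (eqVneq (t' : nat) (t + G)) => [e2|n2].
    have -> : (t == t'.+1 :> nat) = false by lia.
    have -> : (t == t' + G :> nat) = false by lia.
    by rewrite /= !orbF.
  case: (eqVneq (t : nat) t'.+1) => [e3|n3] /=; last by case: eqP.
  have -> : (t == t' + G :> nat) = false by lia.
  by rewrite /= !orbF.
have := edgeE; case: eqP => _; [|case: eqP => _; [|case: eqP => _; [|case: eqP => _; [|case: eqP => _]]]];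
  by move=> eE; congr ltree; apply: eq_map => l'; rewrite eE.
Qed.

Lemma flatmap_nb (F : tree -> tree) (H : 'I_T -> seq tree) :
  (forall t : 'I_T, spine (F (Node (tree_of_nat t) (nth Leaf (tabs bs) t))) = H t) ->
  flatmap F (ltree nb) = ltree (flatten [seq H t | t <- enum 'I_T]).
Proof.
move=> h; rewrite /flatmap ltreeK /nb -val_enum_ord -!map_comp; congr (ltree (flatten _)).
by apply: eq_map => t /=; rewrite h.
Qed.


Lemma map_enum_val (V : finType) : [seq enum_val i | i <- enum 'I_#|V|] = enum V.
Proof.
case E : (enum V) => [|x0 s].
  by apply/size0nil; rewrite size_map size_enum_ord cardE E.
rewrite -E; apply: (@eq_from_nth _ x0) => [|i]; first by rewrite size_map size_enum_ord cardE.
rewrite size_map size_enum_ord => il.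
by rewrite (nth_map (Ordinal il)) ?size_enum_ord // (enum_val_nth x0) nth_enum_ord.
Qed.

Lemma tree_of_graph_of (V : finType) (e : rel V) se ie :
  tree_of_graph (@graph_of V e se ie) =
  ltree [seq ltree [seq tree_of_bool (e u v) | v <- enum V] | u <- enum V].
Proof.
rewrite /tree_of_graph tree_of_seqE -map_comp -[in RHS](map_enum_val V) -map_comp; congr ltree.
apply: eq_map => i /=; rewrite tree_of_seqE -!map_comp; congr ltree.
Qed.

(** The enumeration is lexicographic, so the adjacency matrix of the graph is the matrix of block
    tables that [matT] writes. *)
Lemma enum_pair (V W : finType) : enum {: V * W} = [seq (v, w) | v <- enum V, w <- enum W].
Proof. by rewrite [LHS]enumT [@Finite.enum in LHS]unlock. Qed.

Lemma map_enum_pair (V W : finType) (A : Type) (f : V * W -> A) :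
  [seq f u | u <- enum {: V * W}] = flatten [seq [seq f (v, w) | w <- enum W] | v <- enum V].
Proof.
rewrite enum_pair map_flatten -map_comp; congr flatten; apply: eq_map => v /=.
by rewrite -map_comp.
Qed.

Lemma matTE : matT (envT formula_tree) = tree_of_graph (bgraph enc G bs).
Proof.
rewrite tree_of_graph_of (@map_enum_pair 'I_T blk) {1}envTE /matT [lsub _]/=.
apply: flatmap_nb => t; set z := Node _ (Node (ltree nb) _).
have zE : z = Node (Node (tree_of_nat t) (nth Leaf (tabs bs) t)) (envT formula_tree) by rewrite envTE.
rewrite /rowsz.
have -> : foldr (fun i r => Node (rowz i z) r) Leaf (iota 0 #|blk|) =
    ltree [seq rowz i z | i <- iota 0 #|blk|] by elim: (iota _ _) => //= i s ->.
rewrite ltreeK; case E : (enum blk) => [|l0 s0]; first by rewrite cardE E.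
rewrite -E; apply: (@eq_from_nth _ Leaf) => [|i].
  by rewrite size_map size_map size_iota cardE.
rewrite size_map size_iota => il.
rewrite (nth_map 0) ?size_iota // nth_iota // (nth_map l0) -?cardE // add0n /rowz.
rewrite zE [rsub _]/= {2}envTE [lsub _]/= (@map_enum_pair 'I_T blk).
by apply: flatmap_nb => t'; rewrite (@segzE i t t' l0) // ltreeK.
Qed.

Theorem redTE : redT formula_tree =
  Node (tree_of_graph (bgraph enc G bs)) (tree_of_nat (size bs * bweight g0 p)).
Proof. by rewrite /redT matTE targetTE. Qed.
End Formula.
End Program.

(** * From search to decision *)

(** An arbitrary solver may leave its variables dirty, while the polynomial-time programs above
    expect a clean store. *)
Fixpoint clear_upto (k : nat) (p : program) : program :=
  if k is k'.+1 then Seq (Assign k' ENil) (clear_upto k' p) else p.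

Lemma exec_clear_upto k p s b s' :
  exec_le p (fun j => if j < k then Leaf else s j) b s' ->
  exec_le (clear_upto k p) s (k * 2 + b) s'.
Proof.
elim: k s => [|k IH] s h /=; first by [].
rewrite mulSn -addnA; apply: (@exec_le_seq _ _ _ (update s k Leaf)).
  by exists 2 => //; apply: (ExecAssign s k ENil).
apply: IH; move: h; congr (exec_le _ _ _ _); apply/funext => j; rewrite /update.
by case: (ltngtP j k) => jk; rewrite ?ltnS ?(ltnW jk) ?jk ?leqnn //= leqNgt jk.
Qed.

Definition count_true (u : tree) : tree :=
  flatmap (fun e => if truth e then Node Leaf Leaf else Leaf) u.

Definition postT (u : tree) : tree :=
  if truth (tree_of_bool (size (spine (count_true (lsub u))) < size (spine (rsub u))))
  then Leaf else Node Leaf Leaf.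

Lemma ptime_postT : ptime postT.
Proof.
apply: ptime_if; [|exact: ptime_const|exact: ptime_const].
apply: ptime_ltn; last by ptime_tac.
apply: (@ptime_flatmap (fun z => if truth (lsub z) then Node Leaf Leaf else Leaf)); last by ptime_tac.
by apply: ptime_if; ptime_tac.
Qed.

Lemma postTE n (D : {set 'I_n}) k :
  postT (Node (tree_of_set D) (tree_of_nat k)) = tree_of_bool (k <= #|D|).
Proof.
rewrite /postT /= spine_nat; have -> : size (spine (count_true (tree_of_set D))) = #|D|.
  rewrite /count_true /flatmap ltreeK /tree_of_set tree_of_seqE ltreeK -!map_comp.
  have -> s : size (flatten [seq spine (if truth (tree_of_bool (x \in D)) then Node Leaf Leaf
      else Leaf) | x <- s]) = count (mem D) s.
    by elim: s => //= x s; case: (x \in D) => /= ->.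
  by rewrite -size_filter cardE.
by case: ltnP.
Qed.

Definition decides (p : program) (G : graph) (k t : nat) :=
  computes p (Node (tree_of_graph G) (tree_of_nat k)) t
    (tree_of_bool [exists D, upper_dominating G D && (k <= #|D|)]).

Lemma size_tree_of_set (G : graph) (D : {set 'I_(nverts G)}) :
  tree_size (tree_of_set D) <= 4 * tree_size (tree_of_graph G).
Proof.
rewrite /tree_of_set tree_of_seqE /tree_of_graph tree_of_seqE -!map_comp.
have h (F : 'I_(nverts G) -> tree) s :
    tree_size (ltree [seq tree_of_bool (x \in D) | x <- s]) <= 4 * tree_size (ltree [seq F x | x <- s]).
  elim: s => //= x s IH; have := tree_size_gt0 (F x).
  have : tree_size (tree_of_bool (x \in D)) <= 3 by case: (x \in D).
  lia.
exact: h.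
Qed.

(* A search algorithm is turned into a decision algorithm by keeping the
   threshold in a variable the former does not mention. *)
Lemma decide_by_search (ps : program) : exists (pd : program) (c : nat), forall G k t out,
  computes ps (tree_of_graph G) t out ->
  solution (p := UpperDominatingSet_search) G out ->
  exists2 t', decides pd G k t' &
    t' <= t + pb c (tree_size (Node (tree_of_graph G) (tree_of_nat k))).
Proof.
(* The successor makes [f] positive, so that the saved threshold is not in variable 0. *)
have [k0 hk0] := pvars_bound ps; pose f := k0.+1.
have psf : pvars_lt f ps by apply: pvars_lt_leq hk0.
have [pp [cp hp]] := ptime_postT.
have [c hc] : polyb (fun n => pb cp (5 * n + 1) + (2 * f + 20)) by polyb_tac.
pose pd := Seq (Assign f (ETl (EVar 0))) (Seq (Assign 0 (EHd (EVar 0))) (Seq ps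
  (Seq (Assign f.+1 (ECons (EVar 0) (EVar f))) (clear_upto f.+1
  (Seq (Assign 0 (EVar f.+1)) (Seq (Assign f.+1 ENil) pp)))))).
exists pd, c => G k t out [s' es' s'0] [D [outE upD maxD]].
set u := tree_of_graph G in es' *; set v := tree_of_nat k.
have ansE : [exists D, upper_dominating G D && (k <= #|D|)] = (k <= #|D|).
  apply/existsP/idP => [[D' /andP[upD' kD']]|kD]; last by exists D; rewrite upD.
  exact: leq_trans kD' (maxD _ upD').
pose s1 := update (single (Node u v)) f v; pose s2 := update s1 0 u.
have [|s3 [es3 s3lt s3ge]] := exec_frame es' psf (s1 := s2).
  move=> j jf; rewrite /s2 /s1 /single /update; case: (eqVneq j 0) => // j0.
  by rewrite ltn_eqF.
have s30 : s3 0 = out by rewrite s3lt.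
have s3f : s3 f = v by rewrite s3ge // /s2 /s1 /update /= eqxx.
pose s4 := update s3 f.+1 (Node out v).
pose s5 : store := fun j => if j < f.+1 then Leaf else s4 j.
have s5E : update (update s5 0 (Node out v)) f.+1 Leaf = single (Node out v).
  apply/funext => j; rewrite /update /single /s5 /s4 /update.
  case: (eqVneq j f.+1) => [->//|nj]; case: (eqVneq j 0) => // j0.
  case: ltnP => // fj; rewrite s3ge; last by lia.
  rewrite /s2 /s1 /single /update (negPf j0).
  by rewrite (gtn_eqF (_ : f < j)) //; lia.
have [epp _] := hp (Node out v); rewrite outE postTE -ansE -outE in epp.
have [t' e' le'] : exec_le pd (single (Node u v)) (3 + (3 + (t + (4 + (f.+1 * 2 +
    (2 + (2 + pb cp (tree_size (Node out v)))))))))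
    (single (tree_of_bool [exists D, upper_dominating G D && (k <= #|D|)])).
  apply: (@exec_le_seq _ _ _ s1); first by exists 3 => //; apply: (ExecAssign _ f (ETl (EVar 0))).
  apply: (@exec_le_seq _ _ _ s2).
    exists 3 => //; have := ExecAssign s1 0 (EHd (EVar 0)).
    by rewrite /= {3}/s1 /update.
  apply: (@exec_le_seq _ _ _ s3); first by exists t.
  apply: (@exec_le_seq _ _ _ s4).
    by exists 4 => //; have := ExecAssign s3 f.+1 (ECons (EVar 0) (EVar f)); rewrite /= s30 s3f.
  apply: exec_clear_upto; rewrite -/s5.
  apply: (@exec_le_seq _ _ _ (update s5 0 (Node out v))).
    exists 2 => //; have := ExecAssign s5 0 (EVar f.+1).
    by have -> : eval s5 (EVar f.+1) = Node out v by rewrite /= /s5 ltnn /s4 /update eqxx.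
  apply: (@exec_le_seq _ _ _ (single (Node out v))) => //.
  by exists 2 => //; rewrite -s5E; apply: (ExecAssign _ f.+1 ENil).
exists t'; first by exists (single (tree_of_bool [exists D, upper_dominating G D && (k <= #|D|)])).
apply: leq_trans le' _.
have sz : tree_size (Node out v) <= 5 * tree_size (Node u v) + 1.
  by rewrite outE /=; have := size_tree_of_set D; rewrite -/u; lia.
by have := hc (tree_size (Node u v)); have := pb_mono (leqnn cp) sz; lia.
Qed.

(** * Formulas of bounded width and the size of their encoding *)

Section Formulas.
Variable q : nat.

Definition cls_of (phi : qcnf q) : seq clause :=
  [seq [seq (nat_of_ord l.1, l.2) | l <- c] | c <- clauses phi].

Lemma tree_of_qcnfE (phi : qcnf q) : tree_of_qcnf phi = formula_tree (nvars phi) (cls_of phi).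
Proof.
rewrite /tree_of_qcnf /formula_tree tree_of_seqE /cls_of -map_comp; congr (Node _ (ltree _)).
by apply: eq_map => c /=; rewrite tree_of_seqE /clause_tree -map_comp.
Qed.

Lemma satisfiableE (phi : qcnf q) : satisfiable phi <-> exists x, all (sat_by x) (cls_of phi).
Proof.
rewrite /cls_of; split=> [/existsP[a sa]|[x sx]].
  exists (fun v => if insub v is Some i then a i else true).
  rewrite all_map; apply: sub_all sa => c; rewrite /sat_by /= has_map.
  by apply: sub_has => l /=; rewrite valK.
apply/existsP; exists [ffun i : 'I_(nvars phi) => x i].
move: sx; rewrite all_map; apply: sub_all => c; rewrite /sat_by /= has_map.
by apply: sub_has => l /=; rewrite ffunE.
Qed.

(** A clause padded to length [q] is a map from [q] positions to literals or nothing, and distinct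
    clauses of the formula have distinct paddings. *)
Lemma size_clauses (phi : qcnf q) : size (clauses phi) <= (2 * nvars phi + 1) ^ q.
Proof.
case: phi => n cs /= un wd.
pose pad (c : seq ('I_n * bool)) : {ffun 'I_q -> option ('I_n * bool)} :=
  [ffun i : 'I_q => onth c i].
have padI : {in cs &, injective pad}.
  move=> c c' cin c'in /ffunP e; have sc := allP wd _ cin; have sc' := allP wd _ c'in.
  apply: eq_from_onth => i; case: (ltnP i q) => iq.
    by have := e (Ordinal iq); rewrite !ffunE.
  by rewrite !onth_default //; lia.
have -> : (2 * n + 1) ^ q = #|{ffun 'I_q -> option ('I_n * bool)}|.
  by rewrite card_ffun card_option card_prod card_bool !card_ord mulnC addn1.
by rewrite -(size_map pad) cardE; apply: uniq_leq_size; rewrite ?map_inj_in_uniq // => x _; rewrite mem_enum.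
Qed.

Lemma polyb_exp f m : polyb f -> polyb (fun n => f n ^ m).
Proof.
move=> pf; elim: m => [|m IH]; first exact: polyb_const.
by apply: polyb_le (polyb_mul pf IH) _ => n; rewrite expnS.
Qed.

(** SETH measures time by the number of variables alone, so polynomial overhead in the input size
    must be polynomial in that number. *)
Lemma size_tree_of_qcnf : exists c, forall phi : qcnf q,
  tree_size (tree_of_qcnf phi) <= pb c (nvars phi).
Proof.
have [c hc] : polyb (fun n => (2 * n + 3) + (2 * n + 1) ^ q * (q * (2 * n + 7) + 2)).
  by polyb_tac; apply: polyb_exp; polyb_tac.
exists c => phi; apply: leq_trans (hc _).
have litS (l : 'I_(nvars phi) * bool) :
    tree_size (Node (tree_of_nat l.1) (tree_of_bool l.2)) < 2 * nvars phi + 7.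
  by rewrite /= size_nat; have := ltn_ord l.1; case: l.2 => /=; lia.
have clS (c' : seq ('I_(nvars phi) * bool)) : c' \in clauses phi ->
    tree_size (tree_of_seq (fun l : 'I_(nvars phi) * bool => Node (tree_of_nat l.1) (tree_of_bool l.2)) c')
    < q * (2 * nvars phi + 7) + 2.
  move=> cin; have sc := allP (clauses_width phi) _ cin.
  apply: (@leq_trans (size c' * (2 * nvars phi + 7) + 2)); last by rewrite leq_add2r leq_mul2r sc orbT.
  elim: c' {cin sc} => [|l c' IH] //=; rewrite mulSn.
  by have := litS l; rewrite /=; lia.
have := size_clauses phi; rewrite /= size_nat => le.
have : tree_size (tree_of_seq (tree_of_seq (fun l : 'I_(nvars phi) * bool => Node (tree_of_nat l.1) (tree_of_bool l.2)))
    (clauses phi)) <= size (clauses phi) * (q * (2 * nvars phi + 7) + 2) + 1.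
  elim: (clauses phi) clS => [|c' cs IH] //= clS; rewrite mulSn.
  have := clS c' (mem_head _ _); have := IH (fun x xc => clS x (mem_behead (s := c' :: cs) xc)).
  by lia.
have : size (clauses phi) * (q * (2 * nvars phi + 7) + 2) <=
  (2 * nvars phi + 1) ^ q * (q * (2 * nvars phi + 7) + 2) by rewrite leq_mul2r le orbT.
lia.
Qed.
End Formulas.

(** * Running time *)

Import Order.TTheory GRing.Theory Num.Theory.
Local Open Scope ring_scope.

Section Reals.
Variable R : realType.

Lemma powR2E (x : R) : powR 2 x = expR (x * ln 2).
Proof. by rewrite /powR pnatr_eq0. Qed.

Lemma ln2_gt0 : 0 < ln (2 : R).
Proof. by apply: ln_gt0; rewrite ltr1n. Qed.

Lemma pb_le_exp c (eta : R) : 0 < eta ->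
  exists2 B : R, 0 <= B & forall n : nat, (pb c n)%:R <= B * powR 2 (eta * n%:R).
Proof.
move=> eta_gt0; pose a := eta * ln 2; have a_gt0 : 0 < a by rewrite mulr_gt0 ?ln2_gt0.
pose m : R := c.+1%:R; have m_gt0 : 0 < m by rewrite ltr0n.
(* [B] is chosen so that [B * (1 + a * n / m)] is at least [n + m]; the bound [1 + x <= expR x] is
   then raised to the power [c.+1]. *)
pose B := m + m / a; have B_ge0 : 0 <= B by rewrite addr_ge0 ?divr_ge0 ?ltW.
exists (B ^+ c.+1) => [|n]; first exact: exprn_ge0.
have le1 : (pb c n)%:R <= (n + c.+1)%:R ^+ c.+1 :> R.
  by rewrite -natrX ler_nat -/(pb c.+1 n); apply: pb_mono.
apply: le_trans le1 _; rewrite powR2E.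
have -> : eta * n%:R * ln 2 = c.+1%:R * (a * n%:R / m) by rewrite -/m [RHS]mulrC divfK ?gt_eqF // /a mulrAC.
rewrite expRM_natl -exprMn lerXn2r ?nnegrE ?mulr_ge0 ?expR_ge0 ?ler0n //.
have h := expR_ge1Dx (a * n%:R / m).
apply: le_trans (ler_wpM2l B_ge0 h); rewrite natrD -/m /B.
have E (u v z : R) : 0 < u -> 0 < v ->
    (v + v / u) * (1 + u * z / v) = z + v + (v / u + u * z).
  by move=> u0 v0; field; rewrite !gt_eqF.
rewrite E //.
by rewrite lerDl; apply: addr_ge0; [apply: divr_ge0 | apply: mulr_ge0]; rewrite ?ler0n // ltW.
Qed.

(* [p] is chosen with [b ^ p <= 6 ^ p / 2], and [g0.+1] as the integral part of
   the binary logarithm of [6 ^ p]. *)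
Lemma column_count (b : R) : 2 <= b -> b < 6 -> exists (g0 p : nat) (d0 : R),
  [/\ (2 ^ g0.+1 <= 6 ^ p)%N, 0 <= d0, d0 < 1 & b ^+ p = powR 2 (d0 * g0.+1%:R)].
Proof.
move=> b2 b6; have b_gt0 : 0 < b by apply: lt_le_trans b2.
have x_gt1 : 1 < 6 / b by rewrite ltr_pdivlMr // mul1r.
have lx : 0 < ln (6 / b) by apply: ln_gt0.
pose p := Num.bound (ln (6 / b))^-1.
have hp : (ln (6 / b))^-1 < p%:R by apply: archi_boundP; rewrite invr_ge0 ltW.
have pl : 1 < p%:R * ln (6 / b) by rewrite -ltr_pdivrMr // mul1r.
have h2 : 2 <= (6 / b) ^+ p.
  rewrite -[6 / b]lnK; last by rewrite posrE (lt_trans _ x_gt1).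
  rewrite -expRM_natl; apply: le_trans (expR_ge1Dx _).
  by rewrite -[2](_ : 1 + 1 = _) // lerD2l ltW.
have p_gt0 : (0 < p)%N.
  by rewrite lt0n; apply/eqP => p0; move: h2; rewrite p0 expr0; lra.
pose g := trunc_log 2 (6 ^ p).
have g_gt0 : (0 < g)%N.
  apply: trunc_log_max => //; apply: (@leq_trans 6) => //.
  by rewrite -{1}(expn1 6) leq_exp2l.
have /andP[g1 g2] : (2 ^ g <= 6 ^ p < 2 ^ g.+1)%N by apply: trunc_log_bounds; rewrite ?expn_gt0.
have bg : b ^+ p < 2 ^+ g.
  have : (6 : R) ^+ p < 2 ^+ g * 2.
    by rewrite -exprSr -!natrX ltr_nat.
  move: h2; rewrite expr_div_n ler_pdivlMr ?exprn_gt0 // => h2 h3.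
  by rewrite -(ltr_pM2r (_ : 0 < 2)) // (le_lt_trans _ h3) // mulrC.
have lb : 0 <= ln b by apply: ln_ge0; apply: le_trans b2; rewrite ler1n.
have gl : 0 < g%:R * ln (2 : R) by rewrite mulr_gt0 ?ln2_gt0 ?ltr0n.
exists g.-1, p, (p%:R * ln b / (g%:R * ln 2)); rewrite prednK //; split=> //.
- by apply: divr_ge0; [apply: mulr_ge0; rewrite ?ler0n | apply: ltW].
- rewrite ltr_pdivrMr // mul1r -ltr_expR !expRM_natl !lnK ?posrE //.
rewrite powR2E; have -> : p%:R * ln b / (g%:R * ln 2) * g%:R * ln 2 = p%:R * ln b.
  by rewrite -mulrA divfK // gt_eqF.
by rewrite expRM_natl lnK // posrE.
Qed.
End Reals.

Lemma exists_encoding g0 p : (2 ^ g0.+1 <= 6 ^ p)%N ->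
  exists enc : bits g0 -> 'I_p -> 'I_6, forall a a', enc a =1 enc a' -> a = a'.
Proof.
move=> le; have le' : (#|bits g0| <= #|{ffun 'I_p -> 'I_6}|)%N.
  by rewrite !card_ffun card_bool !card_ord.
exists (fun a => enum_val (widen_ord le' (enum_rank a)) : {ffun 'I_p -> 'I_6}).
move=> a a' /ffunP /enum_val_inj /(congr1 val) /= e.
by apply: enum_rank_inj; apply: val_inj.
Qed.

Lemma leq_groups n g : (n <= (n %/ g.+1 + 2) * g.+1)%N.
Proof.
apply: leq_trans (ltnW (ltn_ceil n (ltn0Sn g))) _.
by rewrite leq_mul2r addn2 leqnSn orbT.
Qed.

Lemma width_groups l m p : (l + (m + 2) * p + 1 = l + 2 * p + 1 + p * m)%N.
Proof. lia. Qed.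

Lemma decision_refutes_SETH (R : realType) (b C : R) (d : nat) (pd : program) :
  2 <= b -> b < 6 ->
  (forall G k, exists2 t, decides pd G k t &
     t%:R <= C * (tree_size (Node (tree_of_graph G) (tree_of_nat k)))%:R ^+ d * b ^+ pathwidth G) ->
  ~ SETH R.
Proof.
move=> b2 b6 solve seth.
have [g0 [p [d0 [le26 d0_ge0 d0_lt1 bpE]]]] := column_count b2 b6.
have [enc enc_inj] := exists_encoding le26.
(* The exponent [delta] splits into [d0], spent on the columns, and [eta], which absorbs all
   polynomial factors. *)
pose eta := (1 - d0) / 2; pose delta := (1 + d0) / 2.
have eta_gt0 : 0 < eta by rewrite /eta; lra.
have delta_lt1 : delta < 1 by rewrite /delta; lra.
have deltaE : delta = eta + d0 by rewrite /delta /eta; lra.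
have [q notq] := seth delta delta_lt1; apply: notq.
have [cq hq] := size_tree_of_qcnf q.
have [pr [cr hr]] := ptime_redT enc.
have [c3 hc3] : polyb (fun n => pb cr (pb cq n) + pb cr (pb cq n) ^ d)%N.
  by apply: polyb_add; [|apply: polyb_exp]; polyb_tac.
have [B B_ge0 hB] := pb_le_exp c3 eta_gt0.
(* Everything in the pathwidth bound that does not grow with [n]; the [2 * p] comes from the two
   extra groups. *)
pose K0 := (#|loc (cor p) (hgt p) (wires p) (config g0)| + 2 * p + 1)%N.
have b_ge1 : 1 <= b by apply: le_trans b2; rewrite ler1n.
have b_ge0 : 0 <= b by apply: le_trans b_ge1.
exists (B * (1 + `|C|) * b ^+ K0); exists (Seq pr pd) => phi.
pose n := nvars phi; pose cls := cls_of phi; pose G := (n %/ g0.+1 + 2)%N.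
pose bs := blocks g0 G (instrs_of (5 * (G * p) + 2) cls).
pose gr := bgraph enc G bs; pose k := (size bs * bweight g0 p)%N.
have xE : tree_of_qcnf phi = formula_tree n cls by apply: tree_of_qcnfE.
have redE : redT enc (tree_of_qcnf phi) = Node (tree_of_graph gr) (tree_of_nat k).
  by rewrite xE redTE.
have [[t1 e1 le1] sz1] := hr (tree_of_qcnf phi); rewrite redE in e1 sz1.
have [t2 [s e2 s0] le2] := solve gr k.
have G_gt0 : (0 < G)%N by rewrite /G addn2.
have ans : [exists D, upper_dominating gr D && (k <= #|D|)%N] = satisfiable phi.
  apply/idP/idP => h.
    apply/satisfiableE; move: h; apply: (reduction_correct enc_inj G_gt0 _ _).1 => //.
    move=> c l /mapP[c' c'in ->] /mapP[l' l'in ->] /=.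
    exact: leq_trans (ltn_ord l'.1) (leq_groups _ _).
  apply: (reduction_correct enc_inj G_gt0 _ _).2 => //; last exact/satisfiableE.
  move=> c l /mapP[c' c'in ->] /mapP[l' l'in ->] /=.
  exact: leq_trans (ltn_ord l'.1) (leq_groups _ _).
exists (t1 + t2)%N, (tree_of_bool (satisfiable phi)); split=> //.
  by exists s; [apply: ExecSeq e1 e2 | rewrite -ans].
rewrite /= -/n natrD.
have szx : (tree_size (tree_of_qcnf phi) <= pb cq n)%N by apply: hq.
have le1' : (t1 <= pb cr (pb cq n))%N by apply: leq_trans le1 (pb_mono _ szx).
have sz1' := leq_trans sz1 (pb_mono (leqnn cr) szx).
set N := tree_size _ in le2 sz1'.
have bp_ge1 m : 1 <= b ^+ m by apply: exprn_ege1.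
have tP : t1%:R + t2%:R <= (pb c3 n)%:R * (1 + `|C|) * b ^+ pathwidth gr.
  have h3 : t1%:R + N%:R ^+ d <= (pb c3 n)%:R :> R.
    rewrite -natrX -natrD ler_nat; apply: leq_trans (hc3 n).
    by apply: leq_add => //; apply: leq_expl.
  have h4 : t2%:R <= `|C| * N%:R ^+ d * b ^+ pathwidth gr.
    apply: le_trans le2 _; apply: ler_wpM2r; first exact: exprn_ge0.
    by apply: ler_wpM2r; rewrite ?exprn_ge0 ?ler0n // ler_norm.
  have h5 : t1%:R <= (pb c3 n)%:R * b ^+ pathwidth gr.
    apply: (@le_trans _ _ (pb c3 n)%:R); last by rewrite ler_peMr ?ler0n.
    by apply: le_trans h3; rewrite lerDl exprn_ge0 ?ler0n.
  have h6 : `|C| * N%:R ^+ d * b ^+ pathwidth gr <= `|C| * (pb c3 n)%:R * b ^+ pathwidth gr.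
    apply: ler_wpM2r; first exact: exprn_ge0.
    by apply: ler_wpM2l => //; apply: le_trans h3; rewrite lerDr ler0n.
  have E (u v w : R) : u * (1 + v) * w = u * w + v * u * w by ring.
  by rewrite E; apply: lerD => //; apply: le_trans h4 h6.
have pwP : b ^+ pathwidth gr <= b ^+ K0 * powR 2 (d0 * n%:R).
  (* By the choice of [d0], each of the [n %/ g0.+1] remaining groups contributes
     [b ^+ p = powR 2 (d0 * g0.+1%:R)]. *)
  apply: (@le_trans _ _ (b ^+ (K0 + p * (n %/ g0.+1)))).
    apply: ler_weXn2l => //; apply: leq_trans (bgraph_pathwidth enc G_gt0 bs) _.
    by rewrite width_groups.
  rewrite exprD ler_wpM2l ?exprn_ge0 // exprM bpE -powR_mulrn ?powR_ge0 // -powRrM.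
  apply: ler_powR; first by rewrite ler1n.
  rewrite -mulrA ler_wpM2l // -natrM ler_nat mulnC; exact: leq_divM.
have CB : 0 <= 1 + `|C| by rewrite addr_ge0.
apply: le_trans tP _.
have -> : powR 2 (delta * n%:R) = powR 2 (eta * n%:R) * powR 2 (d0 * n%:R).
  rewrite -powRD; last by rewrite pnatr_eq0 implybT.
  by rewrite -mulrDl -deltaE.
have E (u v w y z : R) : u * v * w * (y * z) = u * y * v * (w * z) by ring.
rewrite E; apply: ler_pM => //.
- by rewrite mulr_ge0 ?ler0n.
- exact: exprn_ge0.
- by apply: ler_wpM2r.
Qed.

(** * Positivity of the base, and the conclusion *)

Definition K2_adj : rel 'I_2 := fun i j => i != j.

Lemma K2_sym : symmetric K2_adj. Proof. by move=> i j; rewrite /K2_adj eq_sym. Qed.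
Lemma K2_irrefl : irreflexive K2_adj. Proof. by move=> i; rewrite /K2_adj eqxx. Qed.
Definition K2 : graph := Graph K2_sym K2_irrefl.

Lemma pathwidth_K2 : pathwidth K2 = 1%N.
Proof.
rewrite /pathwidth; case: ex_minnP => m /asboolP[B pd <-] min.
apply/eqP; rewrite eqn_leq; apply/andP; split.
  apply: (@leq_trans (width [:: [set: 'I_(nverts K2)]])); last first.
    by rewrite /width big_seq1 cardsT card_ord.
  apply: min; apply/asboolP; exists [:: [set: 'I_(nverts K2)]] => //; split.
  - by move=> x; exists setT; rewrite ?inE.
  - by move=> x y _; exists setT; rewrite ?inE.
  - by move=> [|i] [|j] [|k'] // *; rewrite setIid.
case: pd => _ edges _.
have [//|X XB /andP[x0 x1]] := edges (ord0 : 'I_(nverts K2)) (ord_max : 'I_(nverts K2)).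
have X2 : (1 < #|X|)%N.
  rewrite (cardD1 (ord0 : 'I_(nverts K2))) x0 (cardD1 (ord_max : 'I_(nverts K2))) !inE x1.
  by [].
have le : (#|X| <= \max_(Y <- B) #|Y|)%N by apply: leq_bigmax_seq.
by rewrite /width -ltnS prednK; apply: leq_trans le => //; apply: ltnW.
Qed.

Definition empty_graph : graph :=
  @Graph 0 (fun _ _ => false) (fun _ _ => erefl) (fun=> erefl).

Lemma pathwidth_empty : pathwidth empty_graph = 0%N.
Proof.
apply/eqP; rewrite -leqn0; apply: (@pathwidth_le empty_graph [::]) => //.
by split=> [[]|[]|].
Qed.

Lemma exec_time_gt0 p s t s' : exec p s t s' -> (0 < t)%N.
Proof. by elim=> // *; lia. Qed.

(* A base that is not positive would bound the time on [K2] by a nonpositive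
   number, and the constant is nonnegative because of the empty graph. *)
Lemma base_gt0 (R : realType) (P : problem) (inst : graph -> instance P) (f : instance P -> R) (c : R) :
  (forall G, f (inst G) = c ^+ pathwidth G) -> solvable_in_time_star f -> 0 < c.
Proof.
move=> fE [C [d [p sol]]]; rewrite ltNge; apply/negP => c_le0.
have t_gt0 G : 0 < C * (tree_size (encode (inst G)))%:R ^+ d * c ^+ pathwidth G.
  have [t [out [[s e _] _ le]]] := sol (inst G); rewrite -fE; apply: lt_le_trans le.
  by rewrite ltr0n; apply: exec_time_gt0 e.
have C_gt0 : 0 < C.
  have := t_gt0 empty_graph; rewrite pathwidth_empty expr0 mulr1 pmulr_lgt0 //.
  by rewrite exprn_gt0 // ltr0n tree_size_gt0.
have := t_gt0 K2; rewrite pathwidth_K2 expr1 ltNge mulr_ge0_le0 //.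
by rewrite mulr_ge0 ?exprn_ge0 ?ler0n // ltW.
Qed.

Theorem theorem4 (R : realType) (seth : SETH R) (eps : R) (eps_gt0 : 0 < eps) :
  ~ solvable_in_time_star
      (fun x : instance UpperDominatingSet_decision =>
         (6 - eps) ^+ pathwidth x.1) /\
  ~ solvable_in_time_star
      (fun G : instance UpperDominatingSet_search =>
         (6 - eps) ^+ pathwidth G).
Proof.
(* Enlarging the base only weakens the assumed running time, and a base of at least 2 makes its
   powers monotone and its logarithm nonnegative. *)
pose b := Num.max 2 (6 - eps).
have b2 : 2 <= b by rewrite le_max lexx.
have b6 : b < 6 by rewrite /b; case: (leP 2 (6 - eps)) => _; lra.
have b_ge1 : 1 <= b by apply: le_trans b2; rewrite ler1n.
have b_ge0 : 0 <= b by apply: le_trans b_ge1.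
have bX m : 0 < 6 - eps -> (6 - eps) ^+ m <= b ^+ m.
  by move=> c_gt0; apply: lerXn2r; rewrite ?nnegrE // ?(ltW c_gt0) // le_max lexx orbT.
have bound C d (N m t : nat) : 0 < 6 - eps -> t%:R <= C * N%:R ^+ d * (6 - eps) ^+ m ->
    t%:R <= `|C| * N%:R ^+ d * b ^+ m.
  move=> c_gt0 /le_trans; apply; apply: (@le_trans _ _ (`|C| * N%:R ^+ d * (6 - eps) ^+ m)).
    apply: ler_wpM2r; first by rewrite exprn_ge0 // ltW.
    by apply: ler_wpM2r; rewrite ?exprn_ge0 ?ler0n // ler_norm.
  by apply: ler_wpM2l; [rewrite mulr_ge0 ?exprn_ge0 ?ler0n | apply: bX].
split=> sol.
  have c_gt0 := base_gt0 (inst := fun G => (G, 0%N) : instance UpperDominatingSet_decision)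
    (fun=> erefl) sol.
  case: sol => C [d [p solp]].
  apply: (@decision_refutes_SETH R b `|C| d p b2 b6 _ seth) => G k.
  have [t [out [cmp /= outE le]]] := solp (G, k); exists t; first by rewrite /decides -outE.
  exact: bound le.
have c_gt0 := base_gt0 (inst := fun G => G : instance UpperDominatingSet_search)
  (fun=> erefl) sol.
case: sol => C [d [p solp]].
have [pd [c hpd]] := decide_by_search p.
(* As [N] is positive, the overhead [pb c N] is at most [c.+1 ^ c * N ^ c]; it is merged into the
   constant and the degree. *)
pose d' := (d + c)%N; pose C' : R := `|C| + (c.+1 ^ c)%:R.
apply: (@decision_refutes_SETH R b C' d' pd b2 b6 _ seth) => G k.
have [t [out [cmp sl le]]] := solp G; have [t' dc le'] := hpd G k t out cmp sl.
exists t' => //; set N := tree_size (Node _ _) in le' *.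
have N_gt0 : (0 < N)%N by apply: tree_size_gt0.
have N_ge1 : 1 <= N%:R :> R by rewrite ler1n.
have leN : (tree_size (tree_of_graph G) <= N)%N by rewrite /N /= leqW // leq_addr.
apply: (@le_trans _ _ (t%:R + (pb c N)%:R)); first by rewrite -natrD ler_nat.
rewrite /C' !mulrDl; apply: lerD.
  apply: le_trans (bound _ _ _ _ _ c_gt0 le) _; apply: ler_wpM2r; first exact: exprn_ge0.
  apply: ler_wpM2l => //; apply: (@le_trans _ _ (N%:R ^+ d)).
    by rewrite lerXn2r ?nnegrE ?ler0n // ler_nat.
  by apply: ler_weXn2l => //; apply: leq_addr.
have bp_ge1 : 1 <= b ^+ pathwidth G by apply: exprn_ege1.
apply: (@le_trans _ _ ((c.+1 ^ c)%:R * N%:R ^+ d')); last first.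
  by rewrite ler_peMr // mulr_ge0 ?exprn_ge0 ?ler0n.
rewrite -natrX -natrM ler_nat /pb; apply: (@leq_trans ((c.+1 * N) ^ c)%N).
  by apply: leq_expl; rewrite mulSn leq_add2l leq_pmulr.
by rewrite expnMn leq_mul2l leq_pexp2l ?orbT // leq_addl.
Qed.
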